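(* There exists $C>0$ such that for every $\beta$ larger than some $\beta_0$ the following holds. Let $(W_1,\dots,W_r)$ be an admissible collection of walls, and let $\mathbf W=(W_z)_{z\in A}$ be an admissible wall collection (indexed by a set $A$ of faces of $\mathcal L_{0,n}$) such that $\rho(\mathbf W)\cap\bigcup_{i\le r}\rho(\mathrm{hull}(W_i))=\emptyset$. Then \[\mu^\mp_n\big(W_1,\dots,W_r\text{ are walls of }\mathcal I\mid\mathbf I_{\mathbf W}\big)\le\exp\Big(-(\beta-C)\sum_{i\le r}\mathfrak m(W_i)\Big).\]
   Context: Lattice conventions. Cells of $\mathbb Z^3$ are unit cubes with vertices in $\mathbb Z^3$; faces are unit squares with vertices in $\mathbb Z^3$; a face is horizontal if its normal is $\pm e_3$. Faces are $*$-adjacent if they share a vertex. $\mathcal L_0$ is the plane $\mathbb Z^2\times\{0\}$ (its faces and edges), $\mathcal L_{0,n}$ the faces of $\mathcal L_0$ in $[-n,n]^2\times\{0\}$, and $\rho(A)=\{(x_1,x_2,0):(x_1,x_2,x_3)\in A\}$. Ising measures. For $\beta>0$, $\mu^\mp_n$ is the limit as $m\to\infty$ of the Ising measures on spins of the cells of $[-n,n]^2\times[-m,m]$ with weight $\propto e^{-\beta\sum\mathbf 1\{\sigma_u\ne\sigma_v\}}$ over pairs of face-sharing cells at least one inside, with boundary spins $-1$ on outside cells with positive third coordinate and $+1$ with negative third coordinate. Interfaces. Given $\sigma$, the interface $\mathcal I$ is the $*$-connected component, among faces separating cells of different spin, containing the faces of $\mathcal L_0$ outside the box. Walls and ceilings.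 A face $f\in\mathcal I$ is a ceiling face if it is horizontal and no other face of $\mathcal I$ has the same projection; otherwise a wall face. Walls (ceilings) are maximal $*$-connected sets of wall (ceiling) faces. An edge/face $u$ of $\mathcal L_0$ is interior to a wall $W$ if $u$ is not in the unbounded component of the complement of $\rho(W)$. Face $x$ of $\mathcal L_0$ is assigned $W_x=W$ if $x$ is interior to $W$ and shares an edge with $\rho(W)$, else $W_x=\varnothing$. $\Theta_{\rm st}W$ translates $W$ vertically so its floor (adjacent ceiling corresponding to the unbounded component of the complement of $\rho(W)$) is at height 0; interfaces are in bijection with collections of standardized walls with pairwise vertex-disjoint projections (admissible collections). The excess area is $\mathfrak m(W)=|W|-|\{\text{faces of }\mathcal L_0\text{ in }\rho(W)\}|$. The projection of the hull of $W$, $\rho(\mathrm{hull}(W))$, is $\rho(W)$ together with all bounded connected components of its complement in $\mathcal L_0$. Conditioning. For an admissible wall collection $\mathbf W=(W_z)_{z\in A}$, $\mathbf I_{\mathbf W}$ is the event that for every $z\in A$ the wall assigned to $z$ in $\mathcal I$ is $W_z$. *)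

(* Defs.v *)
From HB Require Import structures.
From Stdlib Require Import Relations.
From mathcomp Require Import all_boot all_order all_algebra finmap.
From mathcomp Require Import all_classical all_reals all_analysis.
Set Implicit Arguments. Unset Strict Implicit. Unset Printing Implicit Defensive.
Import Order.TTheory GRing.Theory Num.Theory numFieldNormedType.Exports.
Local Open Scope ring_scope.


Definition i0 : 'I_3 := @Ordinal 3 0 isT.
Definition i1 : 'I_3 := @Ordinal 3 1 isT.
Definition i2 : 'I_3 := @Ordinal 3 2 isT.

(* points of Z^3; a cell (unit cube) is identified with its lower corner p,
   i.e. the cube p + [0,1]^3 *)
Definition pt := {ffun 'I_3 -> int}.
Definition mkpt (x y z : int) : pt :=
  [ffun k : 'I_3 => if val k == 0%N then x else if val k == 1%N then y else z].
Definition unitv (d : 'I_3) : pt := [ffun k => ((k == d) : nat)%:Z].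
Definition subpt (p q : pt) : pt := [ffun k => p k - q k].

(* a face (p, d) is the unit square with normal e_d and lower corner p:
   { v : v_d = p_d, p_k <= v_k <= p_k + 1 for k <> d } ;
   it separates the cells p and p - e_d. *)
Definition face := (pt * 'I_3)%type.

Definition is_vertex (f : face) (v : pt) : Prop :=
  forall k : 'I_3, if k == f.2 then v k = f.1 k
                   else (v k = f.1 k \/ v k = f.1 k + 1).

Definition star_adj (f g : face) : Prop :=
  exists v, is_vertex f v /\ is_vertex g v.

Definition horizontal (f : face) : bool := f.2 == i2.

Definition inL0 (f : face) : Prop := horizontal f /\ f.1 i2 = 0.
Definition in_sq (n : nat) (f : face) : Prop :=
  - (n%:Z) <= f.1 i0 <= n%:Z - 1 /\ - (n%:Z) <= f.1 i1 <= n%:Z - 1.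
Definition inL0n (n : nat) (f : face) : Prop := inL0 f /\ in_sq n f.
Definition inL0out (n : nat) (f : face) : Prop := inL0 f /\ ~ in_sq n f.

(* a spin field on all cells of Z^3; true = +1, false = -1 *)
Definition sepb (s : pt -> bool) (f : face) : bool :=
  s f.1 != s (subpt f.1 (unitv f.2)).

Definition interface (n : nat) (s : pt -> bool) (f : face) : Prop :=
  sepb s f /\ exists g, inL0out n g /\
    clos_refl_trans face (fun a b => sepb s a /\ sepb s b /\ star_adj a b) g f.

Definition ceil_face (I : face -> Prop) (f : face) : Prop :=
  I f /\ horizontal f /\
  forall g, I g -> horizontal g -> g <> f ->
    (g.1 i0, g.1 i1) <> (f.1 i0, f.1 i1).

Definition wall_face (I : face -> Prop) (f : face) : Prop :=
  I f /\ ~ ceil_face I f.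

Definition is_wall_of (I : face -> Prop) (W : {fset face}) : Prop :=
  exists f, wall_face I f /\
    forall g, g \in W <-> (wall_face I g /\
      clos_refl_trans face
        (fun a b => wall_face I a /\ wall_face I b /\ star_adj a b) f g).

(* ---------- projections onto L_0 (as a 2D cell complex) ----------
   The cells (vertices, edges, faces) of L_0 are encoded in doubled
   coordinates c : int * int : vertex (2x,2y), edges (2x+1,2y),(2x,2y+1),
   face (2x+1,2y+1) = [x,x+1]x[y,y+1]. A closed subset of the plane which is
   a union of closed lattice cells is encoded by the set of open cells it
   contains. *)
Definition cell2 := (int * int)%type.

(* open cells contained in the (closed) projection of the face f *)
Definition proj_face (f : face) (c : cell2) : Prop :=
  (if f.2 == i0 then c.1 = 2 * f.1 i0
   else 2 * f.1 i0 <= c.1 <= 2 * f.1 i0 + 2) /\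
  (if f.2 == i1 then c.2 = 2 * f.1 i1
   else 2 * f.1 i1 <= c.2 <= 2 * f.1 i1 + 2).

Definition rhoW (W : {fset face}) (c : cell2) : Prop :=
  exists f, f \in W /\ proj_face f c.

Definition oddz (x : int) : Prop := ~ (2 %| x)%Z.
(* c lies in the closure of d *)
Definition le_cell (c d : cell2) : Prop :=
  (c.1 = d.1 \/ (oddz d.1 /\ `|c.1 - d.1| = 1)) /\
  (c.2 = d.2 \/ (oddz d.2 /\ `|c.2 - d.2| = 1)).
Definition adj_cell (c d : cell2) : Prop := c <> d /\ (le_cell c d \/ le_cell d c).

Definition reach_compl (R : cell2 -> Prop) : relation cell2 :=
  clos_refl_trans cell2 (fun x y => ~ R x /\ ~ R y /\ adj_cell x y).

Definition in_unbounded (R : cell2 -> Prop) (u : cell2) : Prop :=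
  ~ R u /\ forall N : nat, exists v,
    (N%:Z <= `|v.1| \/ N%:Z <= `|v.2|) /\ reach_compl R u v.

(* rho(hull(W)) : rho(W) together with the bounded components of its
   complement; equivalently, the cells interior to W *)
Definition rho_hull (W : {fset face}) (c : cell2) : Prop :=
  ~ in_unbounded (rhoW W) c.

Definition face_cell (f : face) : cell2 := (2 * f.1 i0 + 1, 2 * f.1 i1 + 1).
Definition edge_of (x : face) (e : cell2) : Prop :=
  e = (2 * x.1 i0 + 1, 2 * x.1 i1) \/ e = (2 * x.1 i0 + 1, 2 * x.1 i1 + 2) \/
  e = (2 * x.1 i0, 2 * x.1 i1 + 1) \/ e = (2 * x.1 i0 + 2, 2 * x.1 i1 + 1).

Definition assigned_to (x : face) (W : {fset face}) : Prop :=
  rho_hull W (face_cell x) /\ exists e, edge_of x e /\ rhoW W e.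

Definition shift_face (h : int) (f : face) : face :=
  ([ffun k => f.1 k + ((k == i2) : nat)%:Z * h], f.2).

(* W' is the standardization of the wall W of I: translate W vertically so
   that its floor (the ceiling of I adjacent to W on the side of the
   unbounded component of the complement of rho(W)) is at height 0 *)
Definition std_of (I : face -> Prop) (W W' : {fset face}) : Prop :=
  exists g, ceil_face I g /\ (exists f, f \in W /\ star_adj f g) /\
    in_unbounded (rhoW W) (face_cell g) /\
    W' = [fset shift_face (- g.1 i2) f | f in W]%fset.

Definition boxT (n m : nat) := ('I_(2 * n) * 'I_(2 * n) * 'I_(2 * m))%type.
Definition cellpt (n m : nat) (b : boxT n m) : pt :=
  mkpt ((b.1.1 : nat)%:Z - n%:Z) ((b.1.2 : nat)%:Z - n%:Z) ((b.2 : nat)%:Z - m%:Z).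
Definition config (n m : nat) := {ffun boxT n m -> bool}.

Definition inside (n m : nat) (c : pt) : bool := [exists b : boxT n m, cellpt b == c].

(* spin field with the Dobrushin boundary condition: outside cells are -1
   if their third coordinate is positive, +1 if negative *)
Definition spin_ext (n m : nat) (sigma : config n m) (c : pt) : bool :=
  match [pick b : boxT n m | cellpt b == c] with
  | Some b => sigma b
  | None => (c i2 < 0)%R
  end.

(* all faces adjacent to a cell of the box have lower corner in this window *)
Definition windowT (n m : nat) :=
  ('I_(2 * n + 1) * 'I_(2 * n + 1) * 'I_(2 * m + 1) * 'I_3)%type.
Definition wface (n m : nat) (w : windowT n m) : face :=
  (mkpt ((w.1.1.1 : nat)%:Z - n%:Z) ((w.1.1.2 : nat)%:Z - n%:Z)
        ((w.1.2 : nat)%:Z - m%:Z), w.2).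

(* number of face-sharing pairs of cells, at least one inside, with
   different spins (pairs <-> the face they share) *)
Definition energy (n m : nat) (sigma : config n m) : nat :=
  #|[set w : windowT n m |
      (inside n m (wface w).1 ||
       inside n m (subpt (wface w).1 (unitv (wface w).2)))
      && sepb (spin_ext sigma) (wface w)]|%N.

Definition weight (R : realType) (beta : R) (n m : nat) (sigma : config n m) : R :=
  expR (- beta * (energy sigma)%:R).

Definition mu_fin (R : realType) (beta : R) (n m : nat)
    (E : (pt -> bool) -> Prop) : R :=
  (\sum_(sigma : config n m | `[< E (spin_ext sigma) >]) weight beta sigma)
  / (\sum_(sigma : config n m) weight beta sigma).

Definition mu (R : realType) (beta : R) (n : nat) (E : (pt -> bool) -> Prop) : R :=
  limn (fun m : nat => mu_fin beta n m E).

Definition cond_prob (R : realType) (beta : R) (n : nat)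
    (E F : (pt -> bool) -> Prop) : R :=
  mu beta n (fun s => E s /\ F s) / mu beta n F.

Definition is_std_wall (W : {fset face}) : Prop :=
  exists (n m : nat) (sigma : config n m) (W0 : {fset face}),
    is_wall_of (interface n (spin_ext sigma)) W0 /\
    std_of (interface n (spin_ext sigma)) W0 W.

Definition vertex_disjoint (W W' : {fset face}) : Prop :=
  forall c : cell2, (2 %| c.1)%Z -> (2 %| c.2)%Z -> rhoW W c -> rhoW W' c -> False.

Definition admissible_walls (r : nat) (Ws : 'I_r -> {fset face}) : Prop :=
  (forall i, is_std_wall (Ws i)) /\
  (forall i j, i != j -> vertex_disjoint (Ws i) (Ws j)).

(* indexed collection (W_z)_{z in A}, W_z possibly empty (no wall) *)
Definition admissible_family (A : {fset face}) (WA : face -> {fset face}) : Prop :=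
  (forall z, z \in A -> WA z = fset0 \/ is_std_wall (WA z)) /\
  (forall z z', z \in A -> z' \in A -> WA z <> WA z' ->
     vertex_disjoint (WA z) (WA z')).

Definition rho_family (A : {fset face}) (WA : face -> {fset face}) (c : cell2) : Prop :=
  exists z, z \in A /\ rhoW (WA z) c.

(* excess area m(W) = |W| - #(faces of L_0 in rho(W)) *)
Definition excess (R : realType) (W : {fset face}) : R :=
  (#|` W|)%:R - (#|` [fset face_cell f | f in W & horizontal f]%fset|)%:R.

Definition walls_event (n r : nat) (Ws : 'I_r -> {fset face}) (s : pt -> bool) : Prop :=
  forall i, exists W, is_wall_of (interface n s) W /\ std_of (interface n s) W (Ws i).

Definition IW_event (n : nat) (A : {fset face}) (WA : face -> {fset face})
    (s : pt -> bool) : Prop :=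
  forall z, z \in A ->
    if WA z == fset0 then
      ~ (exists W, is_wall_of (interface n s) W /\ assigned_to z W)
    else
      exists W, is_wall_of (interface n s) W /\ assigned_to z W /\
                std_of (interface n s) W (WA z).

(* Main.v *)
(* Write lam = e^-beta. An interface I has weight lam^|I| Xi(I), where Xi(I) sums lam^|G| over the
   even sets G of faces that share no vertex with I. Deleting a wall K of I (and shifting
   vertically whatever K encloses) gives an interface J with |I| - |J| = m(K) and the same other
   standard walls; I is recovered from J, K and the spins next to the faces of K. To compare Xi(I)
   with Xi(J), the enclosed zones are shifted one at a time: exchanging components between two
   independent copies shows that a shift only costs the connected sets that reach from the zone to
   a vertex of rho(K), or very high up. Hence Xi(I) <= exp(|K| + sum_V phi(V)) Xi(J), where V runs
   over the walls of J nested in K and phi(V) decays with the distance from V to rho(K). The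
   factors exp(phi(V)) are removed by expanding prod_V (1 + (exp(phi(V)) - 1) 1[V is a wall of J])
   and applying the bound to the walls V, whose extent is smaller: this costs at most exp(|K|)
   because sum_V (exp(phi(V)) - 1) e^(-(beta - C) m(V)) <= |K|. As |K| <= 2 m(K), all these errors
   are absorbed by C. Deletion can increase heights, so the argument is run for interfaces with at
   most m/4 faces in the box; for fixed n, the others have vanishing probability as m grows. *)

(* Everything rests on the fact that two wall faces over a common vertex of the plane lie in the
   same wall. It makes the height jump of a wall a closed form on the columns, so that deleting the
   wall amounts to subtracting a primitive of this form, and it keeps the other walls away from the
   columns that are flattened. It is proved by counting mod 2 the horizontal faces of a wall over a
   column that is not a ceiling: at most one wall has an odd count, and a wall has odd counts around
   all its vertices. Removing exp(phi(V)) applies the bound to V in the presence of the walls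
   already imposed, which fails if V is one of them. So the bound for K is proved when no imposed
   wall is nested in K ([isfree]). The conditioned walls comply because they avoid the hulls, and
   the W_i are deleted by increasing extent, so that those still imposed are never nested in the
   current one. The value C = 8: the errors are exp(|K|) from comparing Xi, exp(|K|) from the
   expansion and 2^|K| from recovering I, in all at most exp(3|K|) <= exp(6 m(K)). *)
Require Import Defs.
From HB Require Import structures.
From Stdlib Require Import Relations.
From mathcomp Require Import all_boot all_order all_algebra finmap.
From mathcomp Require Import all_classical all_reals all_analysis.
From mathcomp Require Import zify ring lra.
Set Implicit Arguments. Unset Strict Implicit. Unset Printing Implicit Defensive.
Import Order.TTheory GRing.Theory Num.Theory numFieldNormedType.Exports.
Local Open Scope ring_scope.

(** * Lattice animals *)
(** Most comparisons of partition functions below reduce to an injection of configurations that does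
    not lower the weights. *)
Lemma ler_sum_inj (R : numDomainType) (T T' : eqType) (s : seq T) (s' : seq T')
    (f : T -> T') (F : T -> R) (F' : T' -> R) :
  uniq s -> {in s &, injective f} -> (forall x, x \in s -> f x \in s') ->
  (forall x, x \in s -> F x <= F' (f x)) -> (forall y, y \in s' -> 0 <= F' y) ->
  \sum_(x <- s) F x <= \sum_(y <- s') F' y.
Proof.
elim: s s' => [|x s IH] s' /=.
  by move=> _ _ _ _ F0; rewrite big_nil big_seq; apply: sumr_ge0.
move=> /andP[xs us] inj sub le F0.
have fx : f x \in s' by apply: sub; rewrite inE eqxx.
rewrite big_cons (perm_big _ (perm_to_rem fx)) big_cons /=.
apply: lerD; first by apply: le; rewrite inE eqxx.
apply: IH => //.
- by move=> a b as_ bs; apply: inj; rewrite inE ?as_ ?bs orbT.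
- move=> a as_; have : f a \in s' by apply: sub; rewrite inE as_ orbT.
  rewrite (perm_mem (perm_to_rem fx)) inE => /orP[/eqP e|//].
  have : a = x by apply: inj; rewrite // inE ?eqxx ?as_ ?orbT.
  by move=> ax; move: xs; rewrite -ax as_.
- by move=> a as_; apply: le; rewrite inE as_ orbT.
- by move=> y /mem_rem; apply: F0.
Qed.

Lemma ler_sum_uniq_sub (R : numDomainType) (T : eqType) (s s' : seq T) (F : T -> R) :
  uniq s -> {subset s <= s'} -> (forall x, x \in s' -> 0 <= F x) ->
  \sum_(x <- s) F x <= \sum_(x <- s') F x.
Proof. by move=> us sub F0; apply: (@ler_sum_inj _ _ _ _ _ id). Qed.

Lemma sum_fiber (R : nmodType) (T T' : eqType) (s : seq T) (f : T -> T') (F : T -> R) :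
  \sum_(x <- s) F x = \sum_(y <- undup (map f s)) \sum_(x <- s | f x == y) F x.
Proof.
rewrite (exchange_big_dep xpredT) //= big_seq [RHS]big_seq; apply: eq_bigr => x xs.
under eq_bigl do rewrite eq_sym.
rewrite -big_filter (_ : [seq i <- _ | i == f x] = [:: f x]) ?big_seq1 //.
have fs : f x \in undup (map f s) by rewrite mem_undup map_f.
apply: perm_small_eq => //; apply: uniq_perm; rewrite ?filter_uniq ?undup_uniq //.
move=> y; rewrite mem_filter inE; case: eqP => // ->; exact: fs.
Qed.

Lemma prodr_le_expR (R : realType) (T : eqType) (s : seq T) (F : T -> R) :
  (forall x, x \in s -> 0 <= F x) -> \prod_(x <- s) (1 + F x) <= expR (\sum_(x <- s) F x).
Proof.
elim: s => [|x s IH] F0; first by rewrite !big_nil expR0.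
rewrite !big_cons expRD; apply: ler_pM.
- by rewrite addr_ge0 // F0 // inE eqxx.
- by rewrite big_seq; apply: prodr_ge0 => y ys; rewrite addr_ge0 // F0 // inE ys orbT.
- exact: expR_ge1Dx.
- by apply: IH => y ys; rewrite F0 // inE ys orbT.
Qed.

Lemma size_undup_le (T : choiceType) (s : seq T) (X : {fset T}) :
  {subset s <= X} -> (size (undup s) <= #|` X|)%N.
Proof. by move=> sX; apply: uniq_leq_size; rewrite ?undup_uniq // => x; rewrite mem_undup; apply: sX. Qed.

Section Connected.
Variables (T : choiceType) (e : rel T).
Hypothesis esym : symmetric e.

Definition crel (X : {fset T}) (a b : T) : Prop := a \in X /\ b \in X /\ e a b.
Definition fconn X := clos_refl_trans T (crel X).
Definition connected (X : {fset T}) : Prop :=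
  forall a b, a \in X -> b \in X -> fconn X a b.
Definition iscomp (X U : {fset T}) : Prop :=
  (X `<=` U)%fset /\ connected X /\ (forall a b, a \in X -> b \in U -> e a b -> b \in X).

Lemma fconn_sym X a b : fconn X a b -> fconn X b a.
Proof.
elim=> {a b} [a b [aX [bX ab]]|a|a b c _ h1 _ h2].
- by apply: rt_step; split=> //; split=> //; rewrite esym.
- exact: rt_refl.
- exact: (rt_trans _ _ _ b).
Qed.

Lemma fconn_stay (U : {fset T}) (P : T -> Prop) a b :
  (forall x y, x \in U -> y \in U -> P x -> e x y -> P y) ->
  P a -> fconn U a b -> P b.
Proof.
move=> st Pa ab; elim: ab Pa => {a b} [a b [aX [bX ab]] Pa|//|a b c _ ab _ bc Pa].
- exact: st Pa ab.
- by apply: bc; apply: ab.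
Qed.

Lemma fconn_mem (U : {fset T}) a b : a \in U -> fconn U a b -> b \in U.
Proof. by move=> aU; apply: (@fconn_stay U (fun x => x \in U)). Qed.

Definition comp (U : {fset T}) (a : T) : {fset T} := [fset b in U | `[< fconn U a b >]]%fset.

Lemma compP U a b : a \in U -> reflect (fconn U a b) (b \in comp U a).
Proof.
move=> aU; apply: (iffP idP); rewrite !inE /=.
  by case/andP => _ /asboolP.
move=> ab; rewrite (fconn_mem aU ab); exact/asboolP.
Qed.

Lemma comp_sub U a : (comp U a `<=` U)%fset.
Proof. by apply/fsubsetP => x; rewrite !inE => /andP[]. Qed.

Lemma iscomp_comp U a : a \in U -> iscomp (comp U a) U.
Proof.
move=> aU; split; first exact: comp_sub.
have cl x y : x \in comp U a -> y \in U -> e x y -> y \in comp U a.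
  move=> /(compP _ aU) ax yU xy; apply/compP => //.
  apply: (rt_trans _ _ _ x _ ax); apply: rt_step; split=> //.
  exact: fconn_mem ax.
split=> // x y xC yC.
have h z : fconn U a z -> fconn (comp U a) a z.
  move=> az; have : z \in comp U a /\ fconn (comp U a) a z; last by case.
  apply: (@fconn_stay U (fun z => z \in comp U a /\ fconn (comp U a) a z) a) az.
  - move=> u v uU vU [uC au] uv; have vC := cl _ _ uC vU uv; split=> //.
    by apply: (rt_trans _ _ _ u _ au); apply: rt_step.
  - by split; [apply/compP => //; apply: rt_refl|apply: rt_refl].
move: xC yC => /(compP _ aU)/h ax /(compP _ aU)/h ay.
apply: (rt_trans _ _ _ a) => //; exact: fconn_sym.
Qed.

Lemma mem_comp U a : a \in U -> a \in comp U a.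
Proof. by move=> aU; apply/compP => //; apply: rt_refl. Qed.

Hypothesis erefl : reflexive e.

(** As long as a point of [X] is missed, some edge [a], [b] leaves the visited set, and the detour
    [a], [b], [a] gains a point at the price of two steps. Reflexivity then pads the walk to an
    exact length, so that walks can be coded by tuples. *)
Lemma walk_cover (X : {fset T}) (f : T) : f \in X -> connected X ->
  exists p, [/\ path e f p, {subset f :: p <= X}, {subset X <= f :: p} & size p = (2 * #|` X|)%N].
Proof.
move=> fX cX.
suff [p [pp sX Xs sz]] : exists p, [/\ path e f p, {subset f :: p <= X},
    {subset X <= f :: p} & (size p <= 2 * #|` X|)%N].
  exists (p ++ nseq (2 * #|` X| - size p) (last f p)).
  have lp : last f p \in X by apply: sX; apply: mem_last.
  split.
  - rewrite cat_path pp /=; elim: (_ - _)%N => //= k ->; by rewrite erefl.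
  - move=> x; rewrite -cat_cons mem_cat => /orP[/sX //|].
    by rewrite mem_nseq => /andP[_ /eqP ->].
  - by move=> x /Xs; rewrite -cat_cons mem_cat => ->.
  - by rewrite size_cat size_nseq subnKC.
suff h k : exists p, [/\ path e f p, {subset f :: p <= X}, (size p <= 2 * size (undup (f :: p)))%N &
     {subset X <= f :: p} \/ (k <= size (undup (f :: p)))%N].
  have [p [pp sX sz [Xs|big]]] := h #|` X|.+1.
    exists p; split=> //; apply: leq_trans sz _.
    by apply: leq_mul => //; apply: size_undup_le.
  exfalso; move: big; rewrite ltnNge => /negP[].
  exact: size_undup_le.
elim: k => [|k [p [pp sX sz [Xs|big]]]].
- exists [::]; split=> //; last by right.
  by move=> x; rewrite inE => /eqP ->.
- by exists p; split=> //; left.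
have [Xs|/existsNP[y /not_implyP[yX yp]]] := pselect {subset X <= f :: p}.
  by exists p; split=> //; left.
have [a [b [ap bp aX bX ab]]] : exists a b, [/\ a \in f :: p, b \notin f :: p, a \in X, b \in X & e a b].
  apply: contrapT => none; apply: yp.
  apply: (@fconn_stay X (fun z => z \in f :: p) f) (cX f y fX yX); last exact: mem_head.
  move=> u v uX vX up uv; apply: contrapT => vp.
  by apply: none; exists u, v; split=> //; apply/negP.
case/splitPl: ap pp sX sz big bp => p1 p2 lp1 pp sX sz big bp.
have pp' : path e f (p1 ++ b :: a :: p2).
  move: pp; rewrite !cat_path /= lp1 => /andP[-> ->]; by rewrite ab esym ab.
have sX' : {subset f :: (p1 ++ b :: a :: p2) <= X}.
  move=> x; rewrite -cat_cons mem_cat !inE => /orP[h|/orP[/eqP->//|/orP[/eqP->//|h]]].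
    by apply: sX; rewrite -cat_cons mem_cat inE h.
  by apply: sX; rewrite -cat_cons mem_cat h orbT.
have us : (size (undup (f :: (p1 ++ p2))) < size (undup (f :: (p1 ++ b :: a :: p2))))%N.
  have -> : (size (undup (f :: p1 ++ p2))).+1 = size (b :: undup (f :: p1 ++ p2)) by [].
  apply: uniq_leq_size.
    by rewrite cons_uniq mem_undup bp undup_uniq.
  move=> x; rewrite !inE !mem_undup => /orP[/eqP->|].
    by rewrite -cat_cons mem_cat !inE eqxx orbT.
  rewrite -!cat_cons !mem_cat => /orP[->//|h]; by rewrite !inE h !orbT.
exists (p1 ++ b :: a :: p2); split=> //.
  move: sz us; rewrite !size_cat /=; lia.
right; exact: leq_ltn_trans big us.
Qed.

Variables (nb : T -> seq T) (Delta : nat).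
Hypothesis enb : forall a b, e a b -> b \in nb a.
Hypothesis nbsz : forall a, (size (nb a) <= Delta)%N.

Fixpoint decode (a : T) (w : seq nat) : seq T :=
  if w is i :: w' then let b := nth a (nb a) i in b :: decode b w' else [::].

Lemma decodeP a p : path e a p -> exists w : seq 'I_Delta, size w = size p /\ decode a (map val w) = p.
Proof.
elim: p a => [|b p IH] a /=; first by exists [::].
move=> /andP[/enb ab /IH[w [sw dw]]].
have lt : (index b (nb a) < Delta)%N by apply: leq_trans (nbsz a); rewrite index_mem.
by exists (Ordinal lt :: w); rewrite /= sw nth_index // dw.
Qed.

(** [X] is the set of points of a covering walk from [f], and a walk is a word of neighbour indices
    below [Delta]. *)
Lemma count_connected (f : T) (k : nat) (s : seq {fset T}) : uniq s ->
  (forall X, X \in s -> [/\ f \in X, connected X & #|` X| = k]) ->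
  (size s <= Delta ^ (2 * k))%N.
Proof.
move=> us h.
pose g (w : (2 * k).-tuple 'I_Delta) : {fset T} := [fset x in f :: decode f (map val w)]%fset.
have -> : (Delta ^ (2 * k))%N = size (codom g) by rewrite size_codom card_tuple card_ord.
apply: uniq_leq_size => // X /h [fX cX kX].
have [p [pp pX Xp sp]] := walk_cover fX cX.
have [w [sw dw]] := decodeP pp.
have sw' : size w == (2 * k)%N by rewrite sw sp kX.
apply/codomP; exists (Tuple sw'); apply/fsetP => x.
rewrite /g /= in_fset dw; apply/idP/idP => [/Xp//|/pX//].
Qed.

(* the weights are summable as soon as they beat the [Delta^2k] connected sets of size k *)
Lemma sum_connected (R : realFieldType) (f : T) (lam : R) (s : seq {fset T}) : uniq s ->
  0 <= lam -> (Delta ^ 2)%:R * lam <= 2^-1 ->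
  (forall X, X \in s -> f \in X /\ connected X) ->
  \sum_(X <- s) lam ^+ #|` X| <= 2 * ((Delta ^ 2)%:R * lam).
Proof.
move=> us l0 lam2 h; set r := _ * lam.
have r0 : 0 <= r by rewrite mulr_ge0.
rewrite (sum_fiber _ (fun X : {fset T} => #|` X|)).
apply: (@le_trans _ _ (\sum_(k <- undup [seq #|` X| | X <- s]) r ^+ k)).
  rewrite big_seq [leRHS]big_seq; apply: ler_sum => k _.
  rewrite (eq_bigr (fun=> lam ^+ k)); last by move=> X /eqP->.
  rewrite -big_filter big_const_seq count_predT iter_addr addr0.
  rewrite -[lam ^+ k *+ _]mulr_natl /r exprMn -natrX -expnM ler_wpM2r ?exprn_ge0 //.
  rewrite ler_nat; apply: (@count_connected f); rewrite ?filter_uniq // => X.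
  by rewrite mem_filter => /andP[/eqP <-] /h[].
set N := (\max_(X <- s) #|` X|)%N.
apply: (@le_trans _ _ (\sum_(k <- iota 1 N) r ^+ k)).
  apply: ler_sum_uniq_sub; rewrite ?undup_uniq //; last by move=> k _; rewrite exprn_ge0.
  move=> k; rewrite mem_undup => kin; have [X Xs ->] := @mapP _ _ (fun X : {fset T} => #|` X|) s k kin; rewrite mem_iota add1n ltnS.
  have [fX _] := h _ Xs.
  rewrite cardfs_gt0 (@leq_bigmax_seq _ s xpredT (fun X : {fset T} => #|` X|) X) // andbT.
  by apply/fset0Pn; exists f.
have -> : \sum_(k <- iota 1 N) r ^+ k = r * \sum_(k < N) r ^+ k.
  by rewrite big_distrr -(addn0 1%N) iotaDl big_map -{1}(subn0 N) big_mkord; apply: eq_bigr => k _; rewrite exprD.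
rewrite mulrC ler_wpM2r //.
have : \sum_(k < N) r ^+ k <= 2 - 2 * r ^+ N.
  elim: {h us s} N => [|N IH]; first by rewrite big_ord0 expr0; lra.
  rewrite big_ord_recr /= exprS.
  have p0 : 0 <= r ^+ N by rewrite exprn_ge0.
  have : 0 <= r ^+ N * (2^-1 - r) by rewrite mulr_ge0 // subr_ge0.
  lra.
have p0 : 0 <= r ^+ N by rewrite exprn_ge0.
lra.
Qed.
End Connected.

(** * Exchanging constraints between two copies *)

Section Swap.
Local Open Scope fset_scope.
Variables (R : realFieldType) (T : choiceType) (e : rel T) (ev : pred {fset T}) (lam : R).
Hypothesis esym : symmetric e.
Hypothesis lam0 : 0 <= lam.
Hypothesis lam1 : lam <= 1.
Hypothesis ev_split : forall X C : {fset T}, ev X -> C `<=` X ->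
  (forall a b, a \in C -> b \in X -> e a b -> b \in C) -> ev C.
Hypothesis ev_join : forall X Y : {fset T}, ev X -> ev Y ->
  (forall a b, a \in X -> b \in Y -> ~~ e a b) -> ev (X `|` Y).

Definition Xi (A : {fset T}) : R :=
  \sum_(X <- [seq X <- fpowerset A | ev X]) lam ^+ #|` X|.

Definition evpairs (A B : {fset T}) : seq ({fset T} * {fset T}) :=
  [seq (X, Y) | X <- [seq X <- fpowerset A | ev X], Y <- [seq Y <- fpowerset B | ev Y]].
Definition pwt (p : {fset T} * {fset T}) : R := lam ^+ (#|` p.1| + #|` p.2|).
Definition pun (p : {fset T} * {fset T}) : {fset T} := p.1 `|` p.2.

Lemma mem_evpairs A B p :
  (p \in evpairs A B) = [&& p.1 `<=` A, ev p.1, p.2 `<=` B & ev p.2].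
Proof.
case: p => X Y /=; apply/allpairsP/and4P => [[[x y] /= [h1 h2 [-> ->]]]|[h1 h2 h3 h4]].
  by move: h1 h2; rewrite !mem_filter !fpowersetE => /andP[? ?] /andP[? ?].
by exists (X, Y); rewrite !mem_filter !fpowersetE h1 h2 h3 h4.
Qed.

Lemma uniq_evpairs A B : uniq (evpairs A B).
Proof.
by apply: allpairs_uniq; rewrite ?filter_uniq ?fset_uniq // => -[x y] [x' y'] _ _ [-> ->].
Qed.

Lemma Xi_mul A B : Xi A * Xi B = \sum_(p <- evpairs A B) pwt p.
Proof.
rewrite /Xi big_distrlr /evpairs big_allpairs /=.
by apply: eq_bigr => X _; apply: eq_bigr => Y _; rewrite /pwt exprD.
Qed.

Lemma pwt_ge0 p : 0 <= pwt p. Proof. exact: exprn_ge0. Qed.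

Definition Znocomp (A B : {fset T}) (l : seq {fset T}) : R :=
  \sum_(p <- [seq p <- evpairs A B | all (fun X => ~~ `[< iscomp e X (pun p) >]) l]) pwt p.

Lemma remove_comp A B p X : iscomp e X (pun p) -> p \in evpairs A B ->
  (p.1 `\` X, p.2 `\` X) \in evpairs A B.
Proof.
move=> [XU [_ cl]]; rewrite !mem_evpairs /= => /and4P[h1 h2 h3 h4].
have h (Z : {fset T}) : Z `<=` pun p -> ev Z -> ev (Z `\` X).
  move=> /fsubsetP ZU evZ; apply: (ev_split evZ); first exact: fsubsetDl.
  move=> a b; rewrite !in_fsetD => /andP[aX aZ] bZ ab; rewrite bZ andbT.
  by apply: contra aX => bX; apply: (cl b a) => //; [exact: ZU|rewrite esym].
rewrite !(fsubset_trans (fsubsetDl _ _)) //= !h //.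
- exact: fsubsetUr.
- exact: fsubsetUl.
Qed.

Lemma comp_remove (U V X : {fset T}) :
  iscomp e X U -> V = U `\` X -> forall Y, iscomp e Y V -> iscomp e Y U.
Proof.
move=> [XU [_ clX]] -> Y [/fsubsetP YV [cY clY]]; split; last split=> //.
  by apply/fsubsetP => y /YV; rewrite in_fsetD => /andP[].
move=> a b aY bU ab; apply: (clY a) => //; rewrite in_fsetD bU andbT.
have := YV _ aY; rewrite in_fsetD => /andP[aX aU].
by apply: contra aX => bX; apply: (clX b); rewrite // esym.
Qed.

(** If [X] is a component of the union, erase it from both copies and remember its two traces. There
    are [4 ^ |X|] pairs of traces, of weight at most [lam ^ |X|] because they cover [X]. Erasing
    creates no new component, so the sets of [l] stay excluded. *)
Lemma Znocomp_step A B X l : X != fset0 ->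
  Znocomp A B l <= (1 + (4 * lam) ^+ #|` X|) * Znocomp A B (X :: l).
Proof.
move=> X0.
rewrite mulrDl mul1r {1}/Znocomp (bigID (fun p => `[< iscomp e X (pun p) >])) /= addrC.
apply: lerD.
  rewrite -big_filter -filter_predI le_eqVlt; apply/orP; left; apply/eqP.
  by rewrite /Znocomp; congr (\sum_(p <- _) _).
rewrite -big_filter -filter_predI.
set s := seq.filter _ _; pose S := [seq p <- evpairs A B | all (fun X => ~~ `[< iscomp e X (pun p) >]) (X :: l)].
pose s' := [seq (q, r) | q <- S, r <- [seq (a, b) | a <- fpowerset X, b <- fpowerset X]].
pose f (p : {fset T} * {fset T}) := ((p.1 `\` X, p.2 `\` X), (p.1 `&` X, p.2 `&` X)).
apply: (@le_trans _ _ (\sum_(y <- s') pwt y.1 * lam ^+ #|` X|)); last first.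
  rewrite /s' big_allpairs_dep /= /Znocomp -/S big_distrr /=; apply: ler_sum => p _.
  rewrite big_const_seq count_predT iter_addr addr0 size_allpairs -[X in X <= _]mulr_natl.
  rewrite !card_fpowerset exprMn.
  rewrite (_ : (2 ^ #|` X| * 2 ^ #|` X|)%:R = 4 ^+ #|` X| :> R); last by rewrite natrM !natrX -exprMn -natrM.
  by rewrite le_eqVlt; apply/orP; left; apply/eqP; ring.
apply: (@ler_sum_inj _ _ _ _ _ f).
- by rewrite filter_uniq // uniq_evpairs.
- move=> [a b] [a' b'] _ _ [h1 h2 h3 h4]; congr (_, _).
    by rewrite -(fsetID X a) -(fsetID X a') h3 h1.
  by rewrite -(fsetID X b) -(fsetID X b') h4 h2.
- move=> p; rewrite mem_filter /= => /andP[/andP[/asboolP cX al] pin].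
  apply/allpairsPdep; exists (p.1 `\` X, p.2 `\` X), (p.1 `&` X, p.2 `&` X); split=> //.
    rewrite mem_filter (remove_comp cX pin) andbT /=.
    have eU : pun (p.1 `\` X, p.2 `\` X) = pun p `\` X by rewrite /pun /= fsetDUl.
    apply/andP; split.
      apply/asboolPn => -[/fsubsetP h _]; case/fset0Pn: X0 => x xX.
      by have := h _ xX; rewrite eU in_fsetD xX.
    apply/allP => Y Yl; apply/asboolPn => h; move/allP: al => /(_ _ Yl) /asboolPn; apply.
    exact: comp_remove cX eU _ h.
  by apply/allpairsPdep; exists (p.1 `&` X), (p.2 `&` X); rewrite !fpowersetE !fsubsetIr.
- move=> p; rewrite mem_filter /= => /andP[/andP[/asboolP [XU _] al] pin].
  rewrite /pwt /= -exprD; apply: ler_wiXn2l => //.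
  rewrite -(cardfsID X p.1) -(cardfsID X p.2).
  have : (#|` X| <= #|` p.1 `&` X| + #|` p.2 `&` X|)%N.
    apply: leq_trans (_ : #|` (p.1 `&` X) `|` (p.2 `&` X)| <= _)%N; last by rewrite cardfsU leq_subr.
    by rewrite -fsetIUl (fsetIidPr XU).
  by move=> h; rewrite [leqRHS]addnACA [leqLHS]addnC leq_add2r.
- by move=> y _; rewrite mulr_ge0 ?pwt_ge0 ?exprn_ge0.
Qed.

Lemma Xi_pairs_nocomp A B l : all (fun X => X != fset0) l ->
  Xi A * Xi B <= \prod_(X <- l) (1 + (4 * lam) ^+ #|` X|) * Znocomp A B l.
Proof.
move=> l0; rewrite Xi_mul.
suff h l1 l2 : all (fun X => X != fset0) l1 ->
    Znocomp A B l2 <= \prod_(X <- l1) (1 + (4 * lam) ^+ #|` X|) * Znocomp A B (l1 ++ l2).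
  have := h l [::] l0; rewrite cats0; apply: le_trans.
  by rewrite /Znocomp (@eq_filter _ _ xpredT) // filter_predT.
elim: l1 l2 => [|X l1 IH] l2 /=; first by rewrite big_nil mul1r.
case/andP=> X0 al; rewrite big_cons -mulrA.
have P0 : 0 <= (1 + (4 * lam) ^+ #|` X|)%R by rewrite addr_ge0 // exprn_ge0 // mulr_ge0.
apply: le_trans (Znocomp_step A B l2 X0) _.
apply: ler_wpM2l => //; apply: le_trans (IH (X :: l2) al) _.
rewrite ler_wpM2l //.
  by apply: prodr_ge0 => Y _; rewrite addr_ge0 // exprn_ge0 // mulr_ge0.
rewrite le_eqVlt /Znocomp; apply/orP; left; apply/eqP; congr (\sum_(p <- _) _).
by apply: eq_filter => p; rewrite all_cat /= [RHS]andbC all_cat -andbA [in RHS]andbC; case: (~~ _); case: all; case: all.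
Qed.

Variables (A B : {fset T}) (k : pred T).

(** The obstructions to the exchange: a component that meets [k] may change copies unless it
    contains a face allowed in only one of [A] and [B]. *)
Definition badpoly (X : {fset T}) : Prop :=
  [/\ connected e X, exists2 f, f \in X & k f &
      exists2 f, f \in X & (f \in A) != (f \in B)].

Definition badlist : seq {fset T} := [seq X <- fpowerset (A `|` B) | `[< badpoly X >]].

Let Ak := [fset f in A | ~~ k f].
Let Bk := [fset f in B | ~~ k f].

Definition kcomp (p : {fset T} * {fset T}) : {fset T} :=
  [fset g in pun p | `[< exists f, [/\ f \in pun p, k f & fconn e (pun p) f g] >]].
Definition kswap (p : {fset T} * {fset T}) : {fset T} * {fset T} :=
  ((p.1 `\` kcomp p) `|` (p.2 `&` kcomp p), (p.2 `\` kcomp p) `|` (p.1 `&` kcomp p)).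

Lemma kswap_un p : pun (kswap p) = pun p.
Proof.
apply/fsetP => x; rewrite /pun /kswap /= !(in_fsetU, in_fsetD, in_fsetI).
by case: (x \in p.1); case: (x \in p.2); case: (x \in kcomp p).
Qed.

(** The components are taken in the union of the two copies, which the exchange preserves. *)
Lemma kswapK : involutive kswap.
Proof.
move=> p; have eC : kcomp (kswap p) = kcomp p by rewrite /kcomp kswap_un.
rewrite {1}/kswap eC [RHS]surjective_pairing; congr (_, _); apply/fsetP => x;
  rewrite /kswap /= !(in_fsetU, in_fsetD, in_fsetI);
  by case: (x \in p.1); case: (x \in p.2); case: (x \in kcomp p).
Qed.

Lemma kcomp_closed p a b : a \in kcomp p -> b \in pun p -> e a b -> b \in kcomp p.
Proof.
rewrite in_fset inE /= => /andP[aU /asboolP[f [fU kf fa]]] bU ab.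
rewrite in_fset inE /= bU; apply/asboolP; exists f; split=> //.
by apply: (rt_trans _ _ _ a _ fa); apply: rt_step.
Qed.

Lemma ev_exchange p (X Y : {fset T}) : X `<=` pun p -> Y `<=` pun p -> ev X -> ev Y ->
  ev ((X `\` kcomp p) `|` (Y `&` kcomp p)).
Proof.
move=> /fsubsetP XU /fsubsetP YU eX eY; apply: ev_join.
- apply: (ev_split eX); first exact: fsubsetDl.
  move=> a b; rewrite !in_fsetD => /andP[aC aX] bX ab; rewrite bX andbT.
  by apply: contra aC => bC; apply: (kcomp_closed bC); [exact: XU|rewrite esym].
- apply: (ev_split eY); first exact: fsubsetIl.
  move=> a b; rewrite !in_fsetI => /andP[aY aC] bY ab; rewrite bY /=.
  by apply: (kcomp_closed aC); first exact: YU.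
- move=> a b; rewrite in_fsetD in_fsetI => /andP[aC aX] /andP[bY bC].
  by apply: contra aC => ab; apply: (kcomp_closed bC); [exact: XU|rewrite esym].
Qed.

Lemma kswap_weight p : pwt (kswap p) = pwt p.
Proof.
rewrite /pwt /kswap /=; apply: (congr1 (GRing.exp lam)).
have h (X Y C : {fset T}) : #|` (X `\` C) `|` (Y `&` C)| = (#|` X `\` C| + #|` Y `&` C|)%N.
  rewrite cardfsU [X in (_ - X)%N](_ : _ = 0%N) ?subn0 //; apply/eqP.
  rewrite cardfs_eq0; apply/eqP/fsetP => x; rewrite !(in_fsetI, in_fsetD).
  by case: (x \in C); rewrite ?andbF.
rewrite !h -(cardfsID (kcomp p) p.1) -(cardfsID (kcomp p) p.2).
by rewrite [LHS]addnACA [RHS]addnC [in RHS]addnACA addnC [X in (_ + X)%N]addnC -addnACA addnC.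
Qed.

(* swapping, in the two copies, the components that meet [k] moves the constraint
   [~~ k] from the first copy to the second one *)
Lemma Xi_swap :
  Xi Ak * Xi B <= \prod_(X <- badlist) (1 + (4 * lam) ^+ #|` X|) * (Xi A * Xi Bk).
Proof.
have nz : all (fun X => X != fset0) badlist.
  apply/allP => X; rewrite mem_filter => /andP[/asboolP[_ [f fX _] _] _].
  by apply/fset0Pn; exists f.
apply: le_trans (Xi_pairs_nocomp _ _ nz) _; apply: ler_wpM2l.
  by apply: prodr_ge0 => Y _; rewrite addr_ge0 // exprn_ge0 // mulr_ge0.
rewrite Xi_mul; apply: (@ler_sum_inj _ _ _ _ _ kswap).
- by rewrite filter_uniq // uniq_evpairs.
- by move=> p q _ _; apply: inv_inj; apply: kswapK.
- move=> p; rewrite mem_filter => /andP[/allP good].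
  rewrite !mem_evpairs => /and4P[/fsubsetP s1 e1 /fsubsetP s2 e2] /=.
  have p1U : p.1 `<=` pun p := fsubsetUl _ _.
  have p2U : p.2 `<=` pun p := fsubsetUr _ _.
  have UAB : pun p `<=` A `|` B.
    apply/fsubsetP => x; rewrite !in_fsetU => /orP[/s1|/s2 ->]; last by rewrite orbT.
    by rewrite in_fset inE /= => /andP[->].
  (* No bad set being a component, [A] and [B] agree on every component that meets [k]; the
     exchanged parts stay admissible in their new copy. *)
  have same x : x \in kcomp p -> (x \in A) = (x \in B).
    rewrite in_fset inE /= => /andP[xU /asboolP[f [fU kf fx]]].
    apply: contrapT => dx.
    have cf := iscomp_comp esym fU.
    have : comp e (pun p) f \in badlist.
      rewrite mem_filter fpowersetE (fsubset_trans (comp_sub _ _ _) UAB) andbT.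
      apply/asboolP; split; first by case: cf => _ [].
        by exists f => //; apply: mem_comp.
      by exists x; [apply/compP|apply/eqP].
    by move/good/asboolPn; apply.
  rewrite !ev_exchange //= andbT.
  apply/andP; split; apply/fsubsetP => x; rewrite in_fsetU in_fsetD in_fsetI.
    case/orP => /andP[h1 h2]; first by have := s1 _ h2; rewrite in_fset inE /= => /andP[].
    by rewrite (same _ h2) s2.
  have BkE y : (y \in Bk) = (y \in B) && ~~ k y by rewrite /Bk !inE.
  rewrite BkE; case/orP => /andP[h1 h2].
    rewrite s2 //=; apply: contra h1 => kx; rewrite in_fset inE /=.
    have xU := fsubsetP p2U _ h2; rewrite xU.
    by apply/asboolP; exists x; split=> //; apply: rt_refl.
  by have := s1 _ h1; rewrite in_fset inE /= -(same _ h2).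
- by move=> p _; rewrite kswap_weight.
- by move=> p _; apply: pwt_ge0.
Qed.
End Swap.

(** * Faces, columns and spin fields *)

Definition col (f : face) : int * int := (f.1 i0, f.1 i1).
Definition ht (f : face) : int := f.1 i2.
Definition hf (c : int * int) (z : int) : face := (mkpt c.1 c.2 z, i2).
(* the vertical face separating the cells of height z above the columns [prv d c] and [c] *)
Definition vf (d : bool) (c : int * int) (z : int) : face := (mkpt c.1 c.2 z, if d then i0 else i1).
Definition prv (d : bool) (c : int * int) : int * int := if d then (c.1 - 1, c.2) else (c.1, c.2 - 1).

Lemma pt_eq (p q : pt) : p i0 = q i0 -> p i1 = q i1 -> p i2 = q i2 -> p = q.
Proof.
move=> h0 h1 h2; apply/ffunP => -[[|[|[|//]]] lt].
- by rewrite (_ : Ordinal lt = i0) //; apply: val_inj.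
- by rewrite (_ : Ordinal lt = i1) //; apply: val_inj.
- by rewrite (_ : Ordinal lt = i2) //; apply: val_inj.
Qed.

Lemma ord3_ind (P : 'I_3 -> Prop) : P i0 -> P i1 -> P i2 -> forall d, P d.
Proof.
move=> h0 h1 h2 [[|[|[|//]]] lt].
- by rewrite (_ : Ordinal lt = i0) //; apply: val_inj.
- by rewrite (_ : Ordinal lt = i1) //; apply: val_inj.
- by rewrite (_ : Ordinal lt = i2) //; apply: val_inj.
Qed.

Lemma mkpt0 x y z : mkpt x y z i0 = x. Proof. by rewrite ffunE. Qed.
Lemma mkpt1 x y z : mkpt x y z i1 = y. Proof. by rewrite ffunE. Qed.
Lemma mkpt2 x y z : mkpt x y z i2 = z. Proof. by rewrite ffunE. Qed.
Definition mkptE := (mkpt0, mkpt1, mkpt2).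

Lemma mkptK (p : pt) : mkpt (p i0) (p i1) (p i2) = p.
Proof. by apply: pt_eq; rewrite mkptE. Qed.

Lemma face_ind (P : face -> Prop) :
  (forall c z, P (hf c z)) -> (forall d c z, P (vf d c z)) -> forall f, P f.
Proof.
move=> hH hV [p d]; rewrite -(mkptK p); elim/ord3_ind: d.
- exact: (hV true (p i0, p i1) (p i2)).
- exact: (hV false (p i0, p i1) (p i2)).
- exact: (hH (p i0, p i1) (p i2)).
Qed.

Lemma col_hf c z : col (hf c z) = c. Proof. by case: c => x y; rewrite /col !mkptE. Qed.
Lemma ht_hf c z : ht (hf c z) = z. Proof. by rewrite /ht mkptE. Qed.
Lemma col_vf d c z : col (vf d c z) = c. Proof. by case: c => x y; rewrite /col !mkptE. Qed.
Lemma ht_vf d c z : ht (vf d c z) = z. Proof. by rewrite /ht mkptE. Qed.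
Definition cohtE := (col_hf, ht_hf, col_vf, ht_vf).

Lemma hf_inj c z c' z' : hf c z = hf c' z' -> c = c' /\ z = z'.
Proof.
move=> e; split; first by rewrite -(col_hf c z) e cohtE.
by rewrite -(ht_hf c z) e cohtE.
Qed.
Lemma horizontal_hf c z : horizontal (hf c z). Proof. by []. Qed.
Lemma horizontal_vf d c z : horizontal (vf d c z) = false. Proof. by case: d. Qed.
Lemma hf_vf c z d c' z' : hf c z <> vf d c' z'.
Proof. by move=> e; have := horizontal_hf c z; rewrite e horizontal_vf. Qed.

Lemma horizontalP f : horizontal f -> f = hf (col f) (ht f).
Proof. by elim/face_ind: f => [c z _|d c z]; rewrite ?cohtE // horizontal_vf. Qed.

(* [b] is a vertex of the projection of [f]; [z] is the height of a vertex of [f] *)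
Definition pv (f : face) (b : int * int) : bool :=
  (if f.2 == i0 then b.1 == f.1 i0 else (b.1 == f.1 i0) || (b.1 == f.1 i0 + 1)) &&
  (if f.2 == i1 then b.2 == f.1 i1 else (b.2 == f.1 i1) || (b.2 == f.1 i1 + 1)).
Definition zv (f : face) (z : int) : bool :=
  if f.2 == i2 then z == ht f else (z == ht f) || (z == ht f + 1).
Definition arnd (b c : int * int) : bool :=
  ((c.1 == b.1) || (c.1 == b.1 - 1)) && ((c.2 == b.2) || (c.2 == b.2 - 1)).

Lemma pv_hf c z b : pv (hf c z) b = arnd b c.
Proof. by rewrite /pv /arnd /hf /= !mkptE; lia. Qed.
Lemma zv_hf c z z' : zv (hf c z) z' = (z' == z).
Proof. by rewrite /zv /= ht_hf. Qed.
Lemma pv_vf d c z b : pv (vf d c z) b = arnd b c && arnd b (prv d c).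
Proof. by case: d; rewrite /pv /arnd /vf /prv /= !mkptE; lia. Qed.
Lemma zv_vf d c z z' : zv (vf d c z) z' = (z' == z) || (z' == z + 1).
Proof. by case: d; rewrite /zv /= ?ht_vf. Qed.
Definition pvE := (pv_hf, pv_vf).
Definition zvE := (zv_hf, zv_vf).

Lemma arnd_col f b : pv f b -> arnd b (col f).
Proof. by elim/face_ind: f => [c z|d c z]; rewrite pvE cohtE // => /andP[]. Qed.

Lemma is_vertexE f v : is_vertex f v <-> pv f (v i0, v i1) && zv f (v i2).
Proof.
have o2 (x y : int) : reflect (x = y \/ x = y + 1) ((x == y) || (x == y + 1)).
  by apply: (iffP orP) => -[/eqP|/eqP]; auto.
split => [h|].
  have := h i0; have := h i1; have := h i2; rewrite /pv /zv /ht /=.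
  elim/ord3_ind: (f.2) => /=.
  - by move=> /o2 -> // /o2 -> // ->; rewrite eqxx.
  - by move=> /o2 -> // -> /o2 -> //; rewrite eqxx.
  - by move=> -> /o2 -> // /o2 -> //; rewrite eqxx.
rewrite /pv /zv /ht /= => /andP[/andP[h0 h1] h2].
elim/ord3_ind.
- by move: h0; case: (f.2) => -[|[|[|]]] //= lt; [move/eqP|move/o2|move/o2].
- by move: h1; case: (f.2) => -[|[|[|]]] //= lt; [move/o2|move/eqP|move/o2].
- by move: h2; case: (f.2) => -[|[|[|]]] //= lt; [move/o2|move/o2|move/eqP].
Qed.

Lemma star_adjE f g : star_adj f g <-> exists b z, [/\ pv f b, zv f z, pv g b & zv g z].
Proof.
split => [[v [/is_vertexE/andP[h1 h2] /is_vertexE/andP[h3 h4]]]|[b [z [h1 h2 h3 h4]]]].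
  by exists (v i0, v i1), (v i2).
exists (mkpt b.1 b.2 z); split; apply/is_vertexE; rewrite !mkptE -surjective_pairing;
  by apply/andP.
Qed.

Definition sadj (f g : face) : bool := `[< star_adj f g >].

Lemma sadjP f g : reflect (exists b z, [/\ pv f b, zv f z, pv g b & zv g z]) (sadj f g).
Proof. by apply: (iffP (asboolP _)); rewrite star_adjE. Qed.

Lemma sadj_sym : symmetric sadj.
Proof.
by move=> f g; apply/sadjP/sadjP => -[b [z [? ? ? ?]]]; exists b, z.
Qed.

Lemma pv_ex f : exists b z, pv f b /\ zv f z.
Proof.
exists (col f), (ht f); elim/face_ind: f => [c z|d c z]; rewrite pvE zvE !cohtE eqxx.
  by rewrite /arnd !eqxx.
by rewrite /arnd /prv; case: d; rewrite /= !eqxx ?orbT.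
Qed.

Lemma sadj_refl : reflexive sadj.
Proof. by move=> f; apply/sadjP; have [b [z [? ?]]] := pv_ex f; exists b, z. Qed.

Definition near1 (x y : int) : bool := (x - 1 <= y) && (y <= x + 1).

Lemma sadj_near f g : sadj f g ->
  [&& near1 (col f).1 (col g).1, near1 (col f).2 (col g).2 & near1 (ht f) (ht g)].
Proof.
move/sadjP => [b [z []]]; rewrite /near1.
have hz h : zv h z -> z = ht h \/ z = ht h + 1.
  by rewrite /zv; case: ifP => _ => [/eqP|/orP[] /eqP]; auto.
move=> /arnd_col p1 /hz z1 /arnd_col p2 /hz z2; move: p1 p2; rewrite /arnd; lia.
Qed.

Definition tri (x : int) : seq int := [:: x - 1; x; x + 1].
(** 27 positions with three orientations each: 81 candidates, among them all faces that share a
    vertex with [f]. *)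
Definition nbf (f : face) : seq face :=
  [seq (mkpt q.1.1 q.1.2 q.2, d) | q <- [seq (c, z) | c <- [seq (x, y) | x <- tri (col f).1, y <- tri (col f).2], z <- tri (ht f)],
     d <- [:: i0; i1; i2]].

Lemma mem_tri x y : near1 x y -> y \in tri x.
Proof. rewrite /near1 /tri !inE; lia. Qed.

Lemma sadj_nbf f g : sadj f g -> g \in nbf f.
Proof.
move/sadj_near => /and3P[h1 h2 h3]; apply/allpairsP; exists ((col g, ht g), g.2); split.
- by apply/allpairsP; exists (col g, ht g); split; rewrite ?mem_tri //;
    apply/allpairsP; exists (col g); rewrite !mem_tri.
- by elim/ord3_ind: (g.2).
- by case: g {h1 h2 h3} => p d; rewrite /= mkptK.
Qed.

Lemma size_nbf f : (size (nbf f) <= 81)%N.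
Proof. by rewrite !size_allpairs. Qed.

(** * Even sets of faces *)

Inductive edge4 : face -> face -> face -> face -> Prop :=
| Edge4h d c z : edge4 (hf c z) (hf (prv d c) z) (vf d c z) (vf d c (z - 1))
| Edge4v b z : edge4 (vf true b z) (vf true (b.1, b.2 - 1) z) (vf false b z) (vf false (b.1 - 1, b.2) z).

Lemma edge4_vertex f1 f2 f3 f4 : edge4 f1 f2 f3 f4 ->
  exists b z, forall g, g \in [:: f1; f2; f3; f4] -> pv g b /\ zv g z.
Proof.
case=> [d c z|b z].
  exists c, z => g; rewrite !inE => /or4P[] /eqP->; rewrite pvE zvE /arnd /prv;
    by case: d => /=; rewrite !eqxx ?orbT ?subrK ?eqxx ?orbT.
exists b, z => g; rewrite !inE => /or4P[] /eqP->; rewrite pvE zvE /arnd /prv;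
    by rewrite /= !eqxx ?orbT.
Qed.

(** The mod 2 cycle condition at every lattice edge; [edge4] lists the four faces around a
    horizontal or a vertical edge. *)
Definition evenp (X : face -> bool) : Prop :=
  forall f1 f2 f3 f4, edge4 f1 f2 f3 f4 -> X f1 (+) X f2 (+) X f3 (+) X f4 = false.

Lemma edge4_adj f1 f2 f3 f4 : edge4 f1 f2 f3 f4 ->
  {in [:: f1; f2; f3; f4] &, forall g h, sadj g h}.
Proof.
move/edge4_vertex => [b [z hb]] g h /hb [? ?] /hb [? ?]; apply/sadjP.
by exists b, z.
Qed.

(** The four faces around an edge are pairwise adjacent, so a subset closed under adjacency contains
    all the faces of [X] at that edge or none. *)
Lemma evenp_sub (X C : face -> bool) : evenp X -> (forall f, C f -> X f) ->
  (forall f g, C f -> X g -> sadj f g -> C g) -> evenp C.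
Proof.
move=> eX CX cl f1 f2 f3 f4 e4; have adj := edge4_adj e4; have e := eX _ _ _ _ e4.
have [/hasP[f fin Cf]|/hasPn none] := boolP (has C [:: f1; f2; f3; f4]).
  have h g : g \in [:: f1; f2; f3; f4] -> C g = X g.
    by move=> gin; apply/idP/idP => [/CX//|Xg]; apply: (cl f) => //; apply: adj.
  by rewrite !h // !inE eqxx ?orbT.
by rewrite !(negbTE (none _ _)) // !inE eqxx ?orbT.
Qed.

Lemma evenp_add (X Y Z : face -> bool) : evenp X -> evenp Y ->
  (forall f, Z f = X f (+) Y f) -> evenp Z.
Proof.
move=> eX eY h f1 f2 f3 f4 e4; have := eX _ _ _ _ e4; have := eY _ _ _ _ e4; rewrite !h.
by case: (X f1); case: (X f2); case: (X f3); case: (X f4); case: (Y f1); case: (Y f2);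
  case: (Y f3); case: (Y f4).
Qed.

Definition ev (X : {fset face}) : bool := `[< evenp (fun f => f \in X) >].

Lemma ev_split (X C : {fset face}) : ev X -> (C `<=` X)%fset ->
  (forall a b, a \in C -> b \in X -> sadj a b -> b \in C) -> ev C.
Proof.
move=> /asboolP eX /fsubsetP CX cl; apply/asboolP.
exact: evenp_sub eX CX cl.
Qed.

Lemma ev_join (X Y : {fset face}) : ev X -> ev Y ->
  (forall a b, a \in X -> b \in Y -> ~~ sadj a b) -> ev (X `|` Y)%fset.
Proof.
move=> /asboolP eX /asboolP eY sep; apply/asboolP; apply: evenp_add eX eY _ => f.
rewrite in_fsetU; case fX: (f \in X); case fY: (f \in Y) => //.
by have := sep _ _ fX fY; rewrite sadj_refl.
Qed.

Lemma ev_fset0 : ev fset0. Proof. by apply/asboolP. Qed.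

(* spin fields, as functions of the column and of the height of a cell *)
Definition field := int * int -> int -> bool.

Definition sepf (T : field) (f : face) : bool :=
  if horizontal f then T (col f) (ht f) != T (col f) (ht f - 1)
  else T (col f) (ht f) != T (prv (f.2 == i0) (col f)) (ht f).

Lemma sepf_hf T c z : sepf T (hf c z) = (T c z != T c (z - 1)).
Proof. by rewrite /sepf horizontal_hf !cohtE. Qed.
Lemma sepf_vf T d c z : sepf T (vf d c z) = (T c z != T (prv d c) z).
Proof. by rewrite /sepf horizontal_vf !cohtE; case: d. Qed.
Definition sepfE := (sepf_hf, sepf_vf).

Lemma sepf_even T : evenp (sepf T).
Proof.
move=> f1 f2 f3 f4 [d c z|b z]; rewrite !sepfE /prv /=.
  by case: (T c z); case: (T c _); case: (T _ z); case: (T _ _).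
case: (T b z); case: (T (b.1 - 1, b.2) z); case: (T (b.1, b.2 - 1) z);
  by case: (T (b.1 - 1, b.2 - 1) z).
Qed.

Lemma sepb_sepf (s : pt -> bool) f : sepb s f = sepf (fun c z => s (mkpt c.1 c.2 z)) f.
Proof.
elim/face_ind: f => [c z|d c z]; rewrite sepfE /sepb /=; congr (s _ != s _).
  by apply: pt_eq; rewrite /prv !ffunE /= ?subr0.
by case: d; apply: pt_eq; rewrite /prv !ffunE /= ?subr0.
Qed.

(** * Boxes, boundary conditions and energy *)

Definition inbox (n : nat) (c : int * int) : bool :=
  [&& - n%:Z <= c.1, c.1 < n%:Z, - n%:Z <= c.2 & c.2 < n%:Z].
Definition inc (n m : nat) (c : int * int) (z : int) : bool :=
  [&& inbox n c, - m%:Z <= z & z < m%:Z].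
(* [f] is a face of a cell of the box *)
Definition inwin (n m : nat) (f : face) : bool :=
  inc n m (col f) (ht f) ||
  (if horizontal f then inc n m (col f) (ht f - 1) else inc n m (prv (f.2 == i0) (col f)) (ht f)).

Lemma inwin_hf n m c z : inwin n m (hf c z) = inc n m c z || inc n m c (z - 1).
Proof. by rewrite /inwin horizontal_hf !cohtE. Qed.
Lemma inwin_vf n m d c z : inwin n m (vf d c z) = inc n m c z || inc n m (prv d c) z.
Proof. by rewrite /inwin horizontal_vf !cohtE; case: d. Qed.
Definition inwinE := (inwin_hf, inwin_vf).

Lemma insideE n m p : inside n m p = inc n m (p i0, p i1) (p i2).
Proof.
rewrite /inside /inc /inbox /=; apply/existsP/idP => [[[[a b] h] /eqP <-]|].
  rewrite /cellpt !mkptE /=; have := ltn_ord a; have := ltn_ord b; have := ltn_ord h; lia.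
move=> hp.
have l0 : (absz (p i0 + n%:Z)%R < 2 * n)%N by lia.
have l1 : (absz (p i1 + n%:Z)%R < 2 * n)%N by lia.
have l2 : (absz (p i2 + m%:Z)%R < 2 * m)%N by lia.
exists (Ordinal l0, Ordinal l1, Ordinal l2); apply/eqP; apply: pt_eq; rewrite /cellpt !mkptE /=; lia.
Qed.

Definition Win (n m : nat) : {fset face} :=
  [fset f in [seq wface w | w : windowT n m] | inwin n m f]%fset.

Lemma inc_lt n m c z : inc n m c z -> [&& - n%:Z <= c.1, c.1 < n%:Z, - n%:Z <= c.2, c.2 < n%:Z, - m%:Z <= z & z < m%:Z].
Proof. by rewrite /inc /inbox -!andbA. Qed.

Lemma in_Win n m f : (f \in Win n m) = inwin n m f.
Proof.
rewrite !inE /= andb_idl // => wf; apply/codomP.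
suff [q [q0 q1 q2]] : exists q : pt * 'I_3, [/\ f = q,
   [&& - n%:Z <= q.1 i0, q.1 i0 <= n%:Z, - n%:Z <= q.1 i1 & q.1 i1 <= n%:Z] &
   - m%:Z <= q.1 i2 <= m%:Z].
  have l0 : (absz (q.1 i0 + n%:Z)%R < 2 * n + 1)%N by lia.
  have l1 : (absz (q.1 i1 + n%:Z)%R < 2 * n + 1)%N by lia.
  have l2 : (absz (q.1 i2 + m%:Z)%R < 2 * m + 1)%N by lia.
  exists (Ordinal l0, Ordinal l1, Ordinal l2, q.2); rewrite q0 /wface /= [LHS]surjective_pairing.
  congr (_, _); apply: pt_eq; rewrite !mkptE; lia.
exists f; move: wf; elim/face_ind: f => [c z|d c z]; rewrite inwinE /hf /vf /= !mkptE.
  by move=> /orP[] /inc_lt h; split=> //; move: h; lia.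
by case: d; move=> /orP[] /inc_lt; rewrite /prv /= => h; split=> //; move: h; lia.
Qed.

Lemma wface_inj n m : injective (@wface n m).
Proof.
move=> [[[a b] c] d] [[[a' b'] c'] d'] e.
have ed : d = d' by have := congr1 snd e.
have ep : (wface (a, b, c, d)).1 = (wface (a', b', c', d')).1 by rewrite e.
have := congr1 (fun p : pt => p i0) ep; have := congr1 (fun p : pt => p i1) ep.
have := congr1 (fun p : pt => p i2) ep; rewrite /wface /= !mkptE => e2 e1 e0.
rewrite ed; congr (_, _, _, _); apply: val_inj => /=; move: e0 e1 e2; lia.
Qed.

Definition dob (n m : nat) (T : field) : Prop := forall c z, ~~ inc n m c z -> T c z = (z < 0).
Definition Sx (n m : nat) (T : field) : {fset face} := [fset f in Win n m | sepf T f]%fset.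
Definition scfg n m (s : config n m) : field := fun c z => spin_ext s (mkpt c.1 c.2 z).

Lemma in_Sx n m T f : (f \in Sx n m T) = inwin n m f && sepf T f.
Proof. by rewrite -in_Win !inE. Qed.

Lemma dob_scfg n m (s : config n m) : dob n m (scfg s).
Proof.
move=> c z h; rewrite /scfg /spin_ext; case: pickP => [b /eqP e|_]; last by rewrite mkptE.
have : inside n m (mkpt c.1 c.2 z) by apply/existsP; exists b; apply/eqP.
by rewrite insideE !mkptE -surjective_pairing (negbTE h).
Qed.

Definition cfg_of n m (T : field) : config n m :=
  [ffun b => let p := cellpt b in T (p i0, p i1) (p i2)].

Lemma scfg_cfg_of n m T c z : dob n m T -> scfg (cfg_of n m T) c z = T c z.
Proof.
move=> dT; rewrite /scfg /spin_ext; case: pickP => [b /eqP e|no].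
  by rewrite ffunE e /= !mkptE -surjective_pairing.
rewrite dT ?mkptE //; apply/negP => ic.
have : inside n m (mkpt c.1 c.2 z) by rewrite insideE !mkptE -surjective_pairing.
by case/existsP => b hb; move: (no b); rewrite hb.
Qed.

Lemma cellpt_inj n m : injective (@cellpt n m).
Proof.
move=> [[a b] c] [[a' b'] c'] e.
have := congr1 (fun p : pt => p i0) e; have := congr1 (fun p : pt => p i1) e.
have := congr1 (fun p : pt => p i2) e; rewrite /cellpt /= !mkptE => e2 e1 e0.
congr (_, _, _); apply: val_inj => /=; move: e0 e1 e2; lia.
Qed.

Lemma scfg_inj n m (s s' : config n m) : scfg s =2 scfg s' -> s = s'.
Proof.
move=> h; apply/ffunP => b; have := h ((cellpt b) i0, (cellpt b) i1) ((cellpt b) i2).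
rewrite /scfg /= mkptK /spin_ext.
by case: pickP => [b' /eqP/cellpt_inj -> //|/(_ b)]; rewrite eqxx.
Qed.

Lemma energyE n m (s : config n m) : energy s = #|` Sx n m (scfg s)|.
Proof.
rewrite /energy cardE -(size_map (@wface n m)); have other f : inc n m ((subpt f.1 (unitv f.2)) i0, (subpt f.1 (unitv f.2)) i1) ((subpt f.1 (unitv f.2)) i2) =
    (if horizontal f then inc n m (col f) (ht f - 1) else inc n m (prv (f.2 == i0) (col f)) (ht f)).
  elim/face_ind: f => [c z|d c z]; rewrite ?horizontal_hf ?horizontal_vf !cohtE !ffunE /= ?subr0 //.
  by case: d; rewrite /= ?subr0.
have wE (w : windowT n m) : (inside n m (wface w).1 || inside n m (subpt (wface w).1 (unitv (wface w).2))) = inwin n m (wface w).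
  by rewrite !insideE other.
apply: perm_size; apply: uniq_perm.
- by rewrite map_inj_uniq ?enum_uniq //; apply: wface_inj.
- exact: fset_uniq.
move=> f; rewrite in_Sx; apply/mapP/andP => [[w]|[fw sf]].
  by rewrite mem_enum inE wE sepb_sepf => /andP[h1 h2] ->; split.
have : f \in Win n m by rewrite in_Win.
rewrite !inE /= => /andP[/codomP[w ew] _].
by exists w => //; rewrite mem_enum inE wE -ew fw sepb_sepf.
Qed.

Lemma sepf_ext T T' : T =2 T' -> sepf T =1 sepf T'.
Proof. by move=> h f; rewrite /sepf !h. Qed.

Definition xorf (T T' : field) : field := fun c z => T c z (+) T' c z.

Lemma sepf_xor T T' f : sepf (xorf T T') f = sepf T f (+) sepf T' f.
Proof.
elim/face_ind: f => [c z|d c z]; rewrite !sepfE /xorf;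
  by case: (T c z); case: (T _ _); case: (T' c z); case: (T' _ _).
Qed.

Definition flat : field := fun _ z => z < 0.

Lemma sepf_flat f : sepf flat f = horizontal f && (ht f == 0).
Proof.
elim/face_ind: f => [c z|d c z]; rewrite sepfE /flat ?horizontal_hf ?horizontal_vf !cohtE.
  by case: ltP; case: ltP; lia.
by rewrite eqxx.
Qed.

Lemma sepf_inj n m T T' : dob n m T -> dob n m T' -> sepf T =1 sepf T' -> T =2 T'.
Proof.
move=> dT dT' h c z.
have low z' : z' < - m%:Z -> T c z' = T' c z'.
  by move=> lt; rewrite dT ?dT' // /inc; lia.
have [lt|ge] := ltP z (- m%:Z); first exact: low.
have -> : z = (absz (z + m%:Z)%R)%:Z - m%:Z by lia.
elim: (absz _) => [|k IH].
  have := h (hf c (0%:Z - m%:Z)); rewrite !sepfE (low (0%:Z - m%:Z - 1)); last lia.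
  by case: (T c _); case: (T' c _); case: (T' c _).
have := h (hf c (k.+1%:Z - m%:Z)); rewrite !sepfE (_ : k.+1%:Z - m%:Z - 1 = k%:Z - m%:Z); last lia.
by rewrite IH; case: (T c _); case: (T' c _); case: (T' c _).
Qed.

(** Number of integers from [-M] to [z], with value 0 when there are none. *)
Definition nlev (M : nat) (z : int) : nat := if (z + M%:Z + 1)%R is Posz k then k else 0%N.

(* the field whose separating faces are the even set [Y], obtained by counting from
   height [-M] upwards the horizontal faces of [Y] in each column *)
Definition fld_of (Y : face -> bool) (M : nat) : field := fun c z =>
  \big[addb/false]_(0 <= i < nlev M z) Y (hf c (i%:Z - M%:Z)).

Lemma fld_of_low Y M c z : z < - M%:Z -> fld_of Y M c z = false.
Proof.
move=> lt; rewrite /fld_of (_ : nlev M z = 0%N) ?big_geq //.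
by rewrite /nlev; case e : (z + M%:Z + 1) => [k|k] //; lia.
Qed.

Lemma fld_of_step Y M c z : - M%:Z <= z -> fld_of Y M c z = fld_of Y M c (z - 1) (+) Y (hf c z).
Proof.
move=> ge; rewrite /fld_of /nlev.
have -> : z + M%:Z + 1 = ((absz (z + M%:Z)%R).+1%:Z) by lia.
have -> : z - 1 + M%:Z + 1 = (absz (z + M%:Z)%R)%:Z by lia.
by rewrite big_nat_recr //= (_ : (absz (z + M%:Z)%R)%:Z - M%:Z = z) //; lia.
Qed.

(** A discrete Poincare lemma. Horizontal faces match by construction; for vertical faces, evenness
    at the horizontal edges carries the identity from one level to the next. *)
Lemma sepf_fld_of Y M : evenp Y -> (forall f, ht f < - M%:Z -> Y f = false) ->
  sepf (fld_of Y M) =1 Y.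
Proof.
move=> eY low f; elim/face_ind: f => [c z|d c z]; rewrite sepfE.
  have [lt|ge] := ltP z (- M%:Z).
    by rewrite !fld_of_low ?low ?ht_hf //; lia.
  by rewrite fld_of_step //; case: (fld_of _ _ _ _); case: (Y _).
have [lt|ge] := ltP z (- M%:Z).
  by rewrite !fld_of_low ?low ?ht_vf.
have -> : z = ((absz (z + M%:Z)%R).+1%:Z) - M%:Z - 1 by lia.
elim: (absz _).+1 => [|k IH].
  by rewrite !fld_of_low ?low ?ht_vf //; lia.
have -> : k.+1%:Z - M%:Z - 1 = k%:Z - M%:Z by lia.
have := eY _ _ _ _ (Edge4h d c (k%:Z - M%:Z)).
rewrite !(@fld_of_step _ _ _ (k%:Z - M%:Z)); [|lia..].
move: IH; case: (fld_of _ _ c _); case: (fld_of _ _ (prv d c) _);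
 case: (Y (vf d c (k%:Z - M%:Z - 1))); case: (Y (hf c _)); case: (Y (hf (prv d c) _));
 by case: (Y (vf _ _ _)).
Qed.

Lemma inwin_low n m f : ht f < - m%:Z -> inwin n m f = false.
Proof.
by elim/face_ind: f => [c z|d c z]; rewrite inwinE cohtE /inc => lt; apply/negbTE; lia.
Qed.

Lemma fld_of_out n m Y c z : evenp Y -> (forall f, Y f -> inwin n m f) ->
  ~~ inc n m c z -> fld_of Y m c z = false.
Proof.
move=> eY Yw nc.
have sY : sepf (fld_of Y m) =1 Y.
  apply: sepf_fld_of => // f lt; apply/negP => /Yw; by rewrite inwin_low.
have out c' z' : ~~ inbox n c' -> fld_of Y m c' z' = false.
  move=> nb; rewrite /fld_of big_seq big1 // => i _; apply/negP => /Yw.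
  by rewrite inwinE /inc (negbTE nb).
have [lt|ge] := ltP z (- m%:Z); first by rewrite fld_of_low.
have [ic|/out//] := boolP (inbox n c).
have gm : m%:Z <= z by move: nc; rewrite /inc ic /=; lia.
(* At these heights [Y] has no vertical face, so the value is constant along the row and can be read
   outside the box. *)
suff h k : fld_of Y m (c.1 - k%:Z, c.2) z = fld_of Y m c z.
  by rewrite -(h (absz (c.1 + n%:Z + 1)%R)) out //; move: ic; rewrite /inbox /=; lia.
elim: k => [|k <-]; first by rewrite subr0 -surjective_pairing.
have := sY (vf true (c.1 - k%:Z, c.2) z); rewrite sepfE /prv /=.
have -> : Y (vf true (c.1 - k%:Z, c.2) z) = false.
  apply/negP => /Yw; rewrite inwinE /inc => /orP[] /and3P[_ _]; lia.
by move/negbFE/eqP => ->; rewrite (_ : c.1 - k.+1%:Z = c.1 - k%:Z - 1) //; lia.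
Qed.

(** * Interfaces *)

Definition outL (n : nat) (f : face) : bool := [&& horizontal f, ht f == 0 & ~~ inbox n (col f)].
(* [I] is the part of an interface inside the window *)
Definition Ih (n : nat) (I : {fset face}) (f : face) : bool := (f \in I) || outL n f.
Definition arel (P : face -> bool) (a b : face) : Prop := P a /\ P b /\ star_adj a b.
Definition conP (P : face -> bool) := clos_refl_trans face (arel P).

Definition isif (n m : nat) (I : {fset face}) : Prop :=
  [/\ (I `<=` Win n m)%fset, evenp (Ih n I) &
      forall f, f \in I -> exists g, outL n g /\ conP (Ih n I) g f].

Definition Iin (n m : nat) (T : field) : {fset face} :=
  [fset f in Win n m | `[< exists g, outL n g /\ conP (sepf T) g f >]]%fset.

(** The room left to the contours that are not part of the interface. *)
Definition allowed (n m : nat) (P : face -> bool) : {fset face} :=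
  [fset f in Win n m | `[< forall g, P g -> ~~ sadj f g >]]%fset.

Lemma conP_sym P a b : conP P a b -> conP P b a.
Proof.
elim=> {a b} [a b [aX [bX ab]]|a|a b c _ h1 _ h2].
- by apply: rt_step; split=> //; split=> //; case: ab => v [va vb]; exists v.
- exact: rt_refl.
- exact: (rt_trans _ _ _ b).
Qed.

Lemma conP_stay (P : face -> bool) (Q : face -> Prop) a b :
  (forall x y, P x -> P y -> Q x -> sadj x y -> Q y) -> Q a -> conP P a b -> Q b.
Proof.
move=> st Qa ab; elim: ab Qa => {a b} [a b [aX [bX ab]] Qa|//|a b c _ ab _ bc Qa].
- by apply: (st a b) => //; apply/asboolP.
- by apply: bc; apply: ab.
Qed.

Lemma conP_mem (P : face -> bool) a b : P a -> conP P a b -> P b.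
Proof. by move=> Pa; apply: (@conP_stay P (fun x => P x : Prop)). Qed.

Lemma conP_step (P : face -> bool) a b c : conP P a b -> P b -> P c -> sadj b c -> conP P a c.
Proof.
move=> ab Pb Pc bc; apply: (rt_trans _ _ _ b _ ab); apply: rt_step; split=> //.
by split=> //; apply/asboolP.
Qed.

Lemma in_allowed n m (P : face -> bool) f : reflect (inwin n m f /\ forall g, P g -> ~~ sadj f g) (f \in allowed n m P).
Proof.
have -> : (f \in allowed n m P) = inwin n m f && `[< forall g, P g -> ~~ sadj f g >].
  by rewrite -in_Win !inE.
by apply: (iffP andP) => -[h1 h2]; split=> //; apply/asboolP.
Qed.

Lemma inL0outE n f : inL0out n f <-> outL n f.
Proof.
have bE : in_sq n f <-> inbox n (col f).
  rewrite /in_sq /inbox /col /=; split => [[]|]; lia.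
rewrite /inL0out /inL0 bE /outL /ht; split => [[[-> ->] /negP ->]|/and3P[-> /eqP -> /negP]] //.
Qed.

Lemma outL_inwin n m f : outL n f -> inwin n m f = false.
Proof.
case/and3P => hor _ nb; rewrite (horizontalP hor) inwin_hf /inc.
by rewrite (negbTE nb).
Qed.

Section Interfaces.
Variables n m : nat.
Hypothesis m_gt0 : (0 < m)%N.

Lemma sepf_out T f : dob n m T -> ~~ inwin n m f -> sepf T f = outL n f.
Proof.
move=> dT nw; have -> : sepf T f = sepf flat f.
  move: nw; elim/face_ind: f => [c z|d c z]; rewrite inwinE !sepfE => /norP[h1 h2];
    by rewrite !dT.
rewrite sepf_flat /outL; case hor : (horizontal f) => //=; case: eqP => //= h0.
apply/esym; move: nw; rewrite (horizontalP hor) inwin_hf !cohtE h0 /inc; apply: contra => ->.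
by rewrite /=; lia.
Qed.

Lemma sepf_Sx T f : dob n m T -> sepf T f = (f \in Sx n m T) || outL n f.
Proof.
move=> dT; rewrite in_Sx; have [fw|fw] := boolP (inwin n m f); last by rewrite sepf_out.
rewrite /=; case e : (outL n f); last by rewrite orbF.
by rewrite (outL_inwin m e) in fw.
Qed.

Lemma in_Iin T f : reflect (inwin n m f /\ exists g, outL n g /\ conP (sepf T) g f) (f \in Iin n m T).
Proof.
have -> : (f \in Iin n m T) = inwin n m f && `[< exists g, outL n g /\ conP (sepf T) g f >].
  by rewrite -in_Win !inE.
by apply: (iffP andP) => -[h1 h2]; split=> //; apply/asboolP.
Qed.

Lemma outL_sepf T f : dob n m T -> outL n f -> sepf T f.
Proof. by move=> dT oL; rewrite sepf_Sx // oL orbT. Qed.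

Lemma IhP T f : dob n m T -> reflect (exists g, outL n g /\ conP (sepf T) g f) (Ih n (Iin n m T) f).
Proof.
move=> dT; apply: (iffP orP) => [[/in_Iin[]//|oL]|[g [og gf]]].
  by exists f; split=> //; apply: rt_refl.
have sf : sepf T f by apply: conP_mem gf; apply: outL_sepf.
have [fw|fw] := boolP (inwin n m f); last by right; rewrite -(sepf_out dT).
by left; apply/in_Iin; split=> //; exists g.
Qed.

Lemma Ih_sepf T f : dob n m T -> Ih n (Iin n m T) f -> sepf T f.
Proof. by move=> dT /(IhP _ dT)[g [og gf]]; apply: conP_mem gf; apply: outL_sepf. Qed.

Lemma Ih_closed T f g : dob n m T -> Ih n (Iin n m T) f -> sepf T g -> sadj f g -> Ih n (Iin n m T) g.
Proof.
move=> dT If sg fg; have sf := Ih_sepf dT If.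
move/(IhP _ dT): If => [h [oh hf]]; apply/IhP => //; exists h; split=> //.
exact: conP_step hf _ _ _.
Qed.

Lemma isif_Iin T : dob n m T -> isif n m (Iin n m T).
Proof.
move=> dT; split.
- by apply/fsubsetP => f /in_Iin[]; rewrite in_Win.
- by apply: (evenp_sub (@sepf_even T)) => [f /Ih_sepf|f g]; [apply|apply: Ih_closed].
- move=> f /in_Iin[_ [g [og gf]]]; exists g; split=> //.
  have : Ih n (Iin n m T) f /\ conP (Ih n (Iin n m T)) g f; last by case.
  apply: (@conP_stay (sepf T) (fun f => Ih n (Iin n m T) f /\ conP (Ih n (Iin n m T)) g f) g) gf.
    move=> x y sx sy [Ix gx] xy; have Iy := Ih_closed dT Ix sy xy; split=> //.
    exact: conP_step gx _ _ _.
  by split; [rewrite /Ih og orbT|apply: rt_refl].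
Qed.

Lemma interfaceE (s : config n m) : interface n (spin_ext s) = (fun f => Ih n (Iin n m (scfg s)) f : Prop).
Proof.
apply/funext => f; apply/propext; have dT := dob_scfg s.
have cE a b : clos_refl_trans face (fun a b => sepb (spin_ext s) a /\ sepb (spin_ext s) b /\ star_adj a b) a b
    <-> conP (sepf (scfg s)) a b.
  rewrite /conP (_ : arel _ = (fun a b => sepb (spin_ext s) a /\ sepb (spin_ext s) b /\ star_adj a b)) //.
  by apply/funext => x; apply/funext => y; rewrite /arel -!sepb_sepf.
split=> [[_ [g [/inL0outE og /cE gf]]]|If]; first by apply/IhP => //; exists g.
split; first by rewrite sepb_sepf; apply: Ih_sepf If.
by move/(IhP _ dT): If => [g [og gf]]; exists g; split; [apply/inL0outE|apply/cE].
Qed.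

(** Adding the flat interface mod 2 turns the infinite set [Ih n I] into an even set inside the
    window, to which [fld_of] applies. *)
Lemma isif_field I : isif n m I -> exists T, dob n m T /\ sepf T =1 Ih n I.
Proof.
case=> /fsubsetP IW eI _; pose Y f := Ih n I f (+) sepf flat f.
have eY : evenp Y by apply: evenp_add eI (sepf_even flat) _.
have Yw f : Y f -> inwin n m f.
  rewrite /Y /Ih; case fI : (f \in I); first by rewrite -in_Win IW.
  rewrite sepf_flat /outL /=; case: (boolP (horizontal f)) => //= hor.
  case: eqP => //= h0; case: (boolP (inbox n (col f))) => //= ib _.
  by rewrite (horizontalP hor) inwin_hf h0 /inc ib /=; lia.
have sY : sepf (fld_of Y m) =1 Y.
  by apply: sepf_fld_of => // f lt; apply/negP => /Yw; rewrite inwin_low.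
exists (xorf flat (fld_of Y m)); split.
  by move=> c z nc; rewrite /xorf (fld_of_out eY Yw nc) addbF.
by move=> f; rewrite sepf_xor sY /Y; case: (Ih _ _ _); case: (sepf _ _).
Qed.

Lemma Iin_of_sep T I : dob n m T -> isif n m I -> (forall f, Ih n I f -> sepf T f) ->
  (forall f g, Ih n I f -> sepf T g -> sadj f g -> Ih n I g) -> Iin n m T = I.
Proof.
move=> dT [/fsubsetP IW eI cI] sub cl; apply/fsetP => f; apply/in_Iin/idP => [[fw [g [og gf]]]|fI].
  have : Ih n I f.
    apply: (@conP_stay (sepf T) (fun f => Ih n I f) g) gf; last by rewrite /Ih og orbT.
    by move=> x y _ sy Ix; apply: cl.
  by rewrite /Ih => /orP[//|/outL_inwin -/(_ m)]; rewrite fw.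
split; first by rewrite -in_Win IW.
have [g [og gf]] := cI _ fI; exists g; split=> //.
elim: gf => {g og f fI} [a b [/sub ? [/sub ? ?]]|a|a b c _ h1 _ h2].
- exact: rt_step.
- exact: rt_refl.
- exact: (rt_trans _ _ _ b).
Qed.

Variables (R : realFieldType) (lam : R).
Hypothesis lam0 : 0 <= lam.

(** A configuration with interface [I] amounts to an even set [G] of allowed faces: [G] is what
    remains of the separating faces without [I], and conversely [G] is added mod 2 to a field whose
    boundary is [I]. The energy is the sum of the two cardinals. *)
Lemma sum_cfg I : isif n m I ->
  \sum_(s : config n m | Iin n m (scfg s) == I) lam ^+ energy s =
  lam ^+ #|` I| * Xi ev lam (allowed n m (Ih n I)).
Proof.
move=> iI; have [T [dT sT]] := isif_field iI; have [/fsubsetP IW eI cI] := iI.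
rewrite -big_filter; set s := [seq _ <- _ | _].
have us : uniq s by rewrite filter_uniq // index_enum_uniq.
rewrite /Xi big_distrr /=; set s' := [seq _ <- _ | _].
have us' : uniq s' by rewrite filter_uniq // fset_uniq.
have memI f : f \in I -> inwin n m f by move/IW; rewrite in_Win.
have SxI (x : config n m) : Iin n m (scfg x) = I -> (I `<=` Sx n m (scfg x))%fset.
  move=> e; apply/fsubsetP => f fI; rewrite in_Sx memI // andTb.
  by apply: (Ih_sepf (dob_scfg x)); rewrite e /Ih fI.
have sepx (x : config n m) f : Iin n m (scfg x) = I -> sepf (scfg x) f = Ih n I f (+) (f \in (Sx n m (scfg x) `\` I)%fset).
  move=> e; have dx := dob_scfg x.
  rewrite in_fsetD in_Sx /Ih; case fI : (f \in I) => /=.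
    by apply: (Ih_sepf dx); rewrite e /Ih fI.
  rewrite [LHS]sepf_Sx // in_Sx; case oL : (outL n f); last by rewrite orbF.
  by rewrite (outL_inwin m oL).
apply: le_anti; apply/andP; split.
- apply: (@ler_sum_inj _ _ _ _ _ (fun x => Sx n m (scfg x) `\` I)%fset) => //.
  + move=> x y; rewrite !mem_filter => /andP[/eqP ex _] /andP[/eqP ey _] exy; apply: scfg_inj.
    apply: (@sepf_inj n m); [exact: dob_scfg..|move=> f].
    by rewrite !sepx // exy.
  + move=> x; rewrite !mem_filter fpowersetE => /andP[/eqP ex _]; apply/andP; split.
      apply/asboolP; apply: evenp_add (@sepf_even (scfg x)) eI _ => f.
      by rewrite sepx //; case: (Ih _ _ _); case: (_ \in _).
    apply/fsubsetP => f; rewrite in_fsetD in_Sx => /andP[fI /andP[fw sf]].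
    apply/in_allowed; split=> // g Ig; apply: contra fI => fg.
    have : Ih n (Iin n m (scfg x)) f.
      by apply: (@Ih_closed _ g) => //; rewrite ?ex ?[sadj g f]sadj_sym //; apply: dob_scfg.
    by rewrite ex /Ih => /orP[//|/outL_inwin -/(_ m)]; rewrite fw.
  + move=> x; rewrite mem_filter => /andP[/eqP ex _]; rewrite energyE -exprD.
    have := cardfsID I (Sx n m (scfg x)); rewrite (fsetIidPr (SxI _ ex)) => ->.
    exact: lexx.
  + by move=> y _; rewrite mulr_ge0 // exprn_ge0.
pose g (G : {fset face}) : config n m := cfg_of n m (xorf T (fld_of (fun f => f \in G) m)).
have gP G : G \in s' -> dob n m (xorf T (fld_of (fun f => f \in G) m)) /\
    forall f, sepf (xorf T (fld_of (fun f => f \in G) m)) f = Ih n I f (+) (f \in G).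
  rewrite mem_filter fpowersetE => /andP[/asboolP eG /fsubsetP GA].
  have Gw f : f \in G -> inwin n m f by move/GA/in_allowed => [].
  have sG : sepf (fld_of (fun f => f \in G) m) =1 (fun f => f \in G).
    by apply: sepf_fld_of => // f lt; apply/negP => /Gw; rewrite inwin_low.
  split; last by move=> f; rewrite sepf_xor sT sG.
  by move=> c z nc; rewrite /xorf (fld_of_out eG Gw nc) addbF dT.
have sgE G f : G \in s' -> sepf (scfg (g G)) f = Ih n I f (+) (f \in G).
  move=> /gP[dG <-]; apply: sepf_ext => c z; exact: scfg_cfg_of.
have IG G f : G \in s' -> f \in G -> Ih n I f = false.
  rewrite mem_filter fpowersetE => /andP[_ /fsubsetP GA] /GA/in_allowed[_ h].
  by apply/negP => /h; rewrite sadj_refl.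
apply: (@ler_sum_inj _ _ _ _ _ g) => //.
- move=> G G' Gs Gs' e; apply/fsetP => f.
  have := sgE _ f Gs; rewrite e sgE //; by case: (Ih _ _ _); case: (_ \in G); case: (_ \in G').
- move=> G Gs; rewrite mem_filter mem_index_enum andbT; apply/eqP; apply: Iin_of_sep => //.
  + exact: dob_scfg.
  + by move=> f If; rewrite sgE // If; case fG: (f \in G) => //; rewrite (IG G) in If.
  + move=> a b Ia; rewrite sgE // => sb ab; case Ib : (Ih n I b) sb => //= bG.
    move: Gs; rewrite mem_filter fpowersetE => /andP[_ /fsubsetP GA].
    by have [_ /(_ _ Ia)] := in_allowed _ _ _ _ (GA _ bG); rewrite sadj_sym ab.
- move=> G Gs; rewrite energyE -exprD le_eqVlt; apply/orP; left; apply/eqP; congr (_ ^+ _).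
  have -> : Sx n m (scfg (g G)) = (I `|` G)%fset.
    apply/fsetP => f; rewrite in_Sx in_fsetU sgE // /Ih.
    case fI : (f \in I) => /=.
      rewrite memI //=; case fG : (f \in G) => //.
      by have := IG _ _ Gs fG; rewrite /Ih fI.
    have [fw|fw] := boolP (inwin n m f).
      by case oL : (outL n f) => //=; rewrite (outL_inwin m oL) in fw.
    case fG : (f \in G) => //.
    move: Gs fG; rewrite mem_filter fpowersetE => /andP[_ /fsubsetP GA] /GA/in_allowed[].
    by rewrite (negbTE fw).
  rewrite cardfsU [X in (_ - X)%N](_ : _ = 0%N) ?subn0 //; apply/eqP.
  rewrite cardfs_eq0; apply/eqP/fsetP => f; rewrite in_fsetI in_fset0.
  case fI : (f \in I) => //=; case fG : (f \in G) => //.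
  by have := IG _ _ Gs fG; rewrite /Ih fI.
- by move=> x _; apply: exprn_ge0.
Qed.
End Interfaces.

(** * Walls with a common vertex *)

(* edge-adjacent columns, [vf d c' z] being the vertical faces between them *)
Definition ecol (d : bool) (c' c x : int * int) : Prop :=
  (c = c' /\ x = prv d c') \/ (x = c' /\ c = prv d c').
(** [flx] and [fly] are the reflections in the two lattice lines through [b]; they permute the four
    columns around [b]. *)
Definition flx (b c : int * int) : int * int := (2 * b.1 - 1 - c.1, c.2).
Definition fly (b c : int * int) : int * int := (c.1, 2 * b.2 - 1 - c.2).
Definition tch (g : face) (b : int * int) (z : int) : bool := pv g b && zv g z.

Lemma int_pair_eq (a b : int * int) : a.1 = b.1 -> a.2 = b.2 -> a = b.
Proof. by case: a b => [? ?] [? ?] /= -> ->. Qed.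

Lemma arndP b c : arnd b c -> (c.1 = b.1 \/ c.1 = b.1 - 1) /\ (c.2 = b.2 \/ c.2 = b.2 - 1).
Proof. by move=> /andP[/orP h1 /orP h2]; split; [case: h1 => /eqP|case: h2 => /eqP]; auto. Qed.

Lemma arnd_flx b c : arnd b c -> arnd b (flx b c).
Proof. rewrite /arnd /flx /=; lia. Qed.
Lemma arnd_fly b c : arnd b c -> arnd b (fly b c).
Proof. rewrite /arnd /fly /=; lia. Qed.

Lemma ecol_flx b c : arnd b c -> exists c', ecol true c' c (flx b c).
Proof.
move=> /arndP[[h|h] _]; [exists c; left|exists (flx b c); right]; split=> //;
  apply: int_pair_eq; rewrite /flx /prv /=; lia.
Qed.
Lemma ecol_fly b c : arnd b c -> exists c', ecol false c' c (fly b c).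
Proof.
move=> /arndP[_ [h|h]]; [exists c; left|exists (fly b c); right]; split=> //;
  apply: int_pair_eq; rewrite /fly /prv /=; lia.
Qed.

Lemma arnd_cases b c x : arnd b c -> arnd b x -> [\/ x = c, x = flx b c, x = fly b c | x = flx b (fly b c)].
Proof.
move=> /arndP[h1 h2] /arndP[h3 h4].
have [e1|n1] := eqVneq x.1 c.1; have [e2|n2] := eqVneq x.2 c.2.
- by apply: Or41; apply: int_pair_eq.
- by apply: Or43; apply: int_pair_eq => //; rewrite /fly /=; lia.
- by apply: Or42; apply: int_pair_eq => //; rewrite /flx /=; lia.
- by apply: Or44; apply: int_pair_eq => //; rewrite /fly /flx /=; lia.
Qed.

Lemma ecol_arnd d c' c x b : ecol d c' c x -> arnd b c -> arnd b x ->
  arnd b c' /\ arnd b (prv d c').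
Proof. by case=> -[-> ->]. Qed.

Lemma ecol_sym d c' c x : ecol d c' c x -> ecol d c' x c.
Proof. by case=> -[-> ->]; [right|left]. Qed.

(** The heights run from [-m - 1] to [m + 1]; all horizontal separating faces have heights between
    [-m] and [m]. *)
Definition par (m : nat) (a : int -> bool) : bool :=
  \big[addb/false]_(0 <= i < (2 * m + 3)%N) a (i%:Z - (m%:Z + 1)).

(** The edge condition is summed over a vertical line of edges; each vertical face occurs at two
    consecutive heights and cancels. *)
Lemma par_tele m (a b v x : int -> bool) : (forall z, a z (+) b z (+) v z (+) v (z - 1) = x z) ->
  (forall z, z < - m%:Z -> v z = false) -> (forall z, m%:Z <= z -> v z = false) ->
  par m a (+) par m b = par m x.
Proof.
move=> h lo hi; rewrite /par.
suff g N : \big[addb/false]_(0 <= i < N) a (i%:Z - (m%:Z + 1)) (+)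
    \big[addb/false]_(0 <= i < N) b (i%:Z - (m%:Z + 1)) =
    \big[addb/false]_(0 <= i < N) x (i%:Z - (m%:Z + 1)) (+) v (N%:Z - (m%:Z + 1) - 1).
  by rewrite g hi ?addbF //; lia.
elim: N => [|N IH]; first by rewrite !big_geq // lo //; lia.
rewrite !big_nat_recr //= -h (_ : N.+1%:Z - (m%:Z + 1) - 1 = N%:Z - (m%:Z + 1)); last lia.
move: IH; case: (bigop _ _ _); case: (bigop _ _ _); case: (bigop _ _ _);
case: (a _); case: (b _); case: (v (_ - 1)); by case: (v _).
Qed.

Lemma par_eq0 m (x : int -> bool) : (forall z, x z = false) -> par m x = false.
Proof. by move=> h; rewrite /par big1. Qed.

Lemma par_pt m (x : int -> bool) (h : int) : - m%:Z - 1 <= h <= m%:Z + 1 -> (forall z, x z = (z == h)) -> par m x = true.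
Proof.
move=> hh hx; rewrite /par (bigD1_seq (absz (h + m%:Z + 1)%R)) ?iota_uniq //; last first.
  by rewrite mem_index_iota; lia.
have [lo hi] := andP hh.
rewrite big1 /= ?addbF.
  by rewrite hx; apply/eqP; lia.
by move=> i ni; rewrite hx; apply/negbTE/negP => /eqP e; move/negP: ni; apply; apply/eqP; lia.
Qed.

Section Walls.
Variables (n m : nat) (T : field).
Hypothesis m_gt0 : (0 < m)%N.
Hypothesis dT : dob n m T.

Definition ceilc (c : int * int) (h : int) : Prop := forall z, T c z = (z < h).
Definition isceil (c : int * int) : bool := `[< exists h, ceilc c h >].
Definition wallf (f : face) : bool := sepf T f && ~~ (horizontal f && isceil (col f)).

Lemma isceilP c : reflect (exists h, ceilc c h) (isceil c). Proof. exact: asboolP. Qed.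

Lemma T_low c z : z < - m%:Z -> T c z = true.
Proof. by move=> h; rewrite dT; [lia|rewrite /inc; lia]. Qed.
Lemma T_high c z : m%:Z <= z -> T c z = false.
Proof. by move=> h; rewrite dT; [lia|rewrite /inc; lia]. Qed.

Lemma ceil_out c : ~~ inbox n c -> ceilc c 0.
Proof. by move=> h z; apply: dT; rewrite /inc (negbTE h). Qed.

Lemma ceil_bound c h : ceilc c h -> - m%:Z <= h <= m%:Z.
Proof.
move=> ch; have := ch m%:Z; rewrite T_high //; have := ch (- m%:Z - 1); rewrite T_low; lia.
Qed.

Lemma ceil_uniq c h h' : ceilc c h -> ceilc c h' -> h = h'.
Proof. move=> ch ch'; have := ch (h - 1); have := ch h; rewrite !ch'; lia. Qed.

Lemma sepf_ceil c (h z : int) : ceilc c h -> sepf T (hf c z) = (z == h).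
Proof. move=> ch; rewrite sepfE !ch; lia. Qed.

Lemma wallf_hf c z : wallf (hf c z) = sepf T (hf c z) && ~~ isceil c.
Proof. by rewrite /wallf horizontal_hf cohtE. Qed.
Lemma wallf_vf d c z : wallf (vf d c z) = sepf T (vf d c z).
Proof. by rewrite /wallf horizontal_vf andbT. Qed.
Lemma wallf_sepf f : wallf f -> sepf T f. Proof. by case/andP. Qed.

Lemma col_cross c : exists z, sepf T (hf c z).
Proof.
apply: contrapT => no.
suff h k : T c (k%:Z - m%:Z - 1) = true.
  by have := h (2 * m + 1)%N; rewrite T_high //; lia.
elim: k => [|k IH]; first by rewrite T_low //; lia.
apply: contrapT => h; apply: no; exists (k.+1%:Z - m%:Z - 1); rewrite sepfE.
by rewrite (_ : k.+1%:Z - m%:Z - 1 - 1 = k%:Z - m%:Z - 1) ?IH; [case: (T _ _) h|lia].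
Qed.

Lemma ceil_of_unique c (h : int) : (forall z, sepf T (hf c z) = (z == h)) -> ceilc c h.
Proof.
move=> u.
have dn k : T c (h - 1 - k%:Z) = T c (h - 1).
  elim: k => [|k <-]; first by rewrite subr0.
  have := u (h - 1 - k%:Z); rewrite sepfE (_ : h - 1 - k%:Z - 1 = h - 1 - k.+1%:Z); last lia.
  by rewrite (_ : (_ == h) = false); [move/negbFE/eqP|lia].
have up k : T c (h + k%:Z) = T c h.
  elim: k => [|k <-]; first by rewrite addr0.
  have := u (h + k.+1%:Z); rewrite sepfE (_ : h + k.+1%:Z - 1 = h + k%:Z); last lia.
  by rewrite (_ : (_ == h) = false); [move/negbFE/eqP|lia].
have l : T c (h - 1) = true by rewrite -(dn (absz (h + m%:Z + 1)%R)) T_low //; lia.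
have t : T c h = false by rewrite -(up (absz (h - m%:Z)%R)) T_high //; lia.
move=> z; case: ltP => zh.
  by rewrite (_ : z = h - 1 - (absz (h - 1 - z)%R)%:Z) ?dn //; lia.
by rewrite (_ : z = h + (absz (z - h)%R)%:Z) ?up //; lia.
Qed.

Definition wcon := conP wallf.
Definition inW (f0 g : face) : bool := `[< wallf f0 /\ wcon f0 g >].

Lemma inWP f0 g : reflect (wallf f0 /\ wcon f0 g) (inW f0 g). Proof. exact: asboolP. Qed.
Lemma inW_refl f0 : wallf f0 -> inW f0 f0.
Proof. by move=> w; apply/inWP; split=> //; apply: rt_refl. Qed.
Lemma inW_wallf f0 g : inW f0 g -> wallf g.
Proof. by move=> /inWP[w h]; apply: conP_mem h. Qed.
Lemma inW_sym f0 g : inW f0 g -> inW g f0.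
Proof. by move=> h; apply/inWP; split; [apply: inW_wallf h|apply: conP_sym; case/inWP: h]. Qed.
Lemma inW_trans f g h : inW f g -> inW g h -> inW f h.
Proof. by move=> /inWP[w fg] /inWP[_ gh]; apply/inWP; split=> //; apply: (rt_trans _ _ _ g). Qed.
Lemma inW_step f0 g h : inW f0 g -> wallf h -> sadj g h -> inW f0 h.
Proof.
move=> fg wh gh; have wg := inW_wallf fg; case/inWP: fg => w fg; apply/inWP; split=> //.
exact: conP_step fg wg wh gh.
Qed.
Lemma tch_sadj g h b z : tch g b z -> tch h b z -> sadj g h.
Proof. by move=> /andP[? ?] /andP[? ?]; apply/sadjP; exists b, z. Qed.
Lemma inW_tch f0 g h b z : inW f0 g -> wallf h -> tch g b z -> tch h b z -> inW f0 h.
Proof. by move=> fg wh tg th; apply: inW_step fg wh _; apply: tch_sadj th. Qed.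

Definition tW (f0 : face) (b : int * int) (z : int) : Prop := exists2 g, inW f0 g & tch g b z.

Lemma tW_inW f0 f1 b z : tW f0 b z -> tW f1 b z -> inW f0 f1.
Proof.
move=> [g fg tg] [h fh th]; apply: inW_trans (inW_sym fh).
by apply: inW_tch fg (inW_wallf fh) tg th.
Qed.

(** The invariant that tells walls apart: over a non-ceiling column it is odd for at most one
    wall. *)
Definition pW (f0 : face) (c : int * int) : bool := par m (fun z => inW f0 (hf c z)).

Lemma vf_ends d c z : (z < - m%:Z) || (m%:Z <= z) -> sepf T (vf d c z) = false.
Proof. by move=> /orP[h|h]; rewrite sepfE ?(T_low _ h) ?(T_high _ h). Qed.

Lemma pW_edge f0 d c x :
  (forall z, inW f0 (hf c z) (+) inW f0 (hf (prv d c) z) (+) inW f0 (vf d c z) (+)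
     inW f0 (vf d c (z - 1)) = x z) -> pW f0 c (+) pW f0 (prv d c) = par m x.
Proof.
move=> h; apply: par_tele h _ _ => z hz; apply/negP => /inW_wallf/wallf_sepf;
  by rewrite vf_ends // hz ?orbT.
Qed.

(** Walls are components among wall faces only, so they are even just at the edges where every
    separating face is a wall face: there a wall takes all of them or none. *)
Lemma inW_edge0 f0 f1 f2 f3 f4 : edge4 f1 f2 f3 f4 ->
  (forall f, f \in [:: f1; f2; f3; f4] -> sepf T f -> wallf f) ->
  inW f0 f1 (+) inW f0 f2 (+) inW f0 f3 (+) inW f0 f4 = false.
Proof.
move=> e4 hw; have adj := edge4_adj e4; have e := sepf_even T e4.
have [/hasP[g gin gW]|/hasPn none] := boolP (has (inW f0) [:: f1; f2; f3; f4]).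
  have h f : f \in [:: f1; f2; f3; f4] -> inW f0 f = sepf T f.
    move=> fin; apply/idP/idP => [/inW_wallf/wallf_sepf//|sf].
    by apply: inW_step gW (hw _ fin sf) _; apply: adj.
  by rewrite !h // !inE eqxx ?orbT.
by rewrite !(negbTE (none _ _)) // !inE eqxx ?orbT.
Qed.

Lemma pW_adj f0 d c' c x : ecol d c' c x -> ~~ isceil c -> ~~ isceil x -> pW f0 c = pW f0 x.
Proof.
move=> ec nc nx; have [n1 n2] : ~~ isceil c' /\ ~~ isceil (prv d c').
  by case: ec nc nx => -[-> ->].
suff : pW f0 c' (+) pW f0 (prv d c') = false.
  by case: ec => -[-> ->]; case: (pW _ _); case: (pW _ _).
rewrite (@pW_edge f0 d c' (fun=> false)) ?par_eq0 // => z.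
apply: inW_edge0 (Edge4h d c' z) _ => f; rewrite !inE => /or4P[] /eqP->;
  by rewrite ?wallf_hf ?wallf_vf ?n1 ?n2 => ->.
Qed.

Lemma edge4h_tch d c z g b : g \in [:: hf c z; hf (prv d c) z; vf d c z; vf d c (z - 1)] ->
  arnd b c -> arnd b (prv d c) -> tch g b z.
Proof.
move=> gin h1 h2; move: gin; rewrite !inE /tch => /or4P[] /eqP->;
  by rewrite pvE zvE ?h1 ?h2 ?eqxx //= subrK eqxx orbT.
Qed.

(* the faces on the edge of a ceiling [c] towards a wall column [x] single out the wall
   that has an odd number of horizontal faces over [x] *)
Lemma ceil_wall_edge d c' c x h : ecol d c' c x -> ceilc c h -> ~~ isceil x ->
  exists g, [/\ wallf g, forall b, arnd b c -> arnd b x -> tch g b h &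
    forall f0, pW f0 x = inW f0 g].
Proof.
move=> ec ch nx.
have bd : - m%:Z - 1 <= h <= m%:Z + 1 by have := ceil_bound ch; lia.
set E := [:: hf c' h; hf (prv d c') h; vf d c' h; vf d c' (h - 1)].
have ic : isceil c by apply/isceilP; exists h.
have cc : c = c' \/ c = prv d c' by case: ec => -[]; auto.
have cE : hf c h \in E by case: cc => ->; rewrite !inE eqxx ?orbT.
have pd : c' <> prv d c'.
  by rewrite /prv; case: (d) => e; have := congr1 fst e; have := congr1 snd e; rewrite /=; lia.
have hw f : f \in E -> sepf T f -> f != hf c h -> wallf f.
  rewrite !inE => /or4P[] /eqP->; rewrite ?wallf_vf ?wallf_hf // => -> /=;
  by case: ec nx => -[-> ->]; rewrite ?eqxx //.
have ev4 := sepf_even T (Edge4h d c' h).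
have sc : sepf T (hf c h) by rewrite (sepf_ceil _ ch).
(* Otherwise the ceiling face would be the only separating face around this edge, against
   evenness. *)
have [g gE wg] : exists2 g, g \in E & wallf g.
  apply: contrapT => no.
  have sE f : f \in E -> sepf T f = (f == hf c h).
    move=> fE; apply/idP/eqP => [sf|->//]; apply/eqP/negPn/negP => ne.
    by apply: no; exists f => //; apply: hw.
  move: ev4; rewrite !sE ?inE ?eqxx ?orbT //.
  have vh d1 c1 z1 : (vf d1 c1 z1 == hf c h) = false by apply/eqP => /esym/hf_vf.
  by rewrite !vh !addbF; case: cc => ->; rewrite eqxx; case: eqP => // /hf_inj[e _]; case: pd.
have tE f b : f \in E -> arnd b c -> arnd b x -> tch f b h.
  move=> fE bc bx; have [h1 h2] := ecol_arnd ec bc bx; exact: edge4h_tch fE h1 h2.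
exists g; split=> // [b|f0]; first exact: tE.
have fx0 z : z != h -> inW f0 (hf c' z) (+) inW f0 (hf (prv d c') z) (+) inW f0 (vf d c' z) (+)
     inW f0 (vf d c' (z - 1)) = false.
  move=> zh; apply: inW_edge0 (Edge4h d c' z) _ => f; rewrite !inE => /or4P[] /eqP->;
  rewrite ?wallf_vf ?wallf_hf // => sf; rewrite sf /=; apply/negP => ic';
  case: ec => -[e1 e2]; move: ic' sf; rewrite -?e2 -?e1 ?(negbTE nx) // => _;
  by rewrite (sepf_ceil _ ch) (negbTE zh).
have pc : pW f0 c = false.
  by apply: par_eq0 => z; apply/negP => /inW_wallf; rewrite wallf_hf ic andbF.
have cW : inW f0 (hf c h) = false.
  by apply/negP => /inW_wallf; rewrite wallf_hf ic andbF.
have [gW|gW] := boolP (inW f0 g).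
  suff : pW f0 c' (+) pW f0 (prv d c') = true.
    by case: ec pc => -[-> ->] ->; rewrite ?addFb ?addbF.
  rewrite (@pW_edge f0 d c' (fun z => z == h)); first exact: (@par_pt _ _ h).
  move=> z; have [->|zh] := eqVneq z h; last exact: fx0.
  have hW f : f \in E -> f != hf c h -> inW f0 f = sepf T f.
    move=> fE ne; apply/idP/idP => [/inW_wallf/wallf_sepf//|sf].
    by apply: inW_step gW (hw _ fE sf ne) _; apply: (edge4_adj (Edge4h d c' h)).
  have hW' f : f \in E -> inW f0 f = sepf T f (+) (f == hf c h).
    move=> fE; have [->|ne] := eqVneq f (hf c h); first by rewrite cW sc.
    by rewrite hW // addbF.
  rewrite !hW' ?inE ?eqxx ?orbT //.
  have vh d1 c1 z1 : (vf d1 c1 z1 == hf c h) = false by apply/eqP => /esym/hf_vf.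
  have : (hf c' h == hf c h) (+) (hf (prv d c') h == hf c h) = true.
    by case: cc => ->; rewrite eqxx; case: eqP => // /hf_inj[e _]; case: pd.
  rewrite !vh !addbF; move: ev4; case: (sepf T (hf c' h)); case: (sepf T (hf (prv d c') h));
    case: (sepf T (vf d c' h)); case: (sepf _ _);
    by case: (hf c' h == _); case: (hf (prv d c') h == _).
suff : pW f0 c' (+) pW f0 (prv d c') = false.
  by case: ec pc => -[-> ->] ->; rewrite ?addFb ?addbF.
rewrite (@pW_edge f0 d c' (fun=> false)) ?par_eq0 // => z.
have [->|zh] := eqVneq z h; last exact: fx0.
have none f : f \in E -> inW f0 f = false.
  move=> fE; apply/negP => fW; move/negP: gW; apply.
  by apply: inW_step fW wg _; apply: (edge4_adj (Edge4h d c' h)).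
by rewrite !none // !inE eqxx ?orbT.
Qed.

Lemma vf_sepf_ceil d c' c x h h' z : ecol d c' c x -> ceilc c h -> ceilc x h' ->
  sepf T (vf d c' z) = (z < h) (+) (z < h').
Proof. by move=> ec ch cx; rewrite sepfE; case: ec => -[<- <-]; rewrite ch cx; case: (z < h); case: (z < h'). Qed.

(** Between adjacent ceilings, every vertical face at a height from one ceiling to the other is
    separating, and these faces form a vertical strip of a single wall. *)
Lemma strip_up d c' c x h h' b f0 z : ecol d c' c x -> ceilc c h -> ceilc x h' ->
  arnd b c -> arnd b x -> (h <= z < h') || (h' <= z < h) -> tW f0 b z <-> tW f0 b (z + 1).
Proof.
move=> ec ch cx bc bx hz; have [b1 b2] := ecol_arnd ec bc bx.
have wv : wallf (vf d c' z) by rewrite wallf_vf (vf_sepf_ceil _ ec ch cx); lia.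
have t0 : tch (vf d c' z) b z by rewrite /tch pvE zvE b1 b2 eqxx.
have t1 : tch (vf d c' z) b (z + 1) by rewrite /tch pvE zvE b1 b2 eqxx orbT.
by split=> -[g gW tg]; exists (vf d c' z) => //; apply: inW_tch gW wv tg _.
Qed.

Lemma strip d c' c x h h' b f0 z : ecol d c' c x -> ceilc c h -> ceilc x h' ->
  arnd b c -> arnd b x -> (h <= z <= h') || (h' <= z <= h) -> tW f0 b z -> tW f0 b h.
Proof.
move=> ec ch cx bc bx hz tz.
have [hle|hle] := leP h z.
  have [k zk] : exists k : nat, z = h + k%:Z by exists (absz (z - h)%R); lia.
  elim: k z zk hz tz {hle} => [|k IH] z zk hz; first by rewrite zk addr0.
  have -> : z = (h + k%:Z) + 1 by lia.
  move/(strip_up f0 ec ch cx bc bx (z := h + k%:Z)) => tz; apply: (IH (h + k%:Z)) => //; first by lia.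
  by apply: tz; lia.
have [k zk] : exists k : nat, z = h - k%:Z by exists (absz (h - z)%R); lia.
elim: k z zk hz tz {hle} => [|k IH] z zk hz; first by rewrite zk subr0.
move/(strip_up f0 ec ch cx bc bx (z := z)) => tz; apply: (IH (z + 1)); [lia|lia|].
by apply: tz; lia.
Qed.

Lemma strip_to d c' c x h h' b f0 : ecol d c' c x -> ceilc c h -> ceilc x h' ->
  arnd b c -> arnd b x -> tW f0 b h -> tW f0 b h'.
Proof.
move=> ec ch cx bc bx; apply: (strip (ecol_sym ec) cx ch) => //; lia.
Qed.

Lemma strip_vf d c' c x h h' b f0 z : ecol d c' c x -> ceilc c h -> ceilc x h' ->
  arnd b c -> arnd b x -> inW f0 (vf d c' z) -> tW f0 b h.
Proof.
move=> ec ch cx bc bx vW; have [b1 b2] := ecol_arnd ec bc bx.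
have : sepf T (vf d c' z) by apply: wallf_sepf; apply: inW_wallf vW.
rewrite (vf_sepf_ceil _ ec ch cx) => hz.
apply: (strip ec ch cx bc bx (z := z)); first by move: hz; lia.
by exists (vf d c' z) => //; rewrite /tch pvE zvE b1 b2 eqxx.
Qed.

(** Otherwise the ceiling at height [h] would extend from column to column around [b], and with four
    ceilings of the same height there is no wall face over [b]. *)
Lemma wall_meets_ceil b c h g : arnd b c -> ceilc c h -> wallf g -> pv g b ->
  exists2 g', wallf g' & tch g' b h.
Proof.
move=> bc ch wg gb; apply: contrapT => no.
have adj d c' y x : ecol d c' y x -> arnd b y -> arnd b x -> ceilc y h -> ceilc x h.
  move=> ec hb hx cy; have [b1 b2] := ecol_arnd ec hb hx.
  have [/isceilP[h' cx]|nx] := boolP (isceil x); last first.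
    have [g' [wg' tg' _]] := ceil_wall_edge ec cy nx.
    by exfalso; apply: no; exists g' => //; apply: tg'.
  have [->//|ne] := eqVneq h h'; exfalso; apply: no.
  have [lt|ge] := ltP h h'.
    exists (vf d c' h); first by rewrite wallf_vf (vf_sepf_ceil _ ec cy cx); lia.
    by rewrite /tch pvE zvE b1 b2 eqxx.
  exists (vf d c' (h - 1)); first by rewrite wallf_vf (vf_sepf_ceil _ ec cy cx); lia.
  by rewrite /tch pvE zvE b1 b2 subrK eqxx orbT.
have all4 x : arnd b x -> ceilc x h.
  have [c1 e1] := ecol_flx bc; have [c2 e2] := ecol_fly bc.
  have bx := arnd_flx bc; have bcy := arnd_fly bc.
  have [c3 e3] := ecol_flx bcy.
  have cx := adj _ _ _ _ e1 bc bx ch; have cy := adj _ _ _ _ e2 bc bcy ch.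
  have cxy := adj _ _ _ _ e3 bcy (arnd_flx bcy) cy.
  by case/(arnd_cases bc) => ->.
move: wg gb; elim/face_ind: g => [x z|d x z].
  rewrite wallf_hf pvE => /andP[_ nx] /all4 cx; case/negP: nx; apply/isceilP; by exists h.
rewrite wallf_vf pvE => sv /andP[/all4 cx /all4 cp]; move: sv.
by rewrite (@vf_sepf_ceil d x x (prv d x) h h) //; [case: (z < h)|left].
Qed.

(** For a column adjacent to [c] this is [ceil_wall_edge]. The opposite column is reached through an
    intermediate one: if that is a ceiling, a strip carries the wall to its height; if not, it has
    the same parity as [x]. *)
Lemma pW_near_ceil b c h f0 : arnd b c -> ceilc c h -> tW f0 b h ->
  forall x f1, arnd b x -> ~~ isceil x -> pW f1 x = inW f0 f1.
Proof.
move=> bc ch t0 x f1 bx nx.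
have near d c' y h' : ecol d c' y x -> arnd b y -> ceilc y h' -> tW f0 b h' -> pW f1 x = inW f0 f1.
  move=> ec hy cy [g gW tg]; have [g' [wg' tg' ->]] := ceil_wall_edge ec cy nx.
  have g0 : inW f0 g' by apply: inW_tch gW wg' tg _; apply: tg'.
  by apply/idP/idP => [h1|h1]; [apply: inW_trans g0 (inW_sym h1)|apply: inW_trans (inW_sym h1) g0].
have [c1 e1] := ecol_flx bc; have [c2 e2] := ecol_fly bc.
have bcy := arnd_fly bc; have [c3 e3] := ecol_flx bcy.
case: (arnd_cases bc bx) => ex; subst x.
- by case/negP: nx; apply/isceilP; exists h.
- exact: near e1 bc ch t0.
- exact: near e2 bc ch t0.
have [/isceilP[h' cy]|ny] := boolP (isceil (fly b c)).
  have t1 := strip_to e2 ch cy bc bcy t0; exact: near e3 bcy cy t1.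
rewrite -(pW_adj f1 e3) //.
have near2 : pW f1 (fly b c) = inW f0 f1.
  have [g gW tg] := t0; have [g' [wg' tg' ->]] := ceil_wall_edge e2 ch ny.
  have g0 : inW f0 g' by apply: inW_tch gW wg' tg _; apply: tg'.
  by apply/idP/idP => [h1|h1]; [apply: inW_trans g0 (inW_sym h1)|apply: inW_trans (inW_sym h1) g0].
exact: near2.
Qed.

Definition oddW (f0 : face) (b : int * int) : Prop :=
  forall x, arnd b x -> ~~ isceil x -> pW f0 x = true.

Lemma oddW_of_col f0 b x : arnd b x -> ~~ isceil x -> pW f0 x = true -> oddW f0 b.
Proof.
move=> bx nx px.
have [[c [h [bc ch]]]|no] := pselect (exists c h, arnd b c /\ ceilc c h).
  have [z sz] := col_cross x.
  have wz : wallf (hf x z) by rewrite wallf_hf sz.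
  have [g wg tg] : exists2 g', wallf g' & tch g' b h.
    by apply: (wall_meets_ceil bc ch wz); rewrite pvE.
  have tW' : tW g b h by exists g => //; apply: inW_refl.
  have := pW_near_ceil bc ch tW' f0 bx nx; rewrite px => gf0 y hy ny.
  by rewrite (pW_near_ceil bc ch tW' f0 hy ny).
have nc y : arnd b y -> ~~ isceil y.
  by move=> hy; apply/negP => /isceilP[h ch]; apply: no; exists y, h.
move=> y hy ny.
have [c1 e1] := ecol_flx bx; have [c2 e2] := ecol_fly bx.
have b2 := arnd_fly bx; have [c3 e3] := ecol_flx b2.
have b1 := arnd_flx bx; have b3 := arnd_flx b2.
have p1 := pW_adj f0 e1 nx (nc _ b1); have p2 := pW_adj f0 e2 nx (nc _ b2).
have p3 := pW_adj f0 e3 (nc _ b2) (nc _ b3).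
by case: (arnd_cases bx hy) => ->; rewrite -?p3 -?p2 -?p1.
Qed.

Hypothesis cT : forall f, sepf T f -> exists g, outL n g /\ conP (sepf T) g f.

(** A path of separating faces from the wall to the faces outside the box has to leave the wall, and
    it can only do so through a ceiling face. *)
Lemma wall_touches_ceil f0 : wallf f0 -> exists b c h, [/\ arnd b c, ceilc c h & tW f0 b h].
Proof.
move=> w0; apply: contrapT => no.
have [g [og gf]] := cT (wallf_sepf w0).
have /inW_wallf : inW f0 g.
  apply: (@conP_stay (sepf T) (fun x => inW f0 x) f0) (conP_sym gf); last exact: inW_refl.
  move=> x y sx sy xW xy; apply: (inW_step xW) => //; apply: contrapT => wy.
  apply: no; have hy : horizontal y && isceil (col y).
    by apply: contrapT => /negP hy; apply: wy; rewrite /wallf sy hy.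
  have [hor /isceilP[h ch]] := andP hy.
  have [b [z [xb xz yb yz]]] := sadjP _ _ xy.
  have hh : z = h.
    move: sy yz; rewrite (horizontalP hor) (sepf_ceil _ ch) zvE => /eqP ->; by move/eqP.
  exists b, (col y), h; split=> //; first exact: arnd_col.
  by exists x => //; rewrite /tch xb -hh.
rewrite /wallf => /andP[_]; case/and3P: og => hor _ nb; rewrite hor /=.
by move/negP; apply; apply/isceilP; exists 0; apply: ceil_out.
Qed.

(** Oddness holds where the wall meets a ceiling and spreads along it: two vertices of the
    projection of a face have in common a non-ceiling column or the strip between two ceilings. *)
Lemma oddW_wall f0 f b : inW f0 f -> pv f b -> oddW f0 b.
Proof.
move=> fW; have w0 : wallf f0 by case/inWP: fW.
have inface g b1 b2 : inW f0 g -> pv g b1 -> pv g b2 -> oddW f0 b1 -> oddW f0 b2.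
  elim/face_ind: g => [c z|d c z] gW; rewrite !pvE.
    move=> h1 h2 o1; have nc : ~~ isceil c by have := inW_wallf gW; rewrite wallf_hf => /andP[].
    by apply: (oddW_of_col h2 nc); apply: o1.
  move=> /andP[h1 h1'] /andP[h2 h2'] o1.
  have [/isceilP[h ch]|nc] := boolP (isceil c); last by apply: (oddW_of_col h2 nc); apply: o1.
  have [/isceilP[h' cp]|nc] := boolP (isceil (prv d c)); last by apply: (oddW_of_col h2' nc); apply: o1.
  have ec : ecol d c c (prv d c) by left.
  have t2 := strip_vf ec ch cp h2 h2' gW.
  move=> x hx nx; rewrite (pW_near_ceil h2 ch t2 f0 hx nx); exact: inW_refl.
have [b0 [c [h [b0c ch t0]]]] := wall_touches_ceil w0.
have o0 : oddW f0 b0.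
  move=> x hx nx; rewrite (pW_near_ceil b0c ch t0 f0 hx nx); exact: inW_refl.
have [g gW /andP[gb0 _]] := t0.
have : inW f0 f /\ forall b, pv f b -> oddW f0 b.
  have gf : wcon g f by case/inWP: (inW_trans (inW_sym gW) fW).
  apply: (@conP_stay wallf (fun f => inW f0 f /\ forall b, pv f b -> oddW f0 b) g) gf.
    move=> x y wx wy [xW ox] xy; have yW := inW_step xW wy xy; split=> // b' yb'.
    have [b1 [z [xb _ yb _]]] := sadjP _ _ xy.
    exact: inface yW yb yb' (ox _ xb).
  by split=> // b' gb'; apply: inface gW gb0 gb' o0.
by case=> _; apply.
Qed.

(** Move left through non-ceiling columns, which keeps both parities, until the next column is a
    ceiling; there a single face determines the odd wall. Columns left of the box are ceilings, so
    the walk stops. *)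
Lemma pW_unique k f f' (c : int * int) : c.1 + n%:Z < k%:Z -> ~~ isceil c -> pW f c -> pW f' c -> inW f f'.
Proof.
elim: k c => [|k IH] c lt nc pc pc'.
  case/negP: nc; apply/isceilP; exists 0; apply: ceil_out.
  apply/negP => /and4P[h1 _ _ _]. lia.
have ec : ecol true c (prv true c) c by right.
have [/isceilP[h ch]|np] := boolP (isceil (prv true c)).
  have [g [wg _ hg]] := ceil_wall_edge ec ch nc.
  by move: pc pc'; rewrite !hg => h1 h2; apply: inW_trans h1 (inW_sym h2).
apply: (IH (prv true c)) => //.
- by rewrite /prv /=; lia.
- by rewrite (pW_adj f ec np nc).
- by rewrite (pW_adj f' ec np nc).
Qed.

(** If some column at [b] is not a ceiling, both walls are odd over it, hence equal. If all four are
    ceilings, the wall faces over [b] are vertical and the strips around [b] link each of them to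
    the height [h]. *)
Lemma wall_over_vertex f f' b : wallf f -> wallf f' -> pv f b -> pv f' b -> inW f f'.
Proof.
move=> wf wf' fb fb'.
have [[x [bx nx]]|no] := pselect (exists x, arnd b x /\ ~~ isceil x).
  have p1 := oddW_wall (inW_refl wf) fb bx nx.
  have p2 := oddW_wall (inW_refl wf') fb' bx nx.
  by apply: (@pW_unique (absz (x.1 + n%:Z)%R).+1 _ _ x); rewrite ?p1 ?p2 //; lia.
have ac x : arnd b x -> exists h, ceilc x h.
  by move=> hx; apply/isceilP; apply: contrapT => /negP nx; apply: no; exists x.
have bb : arnd b b by rewrite /arnd !eqxx.
have [h ch] := ac b bb.
suff tt f0 : wallf f0 -> pv f0 b -> tW f0 b h by apply: tW_inW (tt _ wf fb) (tt _ wf' fb').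
move=> w0 f0b; have [x [hx [bx cx tx]]] : exists x hx, [/\ arnd b x, ceilc x hx & tW f0 b hx].
  move: (w0) f0b; rewrite -/(wallf f0).
  elim/face_ind: f0 w0 => [c z|d c z] w0 _; rewrite pvE.
    move=> bc; case: (ac c bc) => hc cc; move: w0; rewrite wallf_hf => /andP[_ /negP[]].
    by apply/isceilP; exists hc.
  move=> /andP[bc bp]; have [hc cc] := ac c bc; have [hp cp] := ac _ bp.
  exists c, hc; split=> //.
  by apply: (@strip_vf d c c (prv d c) hc hp b _ z) => //; [left|apply: inW_refl].
have [c1 e1] := ecol_flx bx; have [c2 e2] := ecol_fly bx.
have b2 := arnd_fly bx; have [c3 e3] := ecol_flx b2.
have b1 := arnd_flx bx; have b3 := arnd_flx b2.
have [h1 k1] := ac _ b1; have [h2 k2] := ac _ b2; have [h3 k3] := ac _ b3.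
have t1 := strip_to e1 cx k1 bx b1 tx; have t2 := strip_to e2 cx k2 bx b2 tx.
have t3 := strip_to e3 k2 k3 b2 b3 t2.
case: (arnd_cases bx bb) => eb.
- have ch' : ceilc x h by rewrite -eb.
  by rewrite -(ceil_uniq cx ch').
- have ch' : ceilc (flx b x) h by rewrite -eb.
  by rewrite -(ceil_uniq k1 ch').
- have ch' : ceilc (fly b x) h by rewrite -eb.
  by rewrite -(ceil_uniq k2 ch').
- have ch' : ceilc (flx b (fly b x)) h by rewrite -eb.
  by rewrite -(ceil_uniq k3 ch').
Qed.
End Walls.

(** * Deleting a wall *)

Definition b2z (b : bool) : int := if b then 1 else 0.

Lemma sum_b2z_lt (N k : nat) : (k <= N)%N -> \sum_(0 <= i < N) b2z (i < k)%N = k%:Z.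
Proof.
have h (M : nat) : \sum_(0 <= i < M) b2z (i < k)%N = (minn k M)%:Z.
  elim: M => [|M IH]; first by rewrite big_geq // minn0.
  by rewrite big_nat_recr //= IH /b2z; case: ltnP => h; lia.
by move=> kN; rewrite h; lia.
Qed.

Lemma sum_int_recr (F : nat -> int) (N : nat) :
  \sum_(0 <= i < N.+1) F i = (\sum_(0 <= i < N) F i : int) + F N.
Proof. by rewrite big_nat_recr. Qed.

Lemma shift_hf k c z : shift_face k (hf c z) = hf c (z + k).
Proof. by congr (_, _); apply: pt_eq; rewrite !ffunE /= ?mul0r ?mul1r ?addr0. Qed.
Lemma shift_vf k d c z : shift_face k (vf d c z) = vf d c (z + k).
Proof. by congr (_, _); apply: pt_eq; rewrite !ffunE /= ?mul0r ?mul1r ?addr0. Qed.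
Definition shiftE := (shift_hf, shift_vf).
Lemma col_shift k f : col (shift_face k f) = col f.
Proof. by elim/face_ind: f => [c z|d c z]; rewrite shiftE !cohtE. Qed.
Lemma ht_shift k f : ht (shift_face k f) = ht f + k.
Proof. by elim/face_ind: f => [c z|d c z]; rewrite shiftE !cohtE. Qed.
Lemma horizontal_shift k f : horizontal (shift_face k f) = horizontal f.
Proof. by []. Qed.
Lemma pv_shift k f b : pv (shift_face k f) b = pv f b.
Proof. by elim/face_ind: f => [c z|d c z]; rewrite shiftE !pvE. Qed.
Lemma zv_shift k f z : zv (shift_face k f) (z + k) = zv f z.
Proof. by elim/face_ind: f => [c x|d c x]; rewrite shiftE !zvE; lia. Qed.
Lemma shift_shift k l f : shift_face k (shift_face l f) = shift_face (l + k) f.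
Proof. by elim/face_ind: f => [c x|d c x]; rewrite !shiftE addrA. Qed.
Lemma shift0 f : shift_face 0 f = f.
Proof. by elim/face_ind: f => [c x|d c x]; rewrite !shiftE addr0. Qed.
Lemma shiftNK k f : shift_face k (shift_face (- k) f) = f.
Proof. by rewrite shift_shift addNr shift0. Qed.
Lemma shiftK k f : shift_face (- k) (shift_face k f) = f.
Proof. by rewrite shift_shift addrN shift0. Qed.
Lemma sadj_shift k f g : sadj f g -> sadj (shift_face k f) (shift_face k g).
Proof.
by move=> /sadjP[b [z [h1 h2 h3 h4]]]; apply/sadjP; exists b, (z + k); rewrite !pv_shift !zv_shift.
Qed.

Definition shS (k : int) (W : {fset face}) : {fset face} := [fset shift_face k f | f in W]%fset.
Lemma in_shS k W f : (f \in shS k W) = (shift_face (- k) f \in W).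
Proof.
apply/imfsetP/idP => [[g gW ->]|h]; first by rewrite shiftK.
by exists (shift_face (- k) f) => //; rewrite shiftNK.
Qed.
Lemma shS_shS k l W : shS k (shS l W) = shS (l + k) W.
Proof. by apply/fsetP => f; rewrite !in_shS shift_shift (_ : - k + - l = - (l + k)) //; lia. Qed.
Lemma shS0 W : shS 0 W = W.
Proof. by apply/fsetP => f; rewrite in_shS oppr0 shift0. Qed.
Lemma rhoW_shS k W : rhoW (shS k W) = rhoW W.
Proof.
have h l V c : rhoW V c -> rhoW (shS l V) c.
  move=> [f [fV pf]]; exists (shift_face l f); split; first by rewrite in_shS shiftK.
  by move: pf; rewrite /proj_face !ffunE /= !mul0r !addr0.
apply/funext => c; apply/propext; split; last exact: h.
by move/(h (- k)); rewrite shS_shS addrN shS0.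
Qed.

Definition iswall (T : field) (W : {fset face}) : Prop :=
  exists f0, wallf T f0 /\ forall g, (g \in W) = inW T f0 g.
Definition stdof (T : field) (W K : {fset face}) : Prop :=
  exists g, [/\ horizontal g, ceilc T (col g) (ht g), exists2 f, f \in W & sadj f g,
    in_unbounded (rhoW W) (face_cell g) & K = shS (- ht g) W].

Definition excols (W : {fset face}) : {fset cell2} := [fset face_cell f | f in W & horizontal f]%fset.

Lemma face_cell_col f g : face_cell f = face_cell g -> col f = col g.
Proof. by rewrite /face_cell /col => -[h1 h2]; apply: int_pair_eq => /=; lia. Qed.

Lemma in_excols W y : reflect (exists f, [/\ f \in W, horizontal f & y = face_cell f]) (y \in excols W).
Proof.
apply: (iffP (imfsetP _ _ _ _)) => [[f]|[f [fW hf_ ->]]].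
  by rewrite !inE /= => /andP[fW hf_] ->; exists f.
by exists f => //; rewrite !inE /= fW.
Qed.

Lemma dob_le n m M T : (m <= M)%N -> dob n m T -> dob n M T.
Proof. move=> mM dT c z h; apply: dT; move: h; rewrite /inc; case: (inbox n c) => //=; lia. Qed.

(** For a wall in the box, the distance from its leftmost column to [n]. It ignores vertical shifts
    and drops strictly from a wall to those it encloses, which makes it the parameter of the
    induction. *)
Definition ext (n : nat) (K : {fset face}) : nat := \max_(f <- K) absz (n%:Z - (col f).1)%R.

Lemma ext_shS n k K : ext n (shS k K) = ext n K.
Proof.
have le l V : (ext n (shS l V) <= ext n V)%N.
  apply/bigmax_leqP_seq => f; rewrite in_shS => fV _.
  by rewrite -(col_shift (- l) f); apply: (@leq_bigmax_seq _ (enum_fset V) xpredT (fun f => absz (n%:Z - (col f).1)%R)).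
apply/eqP; rewrite eqn_leq le /=.
by have := le (- k) (shS k K); rewrite shS_shS addrN shS0.
Qed.

(* the closed unit square over the column [c] contains the cell [u] *)
Definition cov (u : cell2) (c : int * int) : bool :=
  [&& 2 * c.1 <= u.1, u.1 <= 2 * c.1 + 2, 2 * c.2 <= u.2 & u.2 <= 2 * c.2 + 2].

Lemma oddzP x : oddz x -> exists y, x = 2 * y + 1.
Proof. rewrite /oddz => h; exists ((x %/ 2)%Z); lia. Qed.

Lemma pv_col f : pv f (col f).
Proof.
by elim/face_ind: f => [c z|[] c z]; rewrite pvE cohtE /arnd /prv /= !eqxx ?orbT.
Qed.

Lemma cov_le u v c : le_cell u v -> cov v c -> cov u c.
Proof.
move=> [h1 h2] /and4P[c1 c2 c3 c4]; rewrite /cov.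
have [a1 a2] : 2 * c.1 <= u.1 /\ u.1 <= 2 * c.1 + 2.
  by case: h1 => [->|[/oddzP[y ey] h]] //; rewrite ey in c1 c2 h; lia.
have [a3 a4] : 2 * c.2 <= u.2 /\ u.2 <= 2 * c.2 + 2.
  by case: h2 => [->|[/oddzP[y ey] h]] //; rewrite ey in c3 c4 h; lia.
by rewrite a1 a2 a3 a4.
Qed.

Lemma cov_ex u : exists c, cov u c.
Proof. exists ((u.1 %/ 2)%Z, (u.2 %/ 2)%Z); rewrite /cov /=; lia. Qed.

Lemma far_out (n : nat) (v x : int * int) : (2 * n + 4)%N%:Z <= `|v.1| \/ (2 * n + 4)%N%:Z <= `|v.2| ->
  cov v x -> ~~ inbox n x.
Proof. case: v => [a b] /=; rewrite /cov /inbox /=; case=> h; lia. Qed.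

Lemma cov_proj f u : proj_face f u -> cov u (col f).
Proof. rewrite /proj_face /cov /col /= => -[]; do 2 case: ifP; lia. Qed.

Lemma proj_vertex f b : pv f b -> proj_face f (2 * b.1, 2 * b.2).
Proof.
rewrite /pv /proj_face /= => /andP[]; split; [case: ifP a|case: ifP b0]; lia.
Qed.

Section Delete.
Variables (n m : nat) (T : field).
Hypothesis m_gt0 : (0 < m)%N.
Hypothesis dT : dob n m T.
Hypothesis cT : forall f, sepf T f -> exists g, outL n g /\ conP (sepf T) g f.
Variables (W : {fset face}) (f0 : face).
Hypothesis w0 : wallf T f0.
Hypothesis hW : forall g, (g \in W) = inW T f0 g.

Definition vW (b : int * int) : bool := `[< exists2 f, f \in W & pv f b >].
Definition fW (c : int * int) : bool := `[< exists z, hf c z \in W >].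

Lemma vWP b : reflect (exists2 f, f \in W & pv f b) (vW b). Proof. exact: asboolP. Qed.
Lemma fWP c : reflect (exists z, hf c z \in W) (fW c). Proof. exact: asboolP. Qed.

Lemma W_wallf f : f \in W -> wallf T f. Proof. by rewrite hW; apply: inW_wallf. Qed.
Lemma W_sepf f : f \in W -> sepf T f. Proof. by move=> /W_wallf/wallf_sepf. Qed.
Lemma f0W : f0 \in W. Proof. by rewrite hW; apply: inW_refl. Qed.

Lemma over_W f b : wallf T f -> pv f b -> vW b -> f \in W.
Proof.
move=> wf fb /vWP[g gW gb]; rewrite hW; apply: inW_trans (_ : inW T f0 g) _; first by rewrite -hW.
exact: (wall_over_vertex m_gt0 dT cT (W_wallf gW) wf gb fb).
Qed.

Lemma W_inwin f : f \in W -> inwin n m f.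
Proof.
move=> fW_; apply: contrapT => /negP nw.
have := W_sepf fW_; rewrite (sepf_out m_gt0 dT nw) => /and3P[hor _ nb].
have := W_wallf fW_; rewrite /wallf hor => /andP[_ /negP]; apply.
by apply/isceilP; exists 0; exact: (ceil_out dT nb).
Qed.

Lemma fW_nceil c : fW c -> ~~ isceil T c.
Proof. by move=> /fWP[z /W_wallf]; rewrite wallf_hf => /andP[]. Qed.

Lemma fW_vW c b : fW c -> arnd b c -> vW b.
Proof. by move=> /fWP[z zW] bc; apply/vWP; exists (hf c z) => //; rewrite pvE. Qed.

Lemma near_W b c : vW b -> arnd b c -> ~~ fW c -> exists h, ceilc T c h.
Proof.
move=> vb bc nf; apply/isceilP; apply: contrapT => /negP nc; move/negP: nf; apply.
have [z sz] := col_cross m_gt0 dT c; apply/fWP; exists z.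
by apply: over_W vb; rewrite ?wallf_hf ?sz ?pvE.
Qed.

Definition colsum (c : int * int) : int := \sum_(0 <= i < (2 * m)%N) b2z (T c (i%:Z - m%:Z)).
(** A height for every column, obtained by counting plus cells; on a ceiling it is the height of the
    ceiling. *)
Definition Hgt (c : int * int) : int := colsum c - m%:Z.

Lemma Hgt_ceil c (h : int) : ceilc T c h -> Hgt c = h.
Proof.
move=> ch; have /andP[b1 b2] := ceil_bound m_gt0 dT ch.
rewrite /Hgt /colsum (eq_bigr (fun i => b2z (i < absz (h + m%:Z)%R)%N)); last first.
  by move=> i _; rewrite ch; congr b2z; lia.
rewrite sum_b2z_lt; lia.
Qed.

Lemma Hgt_bound c : - m%:Z <= Hgt c <= m%:Z.
Proof.
rewrite /Hgt; suff h (N : nat) F : 0 <= \sum_(0 <= i < N) b2z (F i) <= N%:Z.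
  by have := h (2 * m)%N (fun i => T c (i%:Z - m%:Z)); rewrite -/(colsum c); lia.
elim: N => [|N IH]; first by rewrite big_geq.
by rewrite sum_int_recr; move: IH; case: (F N); rewrite /=; set S := \sum_(_ <= _ < _) _; lia.
Qed.

(* signed number of faces of [W] above the edge between [prv d c] and [c] *)
Definition om (d : bool) (c : int * int) : int :=
  \sum_(0 <= i < (2 * m)%N) (if vf d c (i%:Z - m%:Z) \in W then
     b2z (T c (i%:Z - m%:Z)) - b2z (T (prv d c) (i%:Z - m%:Z)) else 0).

(** Around a vertex of [W] every vertical separating face belongs to [W], so the count over [W] is
    the full difference of heights. *)
Lemma om_near d c b : vW b -> arnd b c -> arnd b (prv d c) -> om d c = Hgt c - Hgt (prv d c).
Proof.
move=> vb bc bp.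
rewrite /Hgt (_ : _ - _ = colsum c - colsum (prv d c)); last by lia.
rewrite /colsum -sumrB /om; apply: eq_bigr => i _.
case: ifP => // nW; have : sepf T (vf d c (i%:Z - m%:Z)) = false.
  by apply/negP => sv; move/negP: nW; apply; apply: over_W vb; rewrite ?wallf_vf // pvE bc bp.
by rewrite sepfE => /negbFE/eqP->; rewrite subrr.
Qed.

Lemma om0 d c : (forall z, vf d c z \notin W) -> om d c = 0.
Proof. by move=> h; rewrite /om big1 // => i _; rewrite (negbTE (h _)). Qed.

Lemma arnd_refl b : arnd b b. Proof. by rewrite /arnd !eqxx. Qed.
Lemma arnd_prv d b : arnd b (prv d b). Proof. by case: d; rewrite /arnd /prv /= !eqxx ?orbT. Qed.

Lemma om_far d c b : ~~ vW b -> arnd b c -> arnd b (prv d c) -> om d c = 0.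
Proof.
move=> nv bc bp; apply: om0 => z; apply: contra nv => zW; apply/vWP.
by exists (vf d c z) => //; rewrite pvE bc bp.
Qed.

Lemma prvC c : prv false (prv true c) = prv true (prv false c). Proof. by []. Qed.

Lemma arnd_prv2 b : arnd b (prv true (prv false b)).
Proof. by rewrite /arnd /prv /= !eqxx ?orbT. Qed.

Lemma arnd_prv_cases b x : arnd b x ->
  [\/ x = b, x = prv true b, x = prv false b | x = prv true (prv false b)].
Proof.
move=> /arndP[h1 h2]; case: h1 h2 => h1 [] h2; [apply: Or41|apply: Or43|apply: Or42|apply: Or44];
  by apply: int_pair_eq; rewrite /prv.
Qed.

(** At a vertex of [W] the four jumps are differences of [Hgt]; at any other vertex they all
    vanish. *)
Lemma om_closed b : om true b - om true (prv false b) = om false b - om false (prv true b).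
Proof.
have [vb|nv] := boolP (vW b).
  by rewrite !(om_near vb) ?arnd_refl ?arnd_prv ?arnd_prv2 // prvC; lia.
by rewrite !(om_far nv) ?arnd_refl ?arnd_prv ?arnd_prv2.
Qed.

Lemma om_out d c : ~~ inbox n c -> ~~ inbox n (prv d c) -> om d c = 0.
Proof.
move=> h1 h2; apply: om0 => z; apply/negP => /W_inwin; rewrite inwinE /inc.
by rewrite (negbTE h1) (negbTE h2).
Qed.

(* the height jump produced by [W] alone, normalised to vanish at infinity *)
Definition Gj (c : int * int) : int := \sum_(0 <= i < nlev n c.1) om true (i%:Z - n%:Z, c.2).

Lemma Gj_left (c : int * int) : c.1 < - n%:Z -> Gj c = 0.
Proof.
move=> h; rewrite /Gj (_ : nlev n c.1 = 0%N) ?big_geq //.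
by rewrite /nlev; case e : (c.1 + n%:Z + 1) => [k|k] //; lia.
Qed.

Lemma Gj_x (c : int * int) : Gj c = Gj (prv true c) + om true c.
Proof.
have [lt|ge] := ltP c.1 (- n%:Z).
  rewrite !Gj_left ?om_out //; rewrite /prv /inbox /=; lia.
rewrite /Gj /nlev /prv /=.
have -> : c.1 + n%:Z + 1 = ((absz (c.1 + n%:Z)%R).+1)%:Z by lia.
have -> : c.1 - 1 + n%:Z + 1 = (absz (c.1 + n%:Z)%R)%:Z by lia.
rewrite big_nat_recr //=; congr (_ + om true _).
by apply: int_pair_eq => //=; lia.
Qed.

Lemma Gj_y (c : int * int) : Gj c = Gj (prv false c) + om false c.
Proof.
have [k ck] : exists k : nat, c.1 + n%:Z < k%:Z by exists (absz (c.1 + n%:Z)%R).+1; lia.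
elim: k c ck => [|k IH] c ck.
  by rewrite !Gj_left ?om_out //; rewrite /prv /inbox /=; lia.
rewrite Gj_x (Gj_x (prv false c)) IH; last by rewrite /prv /=; lia.
by rewrite prvC; have := om_closed c; lia.
Qed.

(** [Gj] vanishes left of the box by definition and on the rows above and below it because [om]
    does. On the right side it is transported in the second direction from such a row. *)
Lemma Gj_out (c : int * int) : ~~ inbox n c -> Gj c = 0.
Proof.
move=> nb; have [lt|ge] := ltP c.1 (- n%:Z); first exact: Gj_left.
have row y : (y < - n%:Z) || (n%:Z <= y) -> forall x, Gj (x, y) = 0.
  move=> hy x; rewrite /Gj big1 // => i _; apply: om_out; rewrite /inbox /=; lia.
rewrite [c]surjective_pairing.
have [hy|hy] := boolP ((c.2 < - n%:Z) || (n%:Z <= c.2)); first exact: row.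
have gx : n%:Z <= c.1 by move: nb; rewrite /inbox; lia.
have [k ck] : exists k : nat, c.2 + k%:Z = n%:Z by exists (absz (n%:Z - c.2)%R); lia.
elim: k (c.2) ck {hy} => [|k IH] y ck; first by apply: row; lia.
have := Gj_y (c.1, y + 1); rewrite /prv /= IH; last by lia.
rewrite om_out; [|by rewrite /inbox /=; lia..].
by rewrite (_ : y + 1 - 1 = y) ?addr0 => [<-|] //; lia.
Qed.

Lemma Gj_vertex b c c' : ~~ vW b -> arnd b c -> arnd b c' -> Gj c = Gj c'.
Proof.
move=> nv; have h d x : arnd b x -> arnd b (prv d x) -> Gj x = Gj (prv d x).
  by move=> h1; case: d => h2; [rewrite Gj_x|rewrite Gj_y]; rewrite (om_far nv) ?addr0.
suff k x : arnd b x -> Gj x = Gj b by move=> h1 h2; rewrite k // (k c').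
have e1 : Gj b = Gj (prv true b) by apply: h; rewrite ?arnd_refl ?arnd_prv.
have e2 : Gj b = Gj (prv false b) by apply: h; rewrite ?arnd_refl ?arnd_prv.
have e3 : Gj (prv false b) = Gj (prv true (prv false b)) by apply: h; rewrite ?arnd_prv ?arnd_prv2.
by move=> /arnd_prv_cases[] ->; rewrite -?e3 -?e2 -?e1.
Qed.

Lemma HG_vertex b c : vW b -> arnd b c -> Hgt c - Gj c = Hgt b - Gj b.
Proof.
move=> vb; have h d x : arnd b x -> arnd b (prv d x) -> Hgt (prv d x) - Gj (prv d x) = Hgt x - Gj x.
  move=> h1 h2; have := om_near vb h1 h2.
  by case: d h2 => h2 e; [have := Gj_x x|have := Gj_y x]; lia.
have e1 : Hgt (prv true b) - Gj (prv true b) = Hgt b - Gj b by apply: h; rewrite ?arnd_refl ?arnd_prv.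
have e2 : Hgt (prv false b) - Gj (prv false b) = Hgt b - Gj b by apply: h; rewrite ?arnd_refl ?arnd_prv.
have e3 : Hgt (prv true (prv false b)) - Gj (prv true (prv false b)) = Hgt (prv false b) - Gj (prv false b).
  by apply: h; rewrite ?arnd_prv ?arnd_prv2.
by move=> /arnd_prv_cases[] ->; rewrite ?e3 ?e2 ?e1.
Qed.

(* height of the floor of [W] *)
Definition flr : int := Hgt (col f0) - Gj (col f0).

(** [Hgt - Gj] is constant around each vertex of [W], and successive faces of a path in [W] share a
    vertex. *)
Lemma HG_flr b c : vW b -> arnd b c -> Hgt c - Gj c = flr.
Proof.
move=> vb bc; rewrite (HG_vertex vb bc).
case/vWP: (vb) => f fW_ fb.
have : inW T f0 f /\ forall b, pv f b -> Hgt b - Gj b = flr.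
  have cf : wcon T f0 f by move: fW_; rewrite hW => /inWP[].
  apply: (@conP_stay (wallf T) (fun f => inW T f0 f /\ forall b, pv f b -> Hgt b - Gj b = flr) f0) cf.
    move=> x y wx wy [xW hx] xy; have yW := inW_step xW wy xy; split=> // b' yb'.
    have [b1 [z [xb1 _ yb1 _]]] := sadjP _ _ xy.
    have v1 : vW b1 by apply/vWP; exists y; rewrite ?hW.
    have v2 : vW b' by apply/vWP; exists y; rewrite ?hW.
    by rewrite -(HG_vertex v2 (arnd_col yb')) (HG_vertex v1 (arnd_col yb1)) hx.
  split; first exact: inW_refl.
  move=> b' h; rewrite /flr (HG_vertex _ (arnd_col h)) //.
  by apply/vWP; exists f0; rewrite ?f0W.
by case=> _; apply.
Qed.

Lemma near_ceil b c : vW b -> arnd b c -> ~~ fW c -> ceilc T c (flr + Gj c).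
Proof.
move=> vb bc nf; have [h ch] := near_W vb bc nf.
by rewrite -(HG_flr vb bc) (Hgt_ceil ch) subrK.
Qed.

(** Subtracting [Gj] brings all ceilings next to [W] to the height of the floor, so that the columns
    of [W] can be closed by a flat piece at that height. *)
Definition delT : field := fun c z => if fW c then z < flr else T c (z + Gj c).

Lemma delT_near b c z : vW b -> arnd b c -> delT c z = (z < flr).
Proof.
move=> vb bc; rewrite /delT; case: ifPn => // nf.
by rewrite (near_ceil vb bc nf) ltrD2r.
Qed.

Lemma leftmost : exists b, vW b /\ forall b', vW b' -> b.1 <= b'.1.
Proof.
pose P k := `[< exists b, vW b /\ b.1 = k%:Z - n%:Z >].
have low b : vW b -> - n%:Z <= b.1.
  case/vWP => f /W_inwin; elim/face_ind: f => [c z|d c z]; rewrite inwinE pvE /inc /inbox.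
    by move=> h /arndP[]; lia.
  by case: d; rewrite /prv /= => h /andP[/arndP[? ?] /arndP[/= ? ?]]; lia.
have [b [z [fb _]]] := pv_ex f0.
have vb : vW b by apply/vWP; exists f0; rewrite ?f0W.
have exP : exists k, P k.
  exists (absz (b.1 + n%:Z)%R); apply/asboolP; exists b; split=> //; have := low _ vb; lia.
case: (ex_minnP exP) => k /asboolP[b' [vb' e']] kmin; exists b'; split=> // b2 v2.
have : (k <= absz (b2.1 + n%:Z)%R)%N.
  by apply: kmin; apply/asboolP; exists b2; split=> //; have := low _ v2; lia.
have := low _ v2; lia.
Qed.

Lemma Gj_leftmost (b c : int * int) : (forall b', vW b' -> b.1 <= b'.1) -> c.1 < b.1 -> Gj c = 0.
Proof.
move=> h lt; rewrite /Gj big_seq big1 // => i; rewrite mem_index_iota => /andP[_ hi].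
apply: (@om_far _ _ (i%:Z - n%:Z, c.2)); rewrite ?arnd_refl ?arnd_prv //.
apply/negP => /h /=; move: hi; rewrite /nlev; case e : (c.1 + n%:Z + 1) => [k|k] //; lia.
Qed.

(** Left of a leftmost vertex no jump of [W] has been met yet, so [Gj] is still 0 and the floor is
    visible. *)
Lemma floor_ceil (b : int * int) : vW b -> (forall b', vW b' -> b.1 <= b'.1) ->
  ~~ fW (b.1 - 1, b.2) /\ ceilc T (b.1 - 1, b.2) flr.
Proof.
move=> vb h; set c := (b.1 - 1, b.2).
have bc : arnd b c by rewrite /arnd /= !eqxx !orbT.
have nf : ~~ fW c.
  apply/negP => /fW_vW fc; have : vW (b.1 - 1, b.2) by apply: fc; apply: arnd_refl.
  by move/h => /=; lia.
split=> //; have := near_ceil vb bc nf; rewrite (Gj_leftmost h) ?addr0 //= ; lia.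
Qed.

Lemma flr_bound : - m%:Z <= flr <= m%:Z.
Proof.
have [b [vb hb]] := leftmost; have [_ ch] := floor_ceil vb hb.
exact: (ceil_bound m_gt0 dT ch).
Qed.

(** At a vertex of [W], [Gj] is [Hgt - flr], both between [-m] and [m]; elsewhere one moves left
    without changing it. This is the source of the height [3 * m] for the box of [delT]. *)
Lemma Gj_bound c : - (2 * m)%:Z <= Gj c <= (2 * m)%:Z.
Proof.
have [k ck] : exists k : nat, c.1 + n%:Z < k%:Z by exists (absz (c.1 + n%:Z)%R).+1; lia.
elim: k c ck => [|k IH] c ck; first by rewrite Gj_left; lia.
have [vc|nv] := boolP (vW c).
  by have := HG_flr vc (arnd_refl c); have := flr_bound; have := Hgt_bound c; lia.
rewrite Gj_x (om_far nv) ?arnd_refl ?arnd_prv // addr0; apply: IH; rewrite /prv /=; lia.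
Qed.

Lemma fW_inbox c : fW c -> inbox n c.
Proof. by move=> /fWP[z /W_inwin]; rewrite inwinE /inc => /orP[] /andP[]. Qed.

Lemma dob_delT : dob n (3 * m) delT.
Proof.
move=> c z nc; rewrite /delT; case: ifP => [fc|nf].
  have := fW_inbox fc; have := flr_bound; move: nc; rewrite /inc => nc h1 h2.
  by rewrite h2 /= in nc; apply/idP/idP; lia.
have [ib|ob] := boolP (inbox n c); last first.
  by rewrite Gj_out // addr0; apply: dT; rewrite /inc (negbTE ob).
have := Gj_bound c; move: nc; rewrite /inc ib /= => nc gb.
rewrite dT; first by apply/idP/idP; lia.
by rewrite /inc ib /=; lia.
Qed.

Definition touchW (g : face) : bool := `[< exists2 b, pv g b & vW b >].
Lemma touchWP g : reflect (exists2 b, pv g b & vW b) (touchW g). Proof. exact: asboolP. Qed.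

Definition up (g : face) : face := shift_face (Gj (col g)) g.
Definition dn (g : face) : face := shift_face (- Gj (col g)) g.

Lemma upK g : dn (up g) = g. Proof. by rewrite /dn /up col_shift shiftK. Qed.
Lemma dnK g : up (dn g) = g. Proof. by rewrite /dn /up col_shift shiftNK. Qed.
Lemma touchW_shift k g : touchW (shift_face k g) = touchW g.
Proof. by apply: asbool_equiv_eq; split=> -[b h1 h2]; exists b => //; move: h1; rewrite pv_shift. Qed.
Lemma touchW_W f : f \in W -> touchW f.
Proof. by move=> h; have [b [z [fb _]]] := pv_ex f; apply/touchWP; exists b => //; apply/vWP; exists f. Qed.
Lemma ntouchW f : wallf T f -> f \notin W -> ~~ touchW f.
Proof. by move=> wf; apply: contra => /touchWP[b fb vb]; apply: over_W fb vb. Qed.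
Lemma ntouch_vW g b : ~~ touchW g -> pv g b -> ~~ vW b.
Proof. by move=> ng gb; apply: contra ng => vb; apply/touchWP; exists b. Qed.

Lemma sep_touch g : touchW g -> sepf delT g = horizontal g && (ht g == flr).
Proof.
move=> /touchWP[b]; elim/face_ind: g => [c z|d c z]; rewrite pvE sepfE cohtE.
  by move=> bc vb; rewrite !(delT_near _ vb bc) horizontal_hf /=; apply/idP/idP; lia.
by move=> /andP[bc bp] vb; rewrite !(delT_near _ vb) // horizontal_vf eqxx.
Qed.

Lemma nfW_hf c z : ~~ touchW (hf c z) -> ~~ fW c.
Proof. by apply: contra => fc; apply/touchWP; exists c; [rewrite pvE arnd_refl|apply: fW_vW (arnd_refl c)]. Qed.

Lemma nvW_vf d c z : ~~ touchW (vf d c z) -> ~~ vW c.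
Proof. by move/ntouch_vW; apply; rewrite pvE arnd_refl arnd_prv. Qed.

Lemma sep_ntouch g : ~~ touchW g -> sepf delT g = sepf T (up g).
Proof.
rewrite /up; elim/face_ind: g => [c z|d c z] nt; rewrite cohtE shiftE !sepfE /delT.
  by rewrite (negbTE (nfW_hf nt)) (_ : z - 1 + Gj c = z + Gj c - 1) //; lia.
have nv := nvW_vf nt.
have h x : arnd c x -> fW x = false.
  by move=> cx; apply/negbTE; apply: contra nv => fx; apply: fW_vW fx cx.
by rewrite !h ?arnd_refl ?arnd_prv // (@Gj_vertex c (prv d c) c) ?arnd_refl ?arnd_prv.
Qed.

Lemma ceil_delT c h : ~~ fW c -> ceilc delT c (h - Gj c) <-> ceilc T c h.
Proof.
move=> nf; rewrite /ceilc /delT (negbTE nf); split=> H z; last by rewrite H; apply/idP/idP; lia.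
by have := H (z - Gj c); rewrite subrK => ->; apply/idP/idP; lia.
Qed.

Lemma isceil_delT c : ~~ fW c -> isceil delT c = isceil T c.
Proof.
move=> nf; apply/isceilP/isceilP => -[h ch].
  by exists (h + Gj c); apply/(ceil_delT _ nf); rewrite addrK.
by exists (h - Gj c); apply/(ceil_delT _ nf).
Qed.

(** Over the vertices of [W] the new field is flat, hence has no wall face; elsewhere it is a
    shifted copy of the old one. *)
Lemma wall_delT g : wallf delT g = ~~ touchW g && wallf T (up g).
Proof.
have [tg|nt] := boolP (touchW g); last first.
  rewrite /wallf (sep_ntouch nt) /up horizontal_shift col_shift /=.
  move: nt; elim/face_ind: g => [c z|d c z] nt; rewrite ?horizontal_hf ?horizontal_vf //= cohtE.
  by rewrite isceil_delT // (nfW_hf nt).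
apply/negbTE/negP => /andP[]; rewrite (sep_touch tg) => /andP[hor _] /negP; apply; rewrite hor /=.
apply/isceilP; exists flr => z; move/touchWP: tg => [b gb vb].
exact: delT_near vb (arnd_col gb).
Qed.

Lemma sadj_up f g : ~~ touchW f -> sadj f g -> sadj (up f) (up g) /\ Gj (col f) = Gj (col g).
Proof.
move=> nf fg; have [b [z [fb _ gb _]]] := sadjP _ _ fg.
have e : Gj (col f) = Gj (col g) by apply: (Gj_vertex (ntouch_vW nf fb)); apply: arnd_col.
by split=> //; rewrite /up e; apply: sadj_shift.
Qed.
Lemma sadj_dn f g : ~~ touchW f -> sadj f g -> sadj (dn f) (dn g) /\ Gj (col f) = Gj (col g).
Proof.
move=> nf fg; have [b [z [fb _ gb _]]] := sadjP _ _ fg.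
have e : Gj (col f) = Gj (col g) by apply: (Gj_vertex (ntouch_vW nf fb)); apply: arnd_col.
by split=> //; rewrite /dn e; apply: sadj_shift.
Qed.

Lemma wallf_dn f : wallf T f -> f \notin W -> wallf delT (dn f).
Proof. by move=> wf nW; rewrite wall_delT dnK wf andbT /dn touchW_shift; apply: ntouchW. Qed.

Lemma inW_dn f g : f \notin W -> inW T f g ->
  [/\ g \notin W, inW delT (dn f) (dn g) & Gj (col g) = Gj (col f)].
Proof.
move=> nW /inWP[wf fg].
apply: (@conP_stay (wallf T) (fun g => [/\ g \notin W, inW delT (dn f) (dn g) & Gj (col g) = Gj (col f)]) f) fg.
  move=> x y wx wy [nx xf ex] xy.
  have ny : y \notin W.
    apply: contra nx; rewrite !hW => yW; apply: inW_step yW wx _; by rewrite sadj_sym.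
  have [ad e] := sadj_dn (ntouchW wx nx) xy.
  split=> //; last by rewrite -e.
  exact: inW_step xf (wallf_dn wy ny) ad.
by split=> //; apply: inW_refl; apply: wallf_dn.
Qed.

Lemma inW_up f g : inW delT f g -> inW T (up f) (up g) /\ Gj (col g) = Gj (col f).
Proof.
move=> /inWP[wf fg].
apply: (@conP_stay (wallf delT) (fun g => inW T (up f) (up g) /\ Gj (col g) = Gj (col f)) f) fg.
  move=> x y; rewrite !wall_delT => /andP[tx wx] /andP[ty wy] [xf ex] xy.
  have [ad e] := sadj_up tx xy.
  by split; [apply: inW_step xf wy ad|rewrite -e].
by split=> //; apply: inW_refl; move: wf; rewrite wall_delT => /andP[].
Qed.

Lemma notin_up g : wallf delT g -> up g \notin W.
Proof. by rewrite wall_delT => /andP[nt _]; apply: contra nt => /touchW_W; rewrite touchW_shift. Qed.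

(** Another wall has no vertex in common with [W], so [Gj] is constant along it and the wall is
    shifted rigidly. *)
Lemma iswall_del (W1 : {fset face}) : iswall T W1 -> W1 <> W ->
  exists k, (forall f, f \in W1 -> Gj (col f) = k /\ ~~ touchW f) /\ iswall delT (shS (- k) W1).
Proof.
move=> [f [wf hf1]] ne.
have nW : f \notin W.
  apply/negP => fW_; apply: ne; apply/fsetP => g; rewrite hf1 hW.
  by move: fW_; rewrite hW => h; apply/idP/idP => h'; [apply: inW_trans h h'|apply: inW_trans (inW_sym h) h'].
exists (Gj (col f)); split.
  move=> g; rewrite hf1 => fg; have [h1 h2 h3] := inW_dn nW fg; split=> //.
  by apply: ntouchW => //; apply: inW_wallf fg.
exists (dn f); split; first exact: wallf_dn.
move=> g; rewrite in_shS opprK hf1; apply/idP/idP => h.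
  have [_ h2 h3] := inW_dn nW h.
  by move: h2 h3; rewrite col_shift => h2 h3; rewrite /dn col_shift h3 shiftK in h2.
have [h1 h2] := inW_up h.
by move: h1; rewrite dnK /up h2 /dn col_shift.
Qed.

Lemma iswall_undel W2 : iswall delT W2 ->
  exists k W1, [/\ iswall T W1, W1 <> W, forall f, f \in W1 -> Gj (col f) = k & W2 = shS (- k) W1].
Proof.
move=> [f [wf hf1]]; exists (Gj (col f)), (shS (Gj (col f)) W2).
have nW := notin_up wf; have wu : wallf T (up f) by move: wf; rewrite wall_delT => /andP[].
have mem g : (g \in shS (Gj (col f)) W2) = inW T (up f) g.
  rewrite in_shS hf1; apply/idP/idP => h.
    have [h1 h2] := inW_up h; move: h2; rewrite col_shift => h2.
    by move: h1; rewrite {2}/up col_shift h2 shiftNK.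
  have [_ h2 h3] := inW_dn nW h; rewrite upK in h2.
  by move: h2; rewrite /dn h3 col_shift.
split.
- by exists (up f).
- move=> e; move: (mem (up f)); rewrite e inW_refl // => h; by rewrite h in nW.
- by move=> g; rewrite mem => /(inW_dn nW)[_ _ ->]; rewrite col_shift.
- by rewrite shS_shS addrN shS0.
Qed.

(** A ceiling adjacent to [W1] undergoes the same shift as [W1], so heights relative to the floor do
    not change. *)
Lemma stdof_del W1 K k : (forall f, f \in W1 -> Gj (col f) = k /\ ~~ touchW f) ->
  stdof T W1 K <-> stdof delT (shS (- k) W1) K.
Proof.
move=> hk.
have key f g : f \in W1 -> horizontal g -> sadj f g -> Gj (col g) = k /\ ~~ fW (col g).
  move=> fW1 hor fg; have [e nt] := hk _ fW1; have [_ <-] := sadj_up nt fg; split=> //.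
  have [b [z [fb _ gb _]]] := sadjP _ _ fg.
  by apply: contra (ntouch_vW nt fb) => fc; apply: fW_vW fc (arnd_col gb).
split=> -[g [hor cg [f fW1 fg] ub ->]].
  have [eg nf] := key _ _ fW1 hor fg.
  exists (shift_face (- k) g); split => //.
  - by rewrite col_shift ht_shift -{1}eg; apply/(ceil_delT _ nf).
  - by exists (shift_face (- k) f); [rewrite in_shS opprK shiftNK|apply: sadj_shift].
  - move: ub; rewrite rhoW_shS (_ : face_cell (shift_face (- k) g) = face_cell g) //.
    by rewrite /face_cell !ffunE /= !mul0r !addr0.
  - by rewrite shS_shS ht_shift; congr shS; lia.
have fW2 : shift_face k f \in W1 by move: fW1; rewrite in_shS opprK.
have fg' := sadj_shift k fg.
have [eg nf] := key _ (shift_face k g) fW2 hor fg'.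
move: eg nf; rewrite col_shift => eg nf.
exists (shift_face k g); split => //.
- by rewrite col_shift ht_shift; apply/(ceil_delT _ nf); rewrite eg addrK.
- by exists (shift_face k f).
- move: ub; rewrite rhoW_shS (_ : face_cell (shift_face k g) = face_cell g) //.
  by rewrite /face_cell !ffunE /= !mul0r !addr0.
- by rewrite shS_shS ht_shift; congr shS; lia.
Qed.

Lemma outL_dn h : outL n h -> dn h = h /\ h \notin W.
Proof.
move=> oh; have nb : ~~ inbox n (col h) by case/and3P: oh.
split; first by rewrite /dn Gj_out // oppr0 shift0.
by apply/negP => /W_inwin; rewrite (outL_inwin m oh).
Qed.

Definition reachJ (g : face) : Prop := exists h, outL n h /\ conP (sepf delT) h g.

Lemma reachJ_step g g' : sepf delT g -> sepf delT g' -> sadj g g' -> reachJ g -> reachJ g'.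
Proof. by move=> sg sg' gg [h [oh hg]]; exists h; split=> //; apply: conP_step hg sg sg' gg. Qed.

Lemma floorJ c b : vW b -> arnd b c -> sepf delT (hf c flr) /\ tch (hf c flr) b flr.
Proof.
move=> vb bc; split; last by rewrite /tch pvE zvE bc eqxx.
by rewrite sep_touch ?cohtE ?eqxx //; apply/touchWP; exists b; rewrite ?pvE.
Qed.

Lemma sep_dn f : sepf T f -> f \notin W -> sepf delT (dn f) /\
  forall b, pv f b -> vW b -> tch (dn f) b flr.
Proof.
move=> sf nW; have [/touchWP[b fb vb]|nt] := boolP (touchW f); last first.
  split; first by rewrite sep_ntouch ?touchW_shift // dnK.
  by move=> b fb vb; move/negP: nt; case; apply/touchWP; exists b.
have nw : ~~ wallf T f by apply: contra nW => wf; apply: over_W fb vb.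
have hor : horizontal f && isceil T (col f) by move: nw; rewrite /wallf sf negbK.
have [hr /isceilP[h ch]] := andP hor; have ef := horizontalP hr.
have nf : ~~ fW (col f).
  by apply/negP => /fW_nceil; rewrite (_ : isceil T (col f)) //; apply/isceilP; exists h.
have fh : ht f = h by move: sf; rewrite ef sepfE !ch !cohtE; lia.
have eh : h - Gj (col f) = flr.
  have := near_ceil vb (arnd_col fb) nf => ch2.
  have := ch (h - 1); have := ch h; rewrite !ch2; lia.
have ed : dn f = hf (col f) flr by rewrite /dn {2}ef shiftE fh eh.
rewrite ed; split; first by case: (floorJ vb (arnd_col fb)).
by move=> b' fb' vb'; case: (floorJ vb' (arnd_col fb')).
Qed.

Lemma reachJ_all g : sepf delT g -> reachJ g.
Proof.
(* Transport of a path: a face of [W] is replaced by all new separating faces that touch one of its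
   vertices at floor height, any other face by its shift. *)
pose img f g' := if f \in W then sepf delT g' /\ exists2 b, pv f b & tch g' b flr else g' = dn f.
have main f : sepf T f -> forall g', img f g' -> reachJ g'.
  move=> sf; have [h [oh hf_]] := cT sf.
  have sh : sepf T h by exact: (outL_sepf m_gt0 dT oh).
  have : sepf T f /\ forall g', img f g' -> reachJ g'; last by case.
  apply: (@conP_stay (sepf T) (fun f => sepf T f /\ forall g', img f g' -> reachJ g') h) hf_.
    move=> x y sx sy [_ rx] xy; split=> // g'.
    have [b [z [xb xz yb yz]]] := sadjP _ _ xy.
    rewrite /img; case: ifPn => yW.
      have vb : vW b by apply/vWP; exists y.
      move=> [sg [b' yb' tg]].
      have vb' : vW b' by apply/vWP; exists y.
      have [s1 t1] := floorJ vb (arnd_col yb); have [_ t2] := floorJ vb' (arnd_col yb').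
      apply: (reachJ_step s1 sg); first exact: tch_sadj t2 tg.
      have [xW|xW] := boolP (x \in W).
        by apply: rx; rewrite /img xW; split=> //; exists b.
      have [sd td] := sep_dn sx xW.
      apply: (reachJ_step sd s1); first exact: tch_sadj (td _ xb vb) t1.
      by apply: rx; rewrite /img (negbTE xW).
    move=> ->; have [sd td] := sep_dn sy yW.
    have [xW|xW] := boolP (x \in W).
      apply: rx; rewrite /img xW; split=> //; exists b => //; apply: td => //; apply/vWP; by exists x.
    have [sx' tx] := sep_dn sx xW.
    apply: (reachJ_step sx' sd); last by apply: rx; rewrite /img (negbTE xW).
    have [vb|nv] := boolP (vW b); first exact: tch_sadj (tx _ xb vb) (td _ yb vb).
    rewrite /dn (Gj_vertex nv (arnd_col xb) (arnd_col yb)); exact: sadj_shift.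
  split=> // g'; have [e nW] := outL_dn oh.
  by rewrite /img (negbTE nW) e => ->; exists h; split=> //; apply: rt_refl.
move=> sg; have [tg|nt] := boolP (touchW g).
  move: (sg); rewrite sep_touch // => /andP[hor /eqP hg].
  have [b gb /vWP[f fW_ fb]] := touchWP _ tg.
  apply: (main f (W_sepf fW_)); rewrite /img fW_; split=> //; exists b => //.
  by rewrite /tch gb (horizontalP hor) zvE hg eqxx.
apply: (main (up g)); first by rewrite -sep_ntouch.
rewrite /img upK; case: ifPn => // uW.
by move/negP: nt; case; rewrite -(touchW_shift (Gj (col g))); apply: touchW_W.
Qed.

Lemma sepf_nout M f : (m <= M)%N -> (f \in Sx n M T) = sepf T f && ~~ outL n f.
Proof.
move=> mM; have dM := dob_le mM dT; have M0 : (0 < M)%N := leq_trans m_gt0 mM.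
rewrite (sepf_Sx M0 _ dM); case fS : (f \in _) => /=; last by case: (outL n f).
by apply/esym; apply/negP => /(outL_inwin M); move: fS; rewrite in_Sx => /andP[->].
Qed.

Lemma sepf_nout_del f : (f \in Sx n (3 * m) delT) = sepf delT f && ~~ outL n f.
Proof.
have M0 : (0 < 3 * m)%N by rewrite muln_gt0.
rewrite (sepf_Sx M0 _ dob_delT); case fS : (f \in _) => /=; last by case: (outL n f).
by apply/esym; apply/negP => /(outL_inwin (3 * m)); move: fS; rewrite in_Sx => /andP[->].
Qed.

Lemma outL_dnE f : outL n (dn f) = outL n f.
Proof.
have [ib|ob] := boolP (inbox n (col f)); last by rewrite /dn Gj_out // oppr0 shift0.
by rewrite /outL /dn col_shift ib !andbF.
Qed.

Lemma two_faces f : f \in W -> horizontal f ->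
  exists g, [/\ g \in W, horizontal g, col g = col f & g <> f].
Proof.
move=> fW_ hor; have ef := horizontalP hor.
have nc : ~~ isceil T (col f) by have := W_wallf fW_; rewrite /wallf hor => /andP[].
apply: contrapT => no; move/negP: nc; apply; apply/isceilP; exists (ht f).
apply: (ceil_of_unique m_gt0 dT) => z; apply/idP/eqP => [sz|->]; last by rewrite -ef; apply: W_sepf.
apply: contrapT => ne; apply: no; exists (hf (col f) z); split; rewrite ?cohtE //.
  apply: (@over_W _ (col f)).
  - rewrite wallf_hf sz /=; by have := W_wallf fW_; rewrite /wallf hor => /andP[].
  - by rewrite pvE arnd_refl.
  - by apply/vWP; exists f => //; apply: pv_col.
by move=> e; apply: ne; rewrite -(ht_hf (col f) z) e.
Qed.

(** A horizontal wall face is never alone in its column. In terms of the excess area, |W| <= 2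
    m(W). *)
Lemma excols_half : (2 * #|` excols W| <= #|` W|)%N.
Proof.
have selP y : exists p : face * face, y \in excols W ->
    [/\ p.1 \in W, p.2 \in W, face_cell p.1 = y, face_cell p.2 = y & p.1 <> p.2].
  have [yC|nC] := boolP (y \in excols W); last by exists (f0, f0).
  have [f [fW_ hor ->]] := in_excols _ _ yC; have [g [gW _ eg ne]] := two_faces fW_ hor.
  exists (f, g) => _; split=> //=; last by move=> e; apply: ne.
  by move: eg; rewrite /col /face_cell => -[-> ->].
pose sel y := projT1 (cid (selP y)); have selE y := projT2 (cid (selP y)).
have u1 : uniq [seq (sel y).1 | y <- excols W].
  rewrite map_inj_in_uniq ?fset_uniq // => y y' yC yC' e.
  by have [_ _ <- _ _] := selE _ yC; have [_ _ <- _ _] := selE _ yC'; rewrite -!/(sel _) e.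
have u2 : uniq [seq (sel y).2 | y <- excols W].
  rewrite map_inj_in_uniq ?fset_uniq // => y y' yC yC' e.
  by have [_ _ _ <- _] := selE _ yC; have [_ _ _ <- _] := selE _ yC'; rewrite -!/(sel _) e.
have -> : (2 * #|` excols W|)%N = size ([seq (sel y).1 | y <- excols W] ++ [seq (sel y).2 | y <- excols W]).
  by rewrite size_cat !size_map addnn mul2n.
apply: uniq_leq_size.
  rewrite cat_uniq u1 u2 andbT; apply/hasPn => x /mapP[y yC ->]; apply/mapP => -[y' yC' e].
  have [_ _ _ h1 ne] := selE _ yC; have [_ _ h2 _ _] := selE _ yC'.
  have ey : y = y' by rewrite -h1 -h2 -!/(sel _) e.
  by apply: ne; rewrite -/(sel y) e ey.
move=> x; rewrite mem_cat => /orP[] /mapP[y yC ->]; by have [] := selE _ yC.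
Qed.

Lemma sep_delT_cases g : sepf delT g ->
  (exists f, [/\ sepf T f, f \notin W & g = dn f]) \/ (exists c, fW c /\ g = hf c flr).
Proof.
move=> sg; have [tg|nt] := boolP (touchW g).
  move: (sg); rewrite sep_touch // => /andP[hor /eqP hg].
  have eg : g = hf (col g) flr by rewrite -hg; apply: horizontalP.
  have [fc|nf] := boolP (fW (col g)); first by right; exists (col g).
  left; have [b gb vb] := touchWP _ tg.
  have ch := near_ceil vb (arnd_col gb) nf.
  exists (up g); split; last by rewrite upK.
    by rewrite /up {2}eg shiftE sepfE !ch; lia.
  apply/negP => /W_wallf; rewrite /up {2}eg shiftE wallf_hf => /andP[_ /negP]; apply.
  by apply/isceilP; exists (flr + Gj (col g)).
left; exists (up g); rewrite upK -sep_ntouch //; split=> //.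
by apply: contra nt => /touchW_W; rewrite touchW_shift.
Qed.

(** The new interface is the disjoint union of the shifted faces outside [W] and of one floor face
    over each square under [W]. The box of height [3 * m] is large enough for both interfaces. *)
Lemma card_del : (#|` Sx n (3 * m) delT| + #|` W| = #|` Sx n (3 * m) T| + #|` excols W|)%N.
Proof.
have mM : (m <= 3 * m)%N by lia.
have WS : (W `<=` Sx n (3 * m) T)%fset.
  apply/fsubsetP => f fW_; rewrite sepf_nout // W_sepf //=.
  by apply/negP => /(outL_inwin m); rewrite W_inwin.
rewrite -(cardfsID W (Sx n (3 * m) T)) (fsetIidPr WS).
pose Fl := [fset hf (col f) flr | f in W & horizontal f]%fset.
have inFl g : reflect (exists c, fW c /\ g = hf c flr) (g \in Fl).
  apply: (iffP (imfsetP _ _ _ _)) => [[f]|[c [/fWP[z zW] ->]]].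
    rewrite !inE /= => /andP[fW_ hor] ->; exists (col f); split=> //.
    by apply/fWP; exists (ht f); rewrite -horizontalP.
  by exists (hf c z); rewrite ?inE /= ?zW ?cohtE.
have cFl : #|` Fl| = #|` excols W|.
  have -> : excols W = [fset face_cell g | g in Fl]%fset.
    apply/fsetP => y; apply/in_excols/imfsetP => [[f [fW_ hor ->]]|[g /inFl[c [/fWP[z zW] ->]] ->]].
      exists (hf (col f) flr); last by rewrite /face_cell !mkptE.
      by apply/inFl; exists (col f); split=> //; apply/fWP; exists (ht f); rewrite -horizontalP.
    by exists (hf c z); split=> //; rewrite /face_cell !mkptE.
  rewrite [RHS]card_in_imfset //= => g g' /inFl[c [_ ->]] /inFl[c' [_ ->]] /face_cell_col.
  by rewrite !cohtE => ->.
have -> : Sx n (3 * m) delT = (Fl `|` [fset dn f | f in (Sx n (3 * m) T `\` W)])%fset.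
  apply/fsetP => g; rewrite sepf_nout_del in_fsetU; apply/andP/orP => [[sg no]|].
    case: (sep_delT_cases sg) => [[f [sf nW eg]]|h]; last by left; apply/inFl.
    right; apply/imfsetP; exists f => //=; rewrite in_fsetD nW sepf_nout // sf /=.
    by rewrite -outL_dnE -eg.
  case=> [/inFl[c [fc ->]]|/imfsetP[f /=]].
    split; first by case: (floorJ (fW_vW fc (arnd_refl c)) (arnd_refl c)).
    by apply/negP => /and3P[_ _]; rewrite cohtE (fW_inbox fc).
  rewrite in_fsetD sepf_nout // => /and3P[nW sf no] ->; rewrite outL_dnE no.
  by split=> //; case: (sep_dn sf nW).
rewrite cardfsU [X in (_ - X)%N](_ : _ = 0%N); last first.
  apply/eqP; rewrite cardfs_eq0; apply/eqP/fsetP => g; rewrite in_fsetI in_fset0; apply/negP.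
  move=> /andP[/inFl[c [fc eg]] /imfsetP[f /=]].
  rewrite in_fsetD sepf_nout // => /and3P[nW sf no] ef.
  have ecol_ : col f = c by rewrite -(col_shift (- Gj (col f)) f) -/(dn f) -ef eg cohtE.
  have hor : horizontal f by rewrite -(horizontal_shift (- Gj (col f)) f) -/(dn f) -ef eg.
  move/negP: nW; apply; apply: (@over_W _ c); last exact: fW_vW fc (arnd_refl c).
    by rewrite /wallf sf hor ecol_ (fW_nceil fc).
  by rewrite (horizontalP hor) pvE ecol_ arnd_refl.
rewrite cFl (_ : #|` [fset dn f | f in (Sx n (3 * m) T `\` W)]%fset| = #|` Sx n (3 * m) T `\` W|%fset).
  by rewrite subn0 addnAC [RHS]addnAC; congr (_ + _)%N; rewrite addnC.
by rewrite card_in_imfset //= => f g _ _ e; rewrite -(dnK f) e dnK.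
Qed.

(** The squares whose closure contains [u] are one square, two adjacent ones or the four around a
    vertex, according to the parities of the coordinates of [u]. When [u] is outside the projection,
    no jump of [W] separates them. *)
Lemma Gj_cov u c c' : ~ rhoW W u -> cov u c -> cov u c' -> Gj c = Gj c'.
Proof.
move=> nu; case: u nu => a b nu; rewrite /cov /= => h1 h2.
have edge d x : om d x <> 0 -> exists z, vf d x z \in W.
  by move=> ne; apply: contrapT => no; apply: ne; apply: om0 => z; apply/negP => zW; apply: no; exists z.
have gx x : cov (a, b) x -> cov (a, b) (prv true x) -> b != 2 * x.2 -> b != 2 * x.2 + 2 -> Gj x = Gj (prv true x).
  move=> k1 k2 n1 n2; rewrite Gj_x; case: (eqVneq (om true x) 0) => [->|/eqP/edge[z zW]]; first by rewrite addr0.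
  case: nu; exists (vf true x z); split=> //; rewrite /proj_face /vf /= !mkptE.
  move: k1 k2; rewrite /cov /prv /=; lia.
have gy x : cov (a, b) x -> cov (a, b) (prv false x) -> a != 2 * x.1 -> a != 2 * x.1 + 2 -> Gj x = Gj (prv false x).
  move=> k1 k2 n1 n2; rewrite Gj_y; case: (eqVneq (om false x) 0) => [->|/eqP/edge[z zW]]; first by rewrite addr0.
  case: nu; exists (vf false x z); split=> //; rewrite /proj_face /vf /= !mkptE.
  move: k1 k2; rewrite /cov /prv /=; lia.
have [e1|n1] := eqVneq (2 * (a %/ 2)%Z) a; have [e2|n2] := eqVneq (2 * (b %/ 2)%Z) b.
- apply: (@Gj_vertex ((a %/ 2)%Z, (b %/ 2)%Z)); rewrite /arnd /=; [|lia..].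
  apply/negP => /vWP[f fW_ /proj_vertex]; rewrite /= e1 e2 => pf; apply: nu; by exists f.
- have ey : c.2 = c'.2 by lia.
  have [e|[e|e]] : c = c' \/ c' = prv true c \/ c = prv true c'.
    have : c.1 = c'.1 \/ c'.1 = c.1 - 1 \/ c.1 = c'.1 - 1 by lia.
    by case=> [?|[?|?]]; [left|right; left|right; right]; apply: int_pair_eq.
  + by rewrite e.
  + by rewrite e; apply: gx; rewrite -?e /cov /=; lia.
  + by rewrite e; apply/esym; apply: gx; rewrite -?e /cov /=; lia.
- have ex_ : c.1 = c'.1 by lia.
  have [e|[e|e]] : c = c' \/ c' = prv false c \/ c = prv false c'.
    have : c.2 = c'.2 \/ c'.2 = c.2 - 1 \/ c.2 = c'.2 - 1 by lia.
    by case=> [?|[?|?]]; [left|right; left|right; right]; apply: int_pair_eq.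
  + by rewrite e.
  + by rewrite e; apply: gy; rewrite -?e /cov /=; lia.
  + by rewrite e; apply/esym; apply: gy; rewrite -?e /cov /=; lia.
- by congr Gj; apply: int_pair_eq; lia.
Qed.

(** A path in the complement of the projection preserves [Gj], and a far enough cell is covered only
    by columns outside the box. *)
Lemma Gj_unbounded u c : in_unbounded (rhoW W) u -> cov u c -> Gj c = 0.
Proof.
move=> [nu far] uc; have [v [hv uv]] := far (2 * n + 4)%N.
have : ~ rhoW W v /\ forall x, cov v x -> Gj x = Gj c.
  elim: uv nu c uc {far hv} => {u v} [u v [nu [nv [_ uv]]] _ c uc|u nu c uc|u v w _ IH1 _ IH2 nu c uc].
  - split=> // x vx.
    case: uv => [uv|vu]; first exact: (Gj_cov nu (cov_le uv vx) uc).
    exact: (Gj_cov nv vx (cov_le vu uc)).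
  - by split=> // x ux; apply: Gj_cov ux uc.
  - have [nv hv] := IH1 nu c uc; have [x vx] := cov_ex v.
    have [nw hw] := IH2 nv x vx; split=> // y wy; by rewrite (hw _ wy) (hv _ vx).
move=> [nv h]; have [x vx] := cov_ex v; rewrite -(h _ vx); apply: Gj_out.
exact: far_out hv vx.
Qed.

Lemma zone_hull f u : Gj (col f) <> 0 -> proj_face f u -> rho_hull W u.
Proof. by move=> nz pf ub; apply: nz; apply: Gj_unbounded ub (cov_proj pf). Qed.

(** The column to the left of a face of [W1] has the same nonzero [Gj], so it does not lie left of
    the leftmost vertex of [W]; hence [W1] starts strictly further right than [W]. *)
Lemma zone_ext (W1 : {fset face}) : (forall f, f \in W1 -> Gj (col f) <> 0 /\ ~~ touchW f) -> W1 != fset0 ->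
  (ext n W1 < ext n W)%N.
Proof.
move=> h /fset0Pn[f1 f1W].
have [b [/vWP[f fW_ fb] hb]] := leftmost.
have fx g : g \in W -> b.1 <= (col g).1.
  by move=> gW; apply: (hb (col g)); apply/vWP; exists g => //; apply: pv_col.
have Wn g : g \in W -> (col g).1 <= n%:Z.
  move=> /W_inwin; elim/face_ind: g => [c z|d c z]; rewrite inwinE cohtE /inc /inbox; first by lia.
  by case: d; rewrite /prv /=; lia.
have key g : g \in W1 -> b.1 < (col g).1 /\ (col g).1 <= n%:Z.
  move=> gW; have [nz nt] := h _ gW; have nv := ntouch_vW nt (pv_col g).
  have e : Gj (prv true (col g)) = Gj (col g) by apply: (Gj_vertex nv); rewrite ?arnd_refl ?arnd_prv.
  split; last by have [ib|/Gj_out//] := boolP (inbox n (col g)); move: ib; rewrite /inbox; lia.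
  have [lt|] := ltP (prv true (col g)).1 b.1; last by rewrite /prv /=; lia.
  by case: nz; rewrite -e; apply: Gj_leftmost hb lt.
have ef : (col f).1 = b.1.
  have := fx _ fW_; move: fb; elim/face_ind: (f) => [c z|d c z]; rewrite pvE cohtE.
    by move=> /arndP[]; lia.
  by case: d; rewrite /prv /= => /andP[/arndP[] + _ /arndP[]] /=; lia.
have lo : (absz (n%:Z - b.1)%R <= ext n W)%N.
  rewrite -ef; exact: (@leq_bigmax_seq _ (enum_fset W) xpredT (fun f => absz (n%:Z - (col f).1)%R) _ fW_ isT).
apply: leq_trans lo; rewrite -[X in (_ <= X)%N]prednK; last by have := key _ f1W; lia.
rewrite ltnS; apply/bigmax_leqP_seq => g gW _; have := key _ gW; lia.
Qed.

(** The ceiling chosen as floor lies in the unbounded component, where [Gj] is 0, and [Hgt - Gj]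
    equals [flr] around [W]. *)
Lemma stdof_uniq K : stdof T W K -> K = shS (- flr) W.
Proof.
move=> [g [hor cg [f fW_ fg] ub ->]]; congr shS; congr (- _).
have [b [z [fb _ gb _]]] := sadjP _ _ fg.
have vb : vW b by apply/vWP; exists f.
have G0 : Gj (col g) = 0.
  apply: Gj_unbounded ub _; rewrite /face_cell /cov /col /=; lia.
by have := HG_flr vb (arnd_col gb); rewrite (Hgt_ceil cg) G0 subr0.
Qed.

(** To the left of a leftmost vertex, the row of the floor runs to infinity without meeting the
    projection. *)
Lemma stdof_ex : stdof T W (shS (- flr) W).
Proof.
have [b [vb hb]] := leftmost; have [nf ch] := floor_ceil vb hb.
set c := (b.1 - 1, b.2) in nf ch.
have bc : arnd b c by rewrite /arnd /= !eqxx !orbT.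
exists (hf c flr); rewrite !cohtE; split=> //.
- case/vWP: (vb) => f fW_ fb.
  have [g wg tg] := wall_meets_ceil m_gt0 dT bc ch (W_wallf fW_) fb.
  exists g; first by apply: (over_W wg) vb; case/andP: tg.
  by apply: tch_sadj tg _; rewrite /tch pvE zvE bc eqxx.
- have nr (u : cell2) : u.1 < 2 * b.1 -> ~ rhoW W u.
    move=> lt [f [fW_ pf]]; have vf_ : vW (col f).
      by apply/vWP; exists f => //; apply: pv_col.
    by have := hb _ vf_; have := cov_proj pf; rewrite /cov; lia.
  have fc : face_cell (hf c flr) = (2 * c.1 + 1, 2 * c.2 + 1) by rewrite /face_cell !mkptE.
  rewrite fc; split; first by apply: nr; rewrite /c /=; lia.
  move=> N; exists (2 * c.1 + 1 - (N + absz (2 * c.1 + 1)%R)%:Z, 2 * c.2 + 1); split; first by left; rewrite /=; lia.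
  elim: (N + _)%N => [|k IH]; first by rewrite subr0; apply: rt_refl.
  apply: (rt_trans _ _ _ _ _ IH); apply: rt_step; split; [|split].
  + by apply: nr; rewrite /c /=; lia.
  + by apply: nr; rewrite /c /=; lia.
  + have ne : (2 * c.1 + 1 - k%:Z) <> 2 * c.1 + 1 - k.+1%:Z by lia.
    split; first by move=> [].
    rewrite /le_cell /=.
    have [od|od] : oddz (2 * c.1 + 1 - k%:Z) \/ oddz (2 * c.1 + 1 - k.+1%:Z) by rewrite /oddz; lia.
      by right; split; [right; split=> //; lia|left].
    by left; split; [right; split=> //; lia|left].
Qed.
End Delete.

(** * Finite interfaces and their heights *)

Section Structure.
Variables (n m : nat).
Hypothesis m_gt0 : (0 < m)%N.

Definition conn_field (T : field) : Prop :=
  forall f, sepf T f -> exists g, outL n g /\ conP (sepf T) g f.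

Lemma Ih_Sx T : dob n m T -> Ih n (Sx n m T) =1 sepf T.
Proof. by move=> dT f; rewrite (sepf_Sx m_gt0 f dT). Qed.

Lemma isif_Sx T : dob n m T -> conn_field T -> isif n m (Sx n m T).
Proof.
move=> dT cT; have e := Ih_Sx dT; have ee : Ih n (Sx n m T) = sepf T by apply/funext.
split; first by apply/fsubsetP => f; rewrite in_Sx in_Win => /andP[].
  by rewrite ee; apply: sepf_even.
move=> f; rewrite in_Sx => /andP[_ /cT]; by rewrite ee.
Qed.

Lemma field_of_isif I : isif n m I ->
  exists T, [/\ dob n m T, conn_field T, sepf T = Ih n I & Sx n m T = I].
Proof.
move=> iI; have [T [dT sT]] := isif_field m_gt0 iI; have ee : sepf T = Ih n I by apply/funext.
case: iI => /fsubsetP IW _ cI; exists T; split=> //.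
  move=> f; rewrite ee /Ih => /orP[/cI//|oL]; exists f; split=> //; exact: rt_refl.
apply/fsetP => f; rewrite in_Sx sT /Ih; case fI : (f \in I) => /=.
  by rewrite andbT -in_Win IW.
by apply/negbTE/negP => /andP[fw /(outL_inwin m)]; rewrite fw.
Qed.

Lemma mem_Sx T f : dob n m T -> (f \in Sx n m T) = sepf T f && ~~ outL n f.
Proof.
move=> dT; rewrite (sepf_Sx m_gt0 f dT); case fS : (f \in _) => /=; last by case: (outL n f).
by apply/esym; apply/negP => /(outL_inwin m); move: fS; rewrite in_Sx => /andP[->].
Qed.
End Structure.

Lemma Sx_le n m M T : (0 < m)%N -> (m <= M)%N -> dob n m T -> Sx n M T = Sx n m T.
Proof.
move=> m0 mM dT; apply/fsetP => f; rewrite !mem_Sx //; [exact: leq_trans mM|exact: dob_le dT].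
Qed.

Lemma conP_crosses (P : face -> bool) g f (j : int) : conP P g f -> ht g < j -> j <= ht f ->
  exists f', P f' /\ ht f' = j.
Proof.
move=> gf gj jf; apply: contrapT => no.
have : ht f < j; last by lia.
apply: (@conP_stay P (fun x => ht x < j) g) gf => // x y Px Py xj /sadj_near /and3P[_ _].
have : ht y <> j by move=> e; apply: no; exists y.
by rewrite /near1; lia.
Qed.

Lemma conP_crosses_down (P : face -> bool) g f (j : int) : conP P g f -> j < ht g -> ht f <= j ->
  exists f', P f' /\ ht f' = j.
Proof.
move=> gf gj jf; apply: contrapT => no.
have : j < ht f; last by lia.
apply: (@conP_stay P (fun x => j < ht x) g) gf => // x y Px Py xj /sadj_near /and3P[_ _].
have : ht y <> j by move=> e; apply: no; exists y.
by rewrite /near1; lia.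
Qed.

(** A path starting outside the box at height 0 changes height by at most one per step, so it has a
    face at every intermediate height. *)
Lemma height_bound n m T f : (0 < m)%N -> dob n m T -> conn_field n T -> sepf T f ->
  (absz (ht f) <= #|` Sx n m T|)%N.
Proof.
move=> m0 dT cT sf; have [g [og gf]] := cT _ sf.
have g0 : ht g = 0 by case/and3P: og => _ /eqP.
have inS x : sepf T x -> ht x != 0 -> x \in Sx n m T.
  by move=> sx hx; rewrite mem_Sx // sx /outL (negbTE hx) andbF.
have -> : absz (ht f) = size [seq (if 0 <= ht f then i%:Z else - i%:Z) | i <- iota 1 (absz (ht f))].
  by rewrite size_map size_iota.
rewrite -(size_map ht); apply: uniq_leq_size.
  rewrite map_inj_uniq ?iota_uniq // => i j; case: ifP => _; lia.
move=> z /mapP[i]; rewrite mem_iota => hi ->; apply/mapP; case: ifP => hf0.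
  have [||f' [sf' e]] := @conP_crosses _ _ _ i%:Z gf; [lia|lia|].
  by exists f'; [apply: inS => //; lia|rewrite e].
have [||f' [sf' e]] := @conP_crosses_down _ _ _ (- i%:Z) gf; [lia|lia|].
by exists f'; [apply: inS => //; lia|rewrite e].
Qed.

Lemma dob_height n m T L : (0 < m)%N -> dob n m T ->
  (forall f, sepf T f -> (absz (ht f) <= L)%N) -> dob n L.+1 T.
Proof.
move=> m0 dT hL c z; rewrite /inc; case ib : (inbox n c) => /=; last first.
  by move=> _; apply: dT; rewrite /inc ib.
have same y : (L < absz y)%N -> T c y = T c (y - 1).
  move=> ly; apply: contrapT => ne; have := hL (hf c y); rewrite sepfE cohtE.
  by have -> : (T c y != T c (y - 1)) by [apply/eqP]; move/(_ isT); lia.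
have [z0 nz|z0 nz] := leP 0 z.
  have [k zk] : exists k : nat, z = m%:Z + (absz z)%:Z - k%:Z by exists m; lia.
  have zL : L%:Z < z by lia.
  have : forall k : nat, L%:Z < m%:Z + (absz z)%:Z - k%:Z -> T c (m%:Z + (absz z)%:Z - k%:Z) = false.
    elim=> [|j IH] hj; first by apply: (T_high m0 dT); lia.
    rewrite (_ : m%:Z + (absz z)%:Z - j.+1%:Z = m%:Z + (absz z)%:Z - j%:Z - 1); last lia.
    by rewrite -same; [apply: IH; lia|lia].
  by move/(_ k); rewrite -zk; apply.
have zL : z < - L%:Z - 1 by lia.
have : forall k : nat, - m%:Z - 1 + z + k%:Z < - L%:Z - 1 -> T c (- m%:Z - 1 + z + k%:Z) = true.
  elim=> [|j IH] hj; first by apply: (T_low m0 dT); lia.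
  rewrite same; last by lia.
  rewrite (_ : - m%:Z - 1 + z + j.+1%:Z - 1 = - m%:Z - 1 + z + j%:Z); last lia.
  by apply: IH; lia.
move/(_ m.+1); rewrite (_ : - m%:Z - 1 + z + m.+1%:Z = z); last lia.
by move=> -> //; lia.
Qed.

(** * Agreement with the given notions of ceiling, wall and standardization *)

Section DefsEquiv.
Variables (n m : nat) (T : field).
Hypothesis m_gt0 : (0 < m)%N.
Hypothesis dT : dob n m T.
Let P : face -> Prop := fun f => sepf T f.

Lemma ceil_faceE f : ceil_face P f <-> horizontal f /\ ceilc T (col f) (ht f).
Proof.
split=> [[sf [hor un]]|[hor ch]].
  split=> //; apply: (ceil_of_unique m_gt0 dT) => z; apply/idP/eqP => [sz|->].
    apply: contrapT => ne; have h := un (hf (col f) z) sz isT.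
    by apply: h; [move=> e; apply: ne; rewrite -(ht_hf (col f) z) e|rewrite /hf /= !mkptE].
  by rewrite -(horizontalP hor).
split.
  by rewrite /P (horizontalP hor) sepfE !ch; lia.
split=> // g sg hg ne e; apply: ne.
have ec : col g = col f by exact: e.
rewrite (horizontalP hg) (horizontalP hor) ec; congr hf.
have : sepf T (hf (col g) (ht g)) by rewrite -horizontalP.
by rewrite sepfE ec !ch; lia.
Qed.

Lemma wall_faceE f : wall_face P f <-> wallf T f.
Proof.
rewrite /wall_face /wallf /P; split=> [[sf nc]|/andP[sf nc]].
  rewrite sf; apply/negP => /andP[hor /isceilP[h ch]]; apply: nc; apply/ceil_faceE; split=> //.
  suff -> : ht f = h by [].
  have : sepf T (hf (col f) (ht f)) by rewrite -horizontalP.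
  by rewrite sepfE !ch; lia.
split=> // /ceil_faceE[hor ch]; move/negP: nc; apply; rewrite hor; apply/isceilP; by exists (ht f).
Qed.

Lemma is_wall_ofE W : is_wall_of P W <-> iswall T W.
Proof.
have cE a b : clos_refl_trans face (fun a b => wall_face P a /\ wall_face P b /\ star_adj a b) a b <->
    wcon T a b.
  rewrite /wcon /conP (_ : arel _ = (fun a b => wall_face P a /\ wall_face P b /\ star_adj a b)) //.
  apply/funext => x; apply/funext => y; rewrite /arel; apply/propext.
  by split=> -[/wall_faceE ? [/wall_faceE ? ?]].
split=> -[f [wf h]]; exists f; split; try exact/wall_faceE.
  move=> g; apply/idP/inWP => [/h[/wall_faceE ? /cE ?]|[wf' fg]]; first by split=> //; apply/wall_faceE.
  by apply/h; split; [apply/wall_faceE; apply: conP_mem wf' fg|apply/cE].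
move=> g; rewrite h; split=> [/[dup] /inW_wallf wg /inWP[_ fg]|[/wall_faceE wg /cE fg]].
  by split; [apply/wall_faceE|apply/cE].
by apply/inWP.
Qed.

Lemma std_ofE W K : std_of P W K <-> stdof T W K.
Proof.
split=> [[g [/ceil_faceE[hor cg] [[f [fW fg]] [ub ->]]]]|[g [hor cg [f fW fg] ub ->]]].
  by exists g; split=> //; exists f => //; apply/asboolP.
exists g; split; first by apply/ceil_faceE.
split; first by exists f; split=> //; apply/asboolP.
by split.
Qed.
End DefsEquiv.

Definition stdw (T : field) (K : {fset face}) : Prop := exists W, iswall T W /\ stdof T W K.

(** * Deletion within the class of small interfaces *)

Section Summary.
Variables (n m L : nat).
Hypothesis Lm : (3 * L.+1 <= m)%N.

(** Bounding the cardinal also bounds the heights, which makes the class stable under deletion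
    although a deletion may raise parts of the interface. *)
Definition ifld (T : field) : Prop := [/\ dob n L.+1 T, conn_field n T & (#|` Sx n m T| <= L)%N].

Lemma ifld_m T : ifld T -> dob n m T.
Proof. by case=> dT _ _; apply: dob_le dT; lia. Qed.

Lemma wall_eq T W W1 f f1 b : ifld T -> iswall T W -> iswall T W1 -> f \in W -> f1 \in W1 ->
  pv f b -> pv f1 b -> W = W1.
Proof.
move=> [dT cT _] [g [wg hW]] [g1 [wg1 hW1]] fW f1W fb f1b.
have h1 : inW T g f by rewrite -hW.
have h2 : inW T g1 f1 by rewrite -hW1.
have h3 := wall_over_vertex (ltn0Sn L) dT cT (inW_wallf h1) (inW_wallf h2) fb f1b.
apply/fsetP => x; rewrite hW hW1; apply/idP/idP => h.
  exact: inW_trans h2 (inW_trans (inW_sym h3) (inW_trans (inW_sym h1) h)).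
exact: inW_trans h1 (inW_trans h3 (inW_trans (inW_sym h2) h)).
Qed.

Lemma iswall_mem T W : iswall T W -> exists f, f \in W.
Proof. by case=> g [wg hW]; exists g; rewrite hW inW_refl. Qed.

Lemma stdof_eq T W W1 K : ifld T -> iswall T W -> iswall T W1 -> stdof T W K -> stdof T W1 K -> W = W1.
Proof.
move=> iT wW wW1 [g [_ _ _ _ ->]] [g1 [_ _ _ _ e]].
have [f fW] := iswall_mem wW; have [b [z [fb _]]] := pv_ex f.
have : shift_face (- ht g) f \in shS (- ht g) W by rewrite in_shS shiftK.
rewrite e in_shS shift_shift => f1; apply: (wall_eq iT wW wW1 fW f1 fb).
by rewrite pv_shift.
Qed.

Variables (T : field) (W K : {fset face}) (f0 : face).
Hypothesis iT : ifld T.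
Hypothesis w0 : wallf T f0.
Hypothesis hW : forall g, (g \in W) = inW T f0 g.
Hypothesis sK : stdof T W K.

Let dT : dob n L.+1 T. Proof. by case: iT. Qed.
Let cT : conn_field n T. Proof. by case: iT. Qed.
Let T' := delT n L.+1 T W f0.

Lemma del_dob3 : dob n (3 * L.+1) T'.
Proof. exact: (dob_delT (ltn0Sn L) dT cT w0 hW). Qed.

Lemma del_conn : conn_field n T'.
Proof. by move=> f sf; apply: (reachJ_all (ltn0Sn L) dT cT w0 hW). Qed.

Lemma excols_shS k V : excols (shS k V) = excols V.
Proof.
apply/fsetP => y; apply/in_excols/in_excols => -[f [fV hor ->]].
  exists (shift_face (- k) f); split => //; first by move: fV; rewrite in_shS.
  by rewrite /face_cell !ffunE /= !mul0r !addr0.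
exists (shift_face k f); split => //; first by rewrite in_shS shiftK.
by rewrite /face_cell !ffunE /= !mul0r !addr0.
Qed.

Lemma card_shS k V : #|` shS k V| = #|` V|.
Proof.
rewrite card_in_imfset //= => f g _ _ e; by rewrite -(shiftK k f) e shiftK.
Qed.

Lemma K_shift : K = shS (- flr n L.+1 T W f0) W.
Proof. exact: (stdof_uniq (ltn0Sn L) dT cT w0 hW sK). Qed.

Lemma excols_K : excols K = excols W. Proof. by rewrite K_shift excols_shS. Qed.
Lemma card_K : #|` K| = #|` W|. Proof. by rewrite K_shift card_shS. Qed.

Lemma excols_K_half : (2 * #|` excols K| <= #|` K|)%N.
Proof. rewrite excols_K card_K; exact: (excols_half (ltn0Sn L) dT cT hW). Qed.

Lemma del_card : (#|` Sx n m T'| + #|` K| = #|` Sx n m T| + #|` excols K|)%N.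
Proof.
have m3 : (0 < 3 * L.+1)%N by lia.
rewrite (Sx_le m3 Lm del_dob3) (@Sx_le _ L.+1 m) //; last by lia.
by rewrite -(@Sx_le n L.+1 (3 * L.+1)) //; [rewrite excols_K card_K; apply: (card_del (ltn0Sn L) dT cT w0 hW)|lia].
Qed.

(** The construction only gives the box of height [3 * L.+1], but the number of faces does not
    increase, so [height_bound] brings the height back to [L]. *)
Lemma del_ifld : ifld T'.
Proof.
have m3 : (0 < 3 * L.+1)%N by lia.
have cJ : (#|` Sx n m T'| <= L)%N.
  by case: iT => _ _; have := del_card; have := excols_K_half; lia.
split=> //; last exact: del_conn.
apply: (dob_height m3 del_dob3) => f sf; apply: leq_trans (height_bound m3 del_dob3 del_conn sf) _.
by rewrite -(Sx_le m3 Lm del_dob3).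
Qed.

Lemma wW : iswall T W. Proof. by exists f0. Qed.

Lemma del_stdw K' : stdw T' K' <-> stdw T K' /\ K' <> K.
Proof.
split=> [[W2 [w2 s2]]|[[W1 [w1 s1]] ne]].
  have [k [W1 [w1 ne hk e2]]] := iswall_undel (ltn0Sn L) dT cT w0 hW w2.
  have [k' [hk' _]] := iswall_del (ltn0Sn L) dT cT w0 hW w1 ne.
  have h : forall f, f \in W1 -> Gj n L.+1 T W (col f) = k /\ ~~ touchW W f.
    by move=> f fW1; split; [apply: hk|case: (hk' _ fW1)].
  have s1 : stdof T W1 K' by apply/(stdof_del (ltn0Sn L) dT cT w0 hW _ h); rewrite -e2.
  split; first by exists W1.
  move=> eK; apply: ne; apply/esym; apply: (stdof_eq iT wW w1 _ s1); by rewrite eK.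
have nW : W1 <> W.
  move=> e; apply: ne; rewrite K_shift; apply: (stdof_uniq (ltn0Sn L) dT cT w0 hW); by rewrite -e.
have [k [hk w2]] := iswall_del (ltn0Sn L) dT cT w0 hW w1 nW.
by exists (shS (- k) W1); split=> //; apply/(stdof_del (ltn0Sn L) dT cT w0 hW _ hk).
Qed.

Lemma del_walls W2 : iswall T' W2 -> exists2 W1, iswall T W1 & rhoW W1 = rhoW W2.
Proof.
move=> w2; have [k [W1 [w1 ne hk ->]]] := iswall_undel (ltn0Sn L) dT cT w0 hW w2.
by exists W1 => //; rewrite rhoW_shS.
Qed.
End Summary.

(** * The cost of a deletion *)

Lemma vW_shS k W : vW (shS k W) = vW W.
Proof.
apply/funext => b; apply: asbool_equiv_eq; split=> -[f fW fb].
  by exists (shift_face (- k) f); rewrite -?in_shS ?pv_shift.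
by exists (shift_face k f); rewrite ?in_shS ?shiftK ?pv_shift.
Qed.

(* [delT] forgets, of the columns of the wall, exactly these signs *)
Definition signs (T : field) (h : int) (K : {fset face}) : {fset face} :=
  [fset f in K | T (col f) (ht f + h)%R]%fset.

(** [delT] near a vertex shows the floor, which together with [K] gives the wall. The signs give
    [om], hence [Gj], hence the field off the columns of [W]. Over these columns the horizontal
    separating faces are those of [W], and the field is rebuilt upwards from below the box. *)
Lemma delT_inj n m T1 T2 (W1 W2 : {fset face}) f1 f2 (K : {fset face}) : (0 < m)%N ->
  dob n m T1 -> conn_field n T1 -> dob n m T2 -> conn_field n T2 ->
  wallf T1 f1 -> (forall g, (g \in W1) = inW T1 f1 g) ->
  wallf T2 f2 -> (forall g, (g \in W2) = inW T2 f2 g) ->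
  stdof T1 W1 K -> stdof T2 W2 K -> delT n m T1 W1 f1 =2 delT n m T2 W2 f2 ->
  signs T1 (flr n m T1 W1 f1) K = signs T2 (flr n m T2 W2 f2) K -> T1 =2 T2.
Proof.
move=> m0 d1 c1 d2 c2 w1 h1 w2 h2 s1 s2 eJ.
have k1 := stdof_uniq m0 d1 c1 w1 h1 s1; have k2 := stdof_uniq m0 d2 c2 w2 h2 s2.
have [b [vb _]] := leftmost m0 d1 w1 h1.
have vb2 : vW W2 b by rewrite -(vW_shS (- flr n m T2 W2 f2)) -k2 k1 vW_shS.
have eflr : flr n m T1 W1 f1 = flr n m T2 W2 f2.
  have e z : (z < flr n m T1 W1 f1) = (z < flr n m T2 W2 f2).
    rewrite -(delT_near m0 d1 c1 w1 h1 _ vb (arnd_refl b)).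
    by rewrite -(delT_near m0 d2 c2 w2 h2 _ vb2 (arnd_refl b)) eJ.
  have := e (flr n m T1 W1 f1); have := e (flr n m T2 W2 f2); lia.
have eW : W2 = W1.
  rewrite -(shS0 W1) -(subrr (flr n m T1 W1 f1)) addrC -shS_shS -k1 k2 eflr.
  by rewrite shS_shS addNr shS0.
subst W2; rewrite -eflr => esg; set h := flr n m T1 W1 f1 in k1 esg.
have sg f : f \in W1 -> T1 (col f) (ht f) = T2 (col f) (ht f).
  move=> fW; move/fsetP: esg => /(_ (shift_face (- h) f)); rewrite !inE /=.
  have -> : shift_face (- h) f \in K by rewrite k1 in_shS shift_shift subrr shift0.
  by rewrite col_shift ht_shift subrK.
have eom d c : om m T1 W1 d c = om m T2 W1 d c.
  apply: eq_bigr => i _; case: ifP => // vW1.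
  have := sg _ vW1; rewrite !cohtE => e.
  have := W_sepf h1 vW1; have := W_sepf h2 vW1; rewrite !sepfE e.
  by case: (T2 c _); case: (T1 _ _); case: (T2 _ _).
have eG c : Gj n m T1 W1 c = Gj n m T2 W1 c by apply: eq_bigr.
move=> c z; have [fc|nf] := boolP (fW W1 c); last first.
  have := eJ c (z - Gj n m T1 W1 c); rewrite /delT (negbTE nf) -eG subrK //.
have sE T f (d : dob n m T) (ct : conn_field n T) (hh : forall g, (g \in W1) = inW T f g) y :
    sepf T (hf c y) = (hf c y \in W1).
  apply/idP/idP => [sy|/(W_sepf hh)//].
  apply: (over_W m0 d ct hh (b := c)); last exact: fW_vW fc (arnd_refl c).
    by rewrite wallf_hf sy (fW_nceil hh fc).
  by rewrite pvE arnd_refl.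
have st y : T1 c (y - 1) = T2 c (y - 1) -> T1 c y = T2 c y.
  move=> e; have := sE _ _ d1 c1 h1 y; rewrite -(sE _ _ d2 c2 h2 y) !sepfE e.
  by case: (T1 c y); case: (T2 c y); case: (T2 c _).
have [lt|ge] := ltP z (- m%:Z); first by rewrite (T_low m0 d1 _ lt) (T_low m0 d2 _ lt).
have -> : z = - m%:Z - 1 + (absz (z + m%:Z + 1)%R)%:Z by lia.
elim: (absz _) => [|k IH].
  rewrite (T_low m0 d1) ?(T_low m0 d2) //; lia.
by apply: st; rewrite (_ : - m%:Z - 1 + k.+1%:Z - 1 = - m%:Z - 1 + k%:Z) //; lia.
Qed.

(** * Exchange inequalities for the contours *)

Section ShiftXi.
Variables (R : realFieldType) (lam : R).
Hypothesis lam0 : 0 <= lam.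
Hypothesis lam1 : lam <= 1.

Lemma Xi_gt0 A : 0 < Xi ev lam A.
Proof.
have h : fset0 \in [seq X <- fpowerset A | ev X] by rewrite mem_filter ev_fset0 fpowersetE fsub0set.
rewrite /Xi (bigD1_seq fset0 h); last by rewrite filter_uniq // fset_uniq.
by rewrite cardfs0 expr0 ltr_pwDl //; apply: sumr_ge0 => X _; apply: exprn_ge0.
Qed.

Lemma Xi_sub A B : (A `<=` B)%fset -> Xi ev lam A <= Xi ev lam B.
Proof.
move=> AB; apply: ler_sum_uniq_sub; rewrite ?filter_uniq ?fset_uniq //.
  by move=> X; rewrite !mem_filter !fpowersetE => /andP[-> XA]; apply: fsubset_trans XA AB.
by move=> X _; apply: exprn_ge0.
Qed.

Lemma edge4_shift k f1 f2 f3 f4 : edge4 f1 f2 f3 f4 ->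
  edge4 (shift_face k f1) (shift_face k f2) (shift_face k f3) (shift_face k f4).
Proof.
case=> [d c z|b z]; rewrite !shiftE; last exact: Edge4v.
by rewrite (_ : z - 1 + k = z + k - 1); [exact: Edge4h|lia].
Qed.

Lemma ev_shS k X : ev X -> ev (shS k X).
Proof.
move=> /asboolP eX; apply/asboolP => f1 f2 f3 f4 /(edge4_shift (- k)) /eX.
by rewrite !in_shS.
Qed.

Lemma Xi_shS_le k A : Xi ev lam A <= Xi ev lam (shS k A).
Proof.
apply: (@ler_sum_inj _ _ _ _ _ (shS k)).
- by rewrite filter_uniq // fset_uniq.
- by move=> X Y _ _ e; rewrite -(shS0 X) -(shS0 Y) -(subrr k) -!shS_shS e.
- move=> X; rewrite !mem_filter !fpowersetE => /andP[eX /fsubsetP XA]; rewrite ev_shS //=.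
  by apply/fsubsetP => f; rewrite !in_shS => /XA.
- by move=> X _; rewrite card_shS.
- by move=> X _; apply: exprn_ge0.
Qed.

Lemma Xi_shS k A : Xi ev lam (shS k A) = Xi ev lam A.
Proof.
apply: le_anti; rewrite Xi_shS_le andbT.
by have := Xi_shS_le (- k) (shS k A); rewrite shS_shS subrr shS0.
Qed.

Definition polys (A B : {fset face}) (k : pred face) : R :=
  \prod_(X <- badlist sadj A B k) (1 + (4 * lam) ^+ #|` X|).

Let swap := Xi_swap sadj_sym lam0 lam1 ev_split ev_join.

(* removing constraints from the bulk only costs the polymers that touch them *)
Lemma Xi_peierls (A : {fset face}) (k : pred face) :
  Xi ev lam A <= polys fset0 A k * Xi ev lam [fset f in A | ~~ k f]%fset.
Proof.
have := swap fset0 A k; rewrite (_ : [fset f in fset0 | ~~ k f]%fset = fset0); last first.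
  by apply/fsetP => f; rewrite !inE.
by rewrite mulrCA ler_pM2l ?Xi_gt0.
Qed.

(** Exchange between [A] and its translate by [g]: their full sums are equal and cancel, and the
    constraint, now on the translate, is translated back. *)
Lemma Xi_shift (A : {fset face}) (k : pred face) (g : int) :
  Xi ev lam [fset f in A | ~~ k f]%fset <=
  polys A (shS g A) k * Xi ev lam [fset f in A | ~~ k (shift_face g f)]%fset.
Proof.
have := swap A (shS g A) k; rewrite Xi_shS -/(polys _ _ _) mulrCA mulrC.
rewrite ler_pM2l ?Xi_gt0 // => h; apply: le_trans h _.
rewrite le_eqVlt; apply/orP; left; apply/eqP; congr (_ * _).
rewrite -[RHS](Xi_shS g); congr Xi; apply/fsetP => f.
by rewrite in_shS !inE /= -!/(in_mem _ _) in_shS shiftNK.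
Qed.
End ShiftXi.

Lemma sum_cover (R : numDomainType) (T I : eqType) (s : seq T) (J : seq I) (P : I -> T -> bool) (F : T -> R) :
  (forall x, x \in s -> 0 <= F x) -> (forall x, x \in s -> exists2 i, i \in J & P i x) ->
  \sum_(x <- s) F x <= \sum_(i <- J) \sum_(x <- s | P i x) F x.
Proof.
move=> F0 h; rewrite (exchange_big_dep xpredT) //= big_seq [leRHS]big_seq; apply: ler_sum => x xs.
have [i iJ Pi] := h _ xs.
by rewrite (big_rem i iJ) /= Pi lerDl; apply: sumr_ge0 => j _; apply: F0.
Qed.

(** * Distances between columns and between faces *)

Definition d1 (a b : int * int) : nat := (absz (a.1 - b.1)%R + absz (a.2 - b.2)%R)%N.
Definition d3 (f g : face) : nat := (d1 (col f) (col g) + absz (ht f - ht g)%R)%N.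

Lemma near1_abs (x y : int) : near1 x y -> (absz (x - y)%R <= 1)%N.
Proof. rewrite /near1; lia. Qed.

Lemma abs_tri (x y z : int) : (absz (x - z)%R <= absz (x - y)%R + absz (y - z)%R)%N.
Proof. lia. Qed.

Lemma d1_tri a b c : (d1 a c <= d1 a b + d1 b c)%N.
Proof.
rewrite /d1; have := abs_tri a.1 b.1 c.1; have := abs_tri a.2 b.2 c.2.
set p := absz _; set q := absz _; set r := absz _; set s := absz _; set t := absz _; set u := absz _; lia.
Qed.

Lemma d1_sym a b : d1 a b = d1 b a.
Proof. by rewrite /d1 -(abszN (a.1 - b.1)) -(abszN (a.2 - b.2)) !opprB. Qed.

Lemma d3_sadj f g : sadj f g -> (d3 f g <= 3)%N.
Proof.
move=> /sadj_near/and3P[/near1_abs h1 /near1_abs h2 /near1_abs h3]; rewrite /d3 /d1.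
by rewrite -[3%N]/(1 + 1 + 1)%N !leq_add.
Qed.

Lemma d1_pv f b : pv f b -> (d1 (col f) b <= 2)%N.
Proof.
move/arnd_col/arndP => [h1 h2]; rewrite /d1 -[2%N]/(1 + 1)%N leq_add //;
 by apply: near1_abs; rewrite /near1; lia.
Qed.

Lemma d3_tri f g h : (d3 f h <= d3 f g + d3 g h)%N.
Proof.
rewrite /d3; have := d1_tri (col f) (col g) (col h); have := abs_tri (ht f) (ht g) (ht h).
set p := absz _; set q := absz _; set r := absz _; set s := d1 _ _; set t := d1 _ _; set u := d1 _ _; lia.
Qed.

(** A covering walk has twice as many steps as [X] has faces, and adjacent faces are at distance at
    most 3. *)
Lemma connected_diam (X : {fset face}) f x : connected sadj X -> f \in X -> x \in X ->
  (d3 f x <= 6 * #|` X|)%N.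
Proof.
move=> cX fX xX; have [p [pp _ Xp sz]] := walk_cover sadj_sym sadj_refl fX cX.
suff h q g : path sadj g q -> x \in g :: q -> (d3 g x <= 3 * size q)%N.
  by apply: leq_trans (h _ _ pp (Xp _ xX)) _; rewrite sz mulnA.
elim: q g => [|y q IH] g.
  by move=> _; rewrite inE => /eqP ->; rewrite /d3 /d1 !subrr.
rewrite /= => /andP[gy py]; rewrite inE => /orP[/eqP->|xq].
  by rewrite /d3 /d1 !subrr.
have := leq_trans (d3_tri g y x) (leq_add (d3_sadj gy) (IH _ py xq)); rewrite /=; lia.
Qed.

Lemma nbf_d3 f g : g \in nbf f -> (d3 f g <= 3)%N.
Proof.
have tr a b : b \in tri a -> (absz (a - b)%R <= 1)%N by rewrite !inE; lia.
case/allpairsP => -[cz d] [h _ ->]; case/allpairsP: h => -[c z] [h hz ->].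
case/allpairsP: h => -[x y] [hx hy ->].
rewrite /d3 /d1 /col /ht /= !mkptE -[3%N]/(1 + 1 + 1)%N !leq_add //; exact: tr.
Qed.

Definition vts (f : face) : seq (int * int) :=
  [seq b <- [:: col f; ((col f).1 + 1, (col f).2); ((col f).1, (col f).2 + 1); ((col f).1 + 1, (col f).2 + 1)] | pv f b].
Definition vlist (K : {fset face}) : seq (int * int) := undup (flatten [seq vts f | f <- K]).

Lemma mem_vts f b : (b \in vts f) = pv f b.
Proof.
rewrite mem_filter andb_idr // => /arnd_col/arndP[h1 h2]; rewrite !inE.
have [e1|e1] := h1; have [e2|e2] := h2; apply/or4P.
- by apply: Or41; apply/eqP; apply: int_pair_eq; move: e1 e2; rewrite /=; lia.
- by apply: Or43; apply/eqP; apply: int_pair_eq; move: e1 e2; rewrite /=; lia.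
- by apply: Or42; apply/eqP; apply: int_pair_eq; move: e1 e2; rewrite /=; lia.
- by apply: Or44; apply/eqP; apply: int_pair_eq; move: e1 e2; rewrite /=; lia.
Qed.

Lemma mem_vlist K b : (b \in vlist K) = vW K b.
Proof.
rewrite mem_undup; apply/flattenP/vWP => [[s /mapP[f fK ->]]|[f fK fb]].
  by rewrite mem_vts => fb; exists f.
by exists (vts f); [apply/mapP; exists f|rewrite mem_vts].
Qed.

Lemma size_vlist K : (size (vlist K) <= 4 * #|` K|)%N.
Proof.
apply: leq_trans (size_undup _) _; rewrite size_flatten /shape -map_comp sumnE big_map.
rewrite (@leq_trans (\sum_(f <- K) 4)%N) //; last by rewrite big_const_seq count_predT iter_addn addn0.
by apply: leq_sum => f _; rewrite /= size_filter; apply: leq_trans (count_size _ _) _.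
Qed.

Lemma half_pow (R : realFieldType) (d k : nat) : (k <= 5)%N -> 2^-1 ^+ (d - k) <= 32%:R * 2^-1 ^+ d :> R.
Proof.
move=> k5; have -> : 32%:R = 2 ^+ 5 :> R by rewrite -natrX.
apply: (@le_trans _ _ (2 ^+ 5 * 2^-1 ^+ (d - k + 5))).
  by rewrite [leRHS]mulrC exprD -mulrA -exprMn mulVf ?pnatr_eq0 // expr1n mulr1.
by rewrite ler_wpM2l ?exprn_ge0 // ler_wiXn2l ?invr_ge0 ?invf_le1 ?ler1n //; lia.
Qed.

(** * Sums over polymers *)

Section Polymers.
Variables (R : realType) (lam : R).
Hypothesis lam0 : 0 <= lam.
Let lam4 := 4 * lam.
(** 64 is [2 ^ 6]: a polymer with [p] faces reaches no further than [6 * p], so this factor pays for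
    a decay by one half per unit of distance. The factor 4 is that of [Znocomp_step]. *)
Definition small_lam : Prop := (81 ^ 2)%:R * (64 * (4 * lam)) <= 2^-1 :> R.
Definition eps : R := 2 * ((81 ^ 2)%:R * (64 * (4 * lam))).
Hypothesis lam_small : small_lam.

Lemma eps_ge0 : 0 <= eps. Proof. by rewrite /eps !mulr_ge0. Qed.

Lemma sum_polys f (N : nat) (s : seq {fset face}) (P : pred {fset face}) : uniq s ->
  (forall X, X \in s -> P X -> [/\ connected sadj X, f \in X & (N <= 6 * #|` X|)%N]) ->
  \sum_(X <- s | P X) lam4 ^+ #|` X| <= eps * 2^-1 ^+ N.
Proof.
move=> us h; apply: (@le_trans _ _ (\sum_(X <- [seq X <- s | P X]) (64 * lam4) ^+ #|` X| * 2^-1 ^+ N)).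
  rewrite -big_filter big_seq [leRHS]big_seq; apply: ler_sum => X; rewrite mem_filter => /andP[PX Xs].
  have [_ _ hN] := h _ Xs PX.
  rewrite [X in _ <= X * _](exprMn _ 64 lam4) mulrAC -[leLHS]mul1r.
  rewrite ler_wpM2r ?exprn_ge0 ?mulr_ge0 //.
  rewrite -ler_pdivrMr ?exprn_gt0 // mul1r -exprVn invrK.
  by rewrite (_ : 64 = 2 ^+ 6 :> R) -?exprM ?ler_weXn2l // ?ler1n -?natrX.
rewrite -mulr_suml ler_wpM2r ?exprn_ge0 //.
apply: (@sum_connected _ sadj sadj_sym sadj_refl nbf 81 _ _ _ f).
- exact: sadj_nbf.
- exact: size_nbf.
- by rewrite filter_uniq.
- by rewrite !mulr_ge0.
- exact: lam_small.
- by move=> X; rewrite mem_filter => /andP[PX Xs]; case: (h _ Xs PX).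
Qed.

Definition Dw (K : {fset face}) (c : int * int) : R := \sum_(b <- vlist K) 2^-1 ^+ d1 c b.

Lemma Dw_ge0 K c : 0 <= Dw K c.
Proof. by apply: sumr_ge0 => b _; apply: exprn_ge0. Qed.

(* polymers next to a face of [Z] that come over [K] or reach far up *)
Lemma sum_bad (s : seq {fset face}) (Z K : {fset face}) (N : nat) (M : nat) : uniq s ->
  (forall X, X \in s -> connected sadj X /\ exists f q, [/\ f \in X, q \in Z, sadj f q &
      (exists2 x, x \in X & exists2 b, pv x b & vW K b) \/ (exists2 x, x \in X & (N + M < absz (ht x))%N)]) ->
  (forall q, q \in Z -> (absz (ht q) <= M)%N) ->
  \sum_(X <- s) lam4 ^+ #|` X| <= 2592%:R * eps * \sum_(q <- Z) (Dw K (col q) + 2^-1 ^+ N).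
Proof.
move=> us h hM.
pose P (i : face * face * option (int * int)) (X : {fset face}) := (i.1.2 \in X) &&
  (if i.2 is Some b then `[< exists2 x, x \in X & pv x b >] else `[< exists2 x, x \in X & (N + M < absz (ht x))%N >]).
pose I1 := [seq (q, f) | q <- Z, f <- nbf q].
pose I2 := [seq (i, t) | i <- I1, t <- None :: [seq Some b | b <- vlist K]].
apply: le_trans (@sum_cover _ _ _ s I2 P _ _ _) _.
- by move=> X _; rewrite exprn_ge0 // mulr_ge0.
- move=> X /h[_ [f [q [fX qZ fq hx]]]].
  have i1 : (q, f) \in I1 by apply/allpairsPdep; exists q, f; rewrite sadj_nbf // sadj_sym.
  case: hx => [[x xX [b xb vb]]|[x xX hx]].
    exists ((q, f), Some b); last by rewrite /P /= fX; apply/asboolP; exists x.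
    apply/allpairsP; exists ((q, f), Some b); split=> //.
    by rewrite inE /= map_f // mem_vlist.
  exists ((q, f), None); last by rewrite /P /= fX; apply/asboolP; exists x.
  by apply/allpairsP; exists ((q, f), None); split=> //; rewrite inE eqxx.
rewrite /I2 big_allpairs /I1 big_allpairs_dep /= mulr_sumr big_seq [leRHS]big_seq.
apply: ler_sum => q qZ.
(* 32 is [2 ^ 5]: up to 3 units of distance are lost between [q] and [f], and 2 between a face over
   [b] and [b]. The product of 81 and 32 is 2592. *)
apply: (@le_trans _ _ (\sum_(f <- nbf q) 32%:R * eps * (Dw K (col q) + 2^-1 ^+ N))); last first.
  rewrite big_const_seq count_predT iter_addr addr0 -[leLHS]mulr_natl.
  rewrite mulrA ler_wpM2r ?addr_ge0 ?Dw_ge0 ?exprn_ge0 // mulrA ler_wpM2r ?eps_ge0 //.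
  by rewrite -natrM ler_nat (leq_trans (leq_mul (size_nbf q) (leqnn _))).
rewrite big_seq [leRHS]big_seq; apply: ler_sum => f fq.
rewrite big_cons big_map.
have df := nbf_d3 fq.
have tr (X : {fset face}) x : X \in s -> f \in X -> x \in X -> (d3 q x <= 6 * #|` X| + 3)%N.
  move=> /h[cX _] fX xX; have := connected_diam cX fX xX; have := d3_tri q f x; lia.
rewrite addrC mulrDr; apply: lerD.
  rewrite /Dw mulr_sumr; apply: ler_sum => b _.
  apply: le_trans (@sum_polys f (d1 (col q) b - 5) s _ us _) _.
    move=> X Xs /andP[/= fX /asboolP[x xX xb]]; split=> //; first by case: (h _ Xs).
    have h1 := tr _ _ Xs fX xX; have h2 := d1_tri (col q) (col x) b; have h3 := d1_pv xb.
    have h4 : (d1 (col q) (col x) <= d3 q x)%N := leq_addr _ _.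
    move: h1 h2 h3 h4; move: (d1 _ _) (d1 _ _) (d1 _ _) (d3 _ _) (#|` X|) => a b' c d k; lia.
  by rewrite (mulrC 32%:R) -[leRHS](mulrA eps) ler_wpM2l ?eps_ge0 ?half_pow.
apply: le_trans (@sum_polys f (N - 4) s _ us _) _.
  move=> X Xs /andP[/= fX /asboolP[x xX xh]]; split=> //; first by case: (h _ Xs).
  have h1 := tr _ _ Xs fX xX; have h2 := hM _ qZ.
  have h3 : (absz (ht q - ht x)%R <= d3 q x)%N := leq_addl _ _.
  have h4 : (absz (ht x) <= absz (ht q) + absz (ht q - ht x)%R)%N by lia.
  move: h1 h2 h3 h4 xh; move: (absz _) (absz _) (absz _) (d3 _ _) (#|` X|) => a b' c d k; lia.
by rewrite (mulrC 32%:R) -[leRHS](mulrA eps) ler_wpM2l ?eps_ge0 ?half_pow.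
Qed.
End Polymers.

Lemma polys_le_expR (R : realType) (lam : R) A B k : 0 <= lam ->
  polys lam A B k <= expR (\sum_(X <- badlist sadj A B k) (4 * lam) ^+ #|` X|).
Proof. by move=> l0; apply: prodr_le_expR => X _; rewrite exprn_ge0 // mulr_ge0. Qed.

Lemma in_fsetF (A : {fset face}) (P : pred face) f :
  (f \in [fset f in A | P f]%fset) = (f \in A) && P f.
Proof. by rewrite !inE. Qed.

(** * Contour sums before and after a deletion *)

Section DelXi.
Variables (R : realType) (lam : R).
Hypothesis lam0 : 0 <= lam.
Hypothesis lam1 : lam <= 1.
Hypothesis lam_small : small_lam lam.
Variables (n m L N : nat).
Hypothesis Lm : (N + L + 2 * L.+1 + 2 <= m)%N.
Variables (T : field) (W K : {fset face}) (f0 : face).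
Hypothesis dT : dob n L.+1 T.
Hypothesis cT : conn_field n T.
Hypothesis hT : (#|` Sx n m T| <= L)%N.
Hypothesis w0 : wallf T f0.
Hypothesis hW : forall g, (g \in W) = inW T f0 g.
Hypothesis vK : vW K = vW W.

Let G := Gj n L.+1 T W.
Let T' := delT n L.+1 T W f0.
Let L0 : (0 < L.+1)%N := ltn0Sn L.
Let m0 : (0 < m)%N. Proof. by move: Lm; lia. Qed.
Let dTm : dob n m T. Proof. by apply: dob_le dT; move: Lm; lia. Qed.

Definition keep (f : face) : bool := sepf T f && (f \notin W).
(* the zones where [G] takes a value of [gs] have been shifted *)
Definition thz (gs : seq int) (f : face) : face := shift_face (if G (col f) \in gs then - G (col f) else 0) f.
Definition Pz (gs : seq int) (q : face) : bool := `[< exists f, keep f /\ q = thz gs f >].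

Definition Zg (g : int) : {fset face} := [fset q in Sx n m T | (q \notin W) && (G (col q) == g)]%fset.

Lemma zone_nout f : G (col f) != 0 -> ~~ outL n f.
Proof.
move=> g0; apply: contra g0 => /and3P[_ _ nb]; apply/eqP; exact: (Gj_out L0 dT cT w0 hW nb).
Qed.

Lemma mem_Zg g q : g != 0 -> reflect (keep q /\ G (col q) = g) (q \in Zg g).
Proof.
move=> g0; have -> : (q \in Zg g) = [&& q \in Sx n m T, q \notin W & G (col q) == g] by rewrite !inE.
apply: (iffP and3P) => [[]|[/andP[sq nW] e]].
  by rewrite mem_Sx // => /andP[sq _] nW /eqP; split=> //; rewrite /keep sq.
by rewrite mem_Sx // sq nW e; split=> //; apply: zone_nout; rewrite e.
Qed.

Lemma Zg_ht g q : q \in Zg g -> (absz (ht q) <= L)%N.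
Proof.
rewrite !inE /= => /andP[/andP[_ sq] _]; exact: leq_trans (height_bound m0 dTm cT sq) hT.
Qed.

Lemma G_arnd b c c' : ~~ vW W b -> arnd b c -> arnd b c' -> G c = G c'.
Proof. exact: (Gj_vertex L0 dT cT w0 hW). Qed.

Lemma thz_pv gs f b : pv (thz gs f) b = pv f b. Proof. exact: pv_shift. Qed.

Lemma inwin_shift k x : (absz (ht x) + absz k + 1 < m)%N -> inwin n m (shift_face k x) = inwin n m x.
Proof.
elim/face_ind: x => [c z|d c z]; rewrite shiftE !inwinE cohtE /inc => h.
  by case: (inbox n c) => //=; apply/idP/idP; lia.
by case: (inbox n c); case: (inbox n (prv d c)) => //=; apply/idP/idP; lia.
Qed.

Lemma zone_step gs g : g \notin gs -> g != 0 ->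
  Xi ev lam (allowed n m (Pz gs)) <=
  expR (2592%:R * eps lam * \sum_(q <- Zg g) (Dw R K (col q) + 2^-1 ^+ N)) *
  Xi ev lam (allowed n m (Pz (g :: gs))).
Proof.
move=> ggs g0.
(* [E] collects the faces outside the zone of jump [g], and [k] is the exclusion due to that zone.
   Shifting the zone means shifting [k] while [A] is kept. *)
pose E (q : face) : bool := `[< exists f, [/\ keep f, G (col f) <> g & q = thz gs f] >].
pose k (q : face) : bool := `[< exists f, [/\ keep f, G (col f) = g & sadj q f] >].
set A := allowed n m E.
have e1 : allowed n m (Pz gs) = [fset f in A | ~~ k f]%fset.
  apply/fsetP => f; apply/in_allowed/idP => [[fw h]|].
    rewrite in_fsetF; apply/andP; split.
      apply/in_allowed; split=> // q /asboolP[f1 [kf _ eq]]; apply: h; apply/asboolP; by exists f1.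
    apply/asboolPn => -[f1 [kf eg fq]]; have := h f1; rewrite fq => H.
    suff : false by []; apply: H; apply/asboolP; exists f1; split=> //.
    by rewrite /thz eg (negbTE ggs) shift0.
  rewrite in_fsetF => /andP[/in_allowed[fw h] /asboolPn nk]; split=> // q /asboolP[f1 [kf ->]].
  have [eg|ne] := pselect (G (col f1) = g); last by apply: h; apply/asboolP; exists f1.
  apply/negP => s; apply: nk; exists f1; split=> //.
  by move: s; rewrite /thz eg (negbTE ggs) shift0.
have thg f1 : G (col f1) <> g -> thz (g :: gs) f1 = thz gs f1.
  by move=> ne; rewrite /thz inE; case: eqP.
have thg' f1 : G (col f1) = g -> thz (g :: gs) f1 = shift_face (- g) f1.
  by move=> e; rewrite /thz inE e eqxx.
have e2 : allowed n m (Pz (g :: gs)) = [fset f in A | ~~ k (shift_face g f)]%fset.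
  apply/fsetP => f; apply/in_allowed/idP => [[fw h]|].
    rewrite in_fsetF; apply/andP; split.
      apply/in_allowed; split=> // q /asboolP[f1 [kf ne ->]]; apply: h; apply/asboolP; exists f1.
      by rewrite thg.
    apply/asboolPn => -[f1 [kf eg fq]].
    have := h (shift_face (- g) f1); rewrite -(shiftK g f) (sadj_shift (- g) fq) => H.
    by suff : false by []; apply: H; apply/asboolP; exists f1; rewrite thg'.
  rewrite in_fsetF => /andP[/in_allowed[fw h] /asboolPn nk]; split=> // q /asboolP[f1 [kf ->]].
  have [eg|ne] := pselect (G (col f1) = g); last by rewrite thg //; apply: h; apply/asboolP; exists f1.
  rewrite thg' //; apply/negP => s; apply: nk; exists f1; split=> //.
  by have := sadj_shift g s; rewrite shiftNK.
rewrite e1 e2; apply: le_trans (Xi_shift lam0 lam1 A k g) _.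
apply: ler_wpM2r; first by rewrite ltW // Xi_gt0.
apply: le_trans (polys_le_expR _ _ _ lam0) _.
rewrite ler_expR; apply: (@sum_bad _ _ lam0 lam_small _ (Zg g) K N L).
- by rewrite filter_uniq // fset_uniq.
- move=> X; rewrite mem_filter => /andP[/asboolP[cX [f fX /asboolP[q [kq gq fq]]] [x xX dx]] _].
  split=> //; exists f, q; split=> //; first by apply/mem_Zg.
  rewrite vK; apply: contrapT => no.
  have nv y b : y \in X -> pv y b -> ~~ vW W b.
    by move=> yX yb; apply/negP => vb; apply: no; left; exists y => //; exists b.
  have low y : y \in X -> (absz (ht y) <= N + L)%N.
    by move=> yX; rewrite leqNgt; apply/negP => hy; apply: no; right; exists y.
  have Gf : G (col f) = g.
    have [b [z [fb _ qb _]]] := sadjP _ _ fq.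
    by rewrite -gq; apply: (G_arnd (nv _ _ fX fb)); apply: arnd_col.
  (* A connected set that avoids the vertices of [W] keeps the value [g]. So it shares no vertex
     with a face of [E], at any height, and only the window decides whether it lies in [A]. *)
  have GX y : y \in X -> G (col y) = g.
    move=> yX; apply: (@fconn_stay _ sadj X (fun y => G (col y) = g) f _ _ Gf (cX _ _ fX yX)).
    move=> u v uX vX eu uv; have [b [z [ub _ vb _]]] := sadjP _ _ uv.
    by rewrite -eu; apply: (G_arnd (nv _ _ uX ub)); apply: arnd_col.
  have AE j : (shift_face j x \in A) = inwin n m (shift_face j x).
    apply/in_allowed/idP => [[]//|xw]; split=> // e /asboolP[f1 [kf ne ->]]; apply/negP => xe.
    have [b [z [xb _ eb _]]] := sadjP _ _ xe; move: xb eb; rewrite pv_shift thz_pv => xb eb.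
    by apply: ne; rewrite -(GX _ xX); apply: (G_arnd (nv _ _ xX xb)); apply: arnd_col.
  (* [x] has height at most [N + L] and the shift is at most [2 * L.+1], so [Lm] prevents the shift
     from crossing the top or bottom of the window. *)
  move: dx; rewrite in_shS AE -{1}(shift0 x) AE shift0 inwin_shift ?eqxx //.
  have := low _ xX; have := Gj_bound L0 dT cT w0 hW (col x); rewrite -/G (GX _ xX) abszN; move: Lm; lia.
- exact: Zg_ht.
Qed.

Lemma zone_steps gs : uniq gs -> 0 \notin gs ->
  Xi ev lam (allowed n m (Pz [::])) <=
  expR (2592%:R * eps lam * \sum_(g <- gs) \sum_(q <- Zg g) (Dw R K (col q) + 2^-1 ^+ N)) *
  Xi ev lam (allowed n m (Pz gs)).
Proof.
elim: gs => [|g gs IH]; first by rewrite big_nil mulr0 expR0 mul1r.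
rewrite /= inE negb_or eq_sym => /andP[ggs ug] /andP[g0 gs0].
apply: le_trans (IH ug gs0) _; rewrite big_cons mulrDr expRD (mulrC (expR _) (expR _)) -[leRHS]mulrA.
apply: ler_wpM2l; first exact: expR_ge0.
exact: zone_step.
Qed.

Definition Zall : {fset face} := [fset q in Sx n m T | (q \notin W) && (G (col q) != 0)]%fset.

(** Three moves: forget the exclusion by [W], which only increases the sum; shift the zones, one
    value of [Gj] at a time; insert the floor left by [W], at a cost of [81 * eps] per face. *)
Lemma del_Xi : Xi ev lam (allowed n m (sepf T)) <=
  expR (2592%:R * eps lam * \sum_(q <- Zall) (Dw R K (col q) + 2^-1 ^+ N) + 81%:R * eps lam * #|` W|%:R) *
  Xi ev lam (allowed n m (sepf T')).
Proof.
pose gs := undup [seq G (col q) | q <- Zall].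
have mZ q : q \in Zall = [&& q \in Sx n m T, q \notin W & G (col q) != 0] by rewrite !inE.
have gs0 : 0 \notin gs.
  by rewrite mem_undup; apply/negP => /mapP[q]; rewrite mZ => /and3P[_ _ /eqP h] /esym.
have sE : \sum_(q <- Zall) (Dw R K (col q) + 2^-1 ^+ N) =
    \sum_(g <- gs) \sum_(q <- Zg g) (Dw R K (col q) + 2^-1 ^+ N).
  rewrite (sum_fiber _ (fun q => G (col q))) -/gs; rewrite big_seq [RHS]big_seq; apply: eq_bigr => g gin.
  rewrite -big_filter; apply: perm_big; apply: uniq_perm; rewrite ?filter_uniq ?fset_uniq //.
  move=> q; rewrite mem_filter mZ !inE /=; have [->|] := eqVneq (G (col q)) g; last by rewrite !andbF.
  have -> : g != 0 by apply: contraNneq gs0 => <-.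
  by rewrite !andbT.
have k0 f : keep f -> thz gs f = dn n L.+1 T W f.
  move=> /andP[sf nW]; rewrite /thz /dn -/G; case: ifPn => // ng.
  suff -> : G (col f) = 0 by rewrite oppr0.
  apply/eqP; apply: contraNT ng => g0; rewrite mem_undup; apply/mapP; exists f => //.
  by rewrite mZ nW g0 andbT mem_Sx // sf zone_nout.
apply: le_trans (Xi_sub lam0 (_ : (_ `<=` allowed n m (Pz [::]))%fset)) _.
  apply/fsubsetP => f /in_allowed[fw h]; apply/in_allowed; split=> // q /asboolP[f1 [/andP[sf _] ->]].
  by rewrite /thz shift0; apply: h.
apply: le_trans (zone_steps (undup_uniq _) gs0) _.
rewrite sE expRD -[leRHS]mulrA; apply: ler_wpM2l; first exact: expR_ge0.
pose kF (q : face) : bool := `[< exists c, fW W c /\ sadj q (hf c (flr n L.+1 T W f0)) >].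
have -> : allowed n m (sepf T') = [fset f in allowed n m (Pz gs) | ~~ kF f]%fset.
  apply/fsetP => f; apply/in_allowed/idP => [[fw h]|].
    rewrite in_fsetF; apply/andP; split.
      apply/in_allowed; split=> // q /asboolP[f1 [kf ->]]; apply: h; rewrite k0 //.
      by case/andP: kf => sf nW; case: (sep_dn L0 dT cT w0 hW sf nW).
    apply/asboolPn => -[c [fc s]]; move: s; apply/negP; apply: h.
    by case: (floorJ L0 dT cT w0 hW (fW_vW fc (arnd_refl c)) (arnd_refl c)).
  rewrite in_fsetF => /andP[/in_allowed[fw h] /asboolPn nk]; split=> // q sq.
  case: (sep_delT_cases L0 dT cT w0 hW sq) => [[f1 [sf nW ->]]|[c [fc ->]]].
    have kf : keep f1 by rewrite /keep sf.
    by rewrite -k0 //; apply: h; apply/asboolP; exists f1.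
  by apply/negP => s; apply: nk; exists c.
apply: le_trans (Xi_peierls lam0 lam1 _ kF) _; apply: ler_wpM2r; first by rewrite ltW // Xi_gt0.
apply: le_trans (polys_le_expR _ _ _ lam0) _; rewrite ler_expR.
pose J := [seq f | q <- W, f <- nbf (hf (col q) (flr n L.+1 T W f0))].
set s := badlist _ _ _ _.
apply: le_trans (@sum_cover _ _ _ s J (fun f X => f \in X) _ _ _) _.
- by move=> X _; rewrite exprn_ge0 // mulr_ge0.
- move=> X; rewrite mem_filter => /andP[/asboolP[cX [f fX /asboolP[c [fc fq]]] _] _].
  exists f => //; apply/allpairsPdep; case/fWP: fc => z zW; exists (hf c z), f.
  by rewrite cohtE sadj_nbf // sadj_sym.
rewrite /J big_allpairs_dep /=.
apply: (@le_trans _ _ (\sum_(q <- W) 81%:R * eps lam)); last first.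
  by rewrite big_const_seq count_predT iter_addr addr0 -[leLHS]mulr_natr.
apply: ler_sum => q _; apply: (@le_trans _ _ (\sum_(f <- nbf (hf (col q) (flr n L.+1 T W f0))) eps lam)).
  apply: ler_sum => f _; rewrite -[eps lam]mulr1 -(expr0 (2^-1 : R)).
  apply: (@sum_polys _ _ lam0 lam_small f 0 s (fun X => f \in X)); first by rewrite filter_uniq // fset_uniq.
  by move=> X; rewrite mem_filter => /andP[/asboolP[cX _ _] _] fX; split.
rewrite big_const_seq count_predT iter_addr addr0 -[leLHS]mulr_natl ler_wpM2r ?eps_ge0 //.
Qed.
End DelXi.

(** * Sums of the decay over columns and over walls *)

Section DistanceSums.
Variable R : realType.

Lemma geo_nat (s : seq nat) : uniq s -> \sum_(k <- s) 2^-1 ^+ k <= 2 :> R.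
Proof.
move=> us; have [N hN] : exists N, {subset s <= iota 0 N}.
  exists (\max_(k <- s) k).+1 => k ks; rewrite mem_iota /= add0n ltnS.
  exact: (@leq_bigmax_seq _ s xpredT id).
apply: (@le_trans _ _ (\sum_(k <- iota 0 N) 2^-1 ^+ k)).
  by apply: ler_sum_uniq_sub => // k _; apply: exprn_ge0.
have -> : \sum_(k <- iota 0 N) 2^-1 ^+ k = 2 - 2 * 2^-1 ^+ N :> R.
  elim: {us s hN} N => [|N IH]; first by rewrite big_nil expr0; lra.
  by rewrite -(addn1 N) iotaD big_cat /= IH big_seq1 add0n addn1 exprS; lra.
by rewrite lerBlDr lerDl mulr_ge0 // exprn_ge0.
Qed.

Lemma geo_int (s : seq int) (y : int) : uniq s -> \sum_(x <- s) 2^-1 ^+ absz (x - y)%R <= 4 :> R.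
Proof.
move=> us; rewrite (bigID (fun x => y <= x)) /= (_ : 4 = 2 + 2 :> R); last by rewrite -natrD.
apply: lerD; rewrite -big_filter -(big_map (fun x => absz (x - y)%R) xpredT (fun k => 2^-1 ^+ k)); apply: geo_nat;
  rewrite map_inj_in_uniq ?filter_uniq // => a b; rewrite !mem_filter => /andP[ha _] /andP[hb _]; lia.
Qed.

Lemma geo_col (s : seq (int * int)) (b : int * int) : uniq s -> \sum_(c <- s) 2^-1 ^+ d1 c b <= 16%:R :> R.
Proof.
move=> us; pose X := undup (map fst s); pose Y := undup (map snd s).
apply: (@le_trans _ _ (\sum_(c <- [seq (x, y) | x <- X, y <- Y]) 2^-1 ^+ d1 c b)).
  apply: ler_sum_uniq_sub => // c cs; apply/allpairsP; exists c; rewrite -surjective_pairing; split=> //.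
    by rewrite mem_undup map_f.
  by rewrite mem_undup map_f.
rewrite big_allpairs /d1 /=.
under eq_bigr do under eq_bigr do rewrite exprD.
under eq_bigr do rewrite -big_distrr /=.
rewrite -big_distrl /= (_ : 16%:R = 4 * 4 :> R); last by rewrite -natrM.
by apply: ler_pM; rewrite ?geo_int ?undup_uniq // sumr_ge0 // => x _; apply: exprn_ge0.
Qed.

Lemma Dw_le16 K c : Dw R K c <= 16%:R.
Proof.
rewrite /Dw; under eq_bigr do rewrite d1_sym.
by apply: geo_col; rewrite undup_uniq.
Qed.

Lemma Dw_shift K c c' : Dw R K c <= 2 ^+ d1 c c' * Dw R K c'.
Proof.
rewrite /Dw big_distrr /=; apply: ler_sum => b _.
have -> : (2 : R) ^+ d1 c c' = (2^-1 ^+ d1 c c')^-1 by rewrite -exprVn invrK.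
rewrite ler_pdivlMl ?exprn_gt0 // -exprD.
apply: ler_wiXn2l; rewrite ?invr_ge0 ?invf_le1 ?ler1n //.
by rewrite -(d1_sym c'); apply: d1_tri.
Qed.

(** 64 is 4 times 16: a face has at most four projected vertices, and the decay from one vertex sums
    to at most 16 over all columns. *)
Lemma sum_Dw (s : seq face) (k : nat) K : (forall c, (count (fun f => col f == c) s <= k)%N) ->
  \sum_(f <- s) Dw R K (col f) <= k%:R * (64%:R * #|` K|%:R).
Proof.
move=> hk; rewrite (sum_fiber _ col).
apply: (@le_trans _ _ (\sum_(c <- undup [seq col f | f <- s]) k%:R * Dw R K c)).
  apply: ler_sum => c _; rewrite (eq_bigr (fun=> Dw R K c)); last by move=> f /eqP->.
  rewrite -big_filter big_const_seq count_predT iter_addr addr0 -[leLHS]mulr_natl.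
  by rewrite ler_wpM2r ?Dw_ge0 // ler_nat size_filter.
rewrite -mulr_sumr ler_wpM2l // /Dw exchange_big /=.
apply: (@le_trans _ _ (\sum_(b <- vlist K) 16%:R)).
  by apply: ler_sum => b _; apply: geo_col; rewrite undup_uniq.
rewrite big_const_seq count_predT iter_addr addr0 -[leLHS]mulr_natr.
apply: (@le_trans _ _ (16%:R * (4 * #|` K|)%N%:R)); first by rewrite ler_wpM2l // ler_nat size_vlist.
by rewrite natrM mulrA -natrM.
Qed.

Lemma expR_sub1_le (x : R) : expR x - 1 <= x * expR x.
Proof.
have := expR_ge1Dx (- x); rewrite expRN => h.
have e0 := expR_gt0 x; have := ler_wpM2r (ltW e0) h; rewrite mulVf ?gt_eqF //; lra.
Qed.
End DistanceSums.

Section WallSum.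
Variables (R : realType) (s : R).
Hypothesis s0 : 0 <= s.
Hypothesis s1 : 2 * ((81 ^ 2)%:R * (128%:R * (expR 1 * s))) * 384%:R <= 1.

(** A standard wall touches its floor at height 0, hence has a face whose lower height is 0 or -1.
    This leaves boundedly many anchors over each column. *)
Definition stdshape (K : {fset face}) : Prop :=
  connected sadj K /\ exists2 f, f \in K & (ht f == 0) || (ht f == - 1).

(** Let [S] be the inner sum. Then [expR (e1 * S) - 1 <= e1 * S * expR (e1 * S)], with
    [e1 * S <= |V|] in the exponential and [S <= |V| * 64 ^ |V|] times the decay at an anchor of [V]
    in front; hence the base [128 * expR 1 * s]. A column has at most 6 anchors (two heights, three
    orientations), and 384 is 6 times 64. *)
Lemma sum_walls (e1 : R) (K : {fset face}) (l : seq {fset face}) : uniq l -> 0 <= e1 -> 16%:R * e1 <= 1 ->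
  (forall V, V \in l -> stdshape V) ->
  \sum_(V <- l) (expR (e1 * \sum_(q <- V) Dw R K (col q)) - 1) * s ^+ #|` V| <= #|` K|%:R.
Proof.
move=> ul e10 e116 hl.
have anP V : exists f, V \in l -> [/\ connected sadj V, f \in V & (ht f == 0) || (ht f == - 1)].
  have [Vl|nV] := boolP (V \in l); last by exists (hf (0, 0) 0).
  by have [cV [f fV hf_]] := hl _ Vl; exists f.
pose an V := projT1 (cid (anP V)); have anE V := projT2 (cid (anP V)).
set S := fun V : {fset face} => \sum_(q <- V) Dw R K (col q).
have E0 := expR_gt0 (1 : R).
have S0 V : 0 <= S V by apply: sumr_ge0 => q _; apply: Dw_ge0.
have b1 V : e1 * S V <= #|` V|%:R.
  apply: (@le_trans _ _ (e1 * (#|` V|%:R * 16%:R))).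
    rewrite ler_wpM2l // /S; apply: (@le_trans _ _ (\sum_(q <- V) 16%:R)).
      by apply: ler_sum => q _; apply: Dw_le16.
    by rewrite big_const_seq count_predT iter_addr addr0 -[leLHS]mulr_natl.
  by rewrite mulrCA -[leRHS]mulr1 ler_wpM2l // mulrC.
have e11 : e1 <= 1 by apply: le_trans e116; rewrite ler_peMl // ler1n.
have b2 V : V \in l -> e1 * S V <= 128%:R ^+ #|` V| * Dw R K (col (an V)).
  move=> Vl; have [cV fV _] := anE _ Vl.
  apply: (@le_trans _ _ (S V)); first by rewrite ler_piMl.
  apply: (@le_trans _ _ (\sum_(q <- V) 64%:R ^+ #|` V| * Dw R K (col (an V)))).
    rewrite /S big_seq [leRHS]big_seq; apply: ler_sum => q qV.
    apply: le_trans (Dw_shift _ K (col q) (col (an V))) _; rewrite ler_wpM2r ?Dw_ge0 //.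
    rewrite (_ : 64%:R = 2 ^+ 6 :> R); last by rewrite -natrX.
    rewrite -exprM ler_weXn2l ?ler1n //.
    by apply: leq_trans (connected_diam cV qV fV); apply: leq_addr.
  rewrite big_const_seq count_predT iter_addr addr0 -[leLHS]mulr_natl mulrA ler_wpM2r ?Dw_ge0 //.
  rewrite (_ : 128%:R = 2 * 64%:R :> R); last by rewrite -natrM.
  by rewrite exprMn ler_wpM2r ?exprn_ge0 // -natrX ler_nat ltnW // ltn_expl.
set x := 128%:R * (expR 1 * s).
have x0 : 0 <= x by rewrite !mulr_ge0 // ltW.
apply: (@le_trans _ _ (\sum_(V <- l) Dw R K (col (an V)) * x ^+ #|` V|)).
  rewrite big_seq [leRHS]big_seq; apply: ler_sum => V Vl.
  rewrite /x !exprMn !mulrA ler_wpM2r ?exprn_ge0 //.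
  apply: le_trans (expR_sub1_le _) _; rewrite [Dw _ _ _ * _]mulrC; apply: ler_pM.
  - exact: mulr_ge0 e10 (S0 V).
  - exact: expR_ge0.
  - exact: b2.
  - by rewrite -expRM_natl mulr1 ler_expR; apply: b1.
rewrite (sum_fiber _ an).
have anl f : f \in undup [seq an V | V <- l] -> (ht f == 0) || (ht f == - 1).
  by rewrite mem_undup => /mapP[V Vl ->]; have [] := anE _ Vl.
set eta := 2 * ((81 ^ 2)%:R * x).
have eta384 : eta * 384%:R <= 1 by [].
apply: (@le_trans _ _ (\sum_(f <- undup [seq an V | V <- l]) Dw R K (col f) * eta)).
  apply: ler_sum => f _; rewrite (eq_bigr (fun V : {fset face} => Dw R K (col f) * x ^+ #|` V|)); last by move=> V /eqP->.
  rewrite -mulr_sumr ler_wpM2l ?Dw_ge0 // -big_filter big_seq_cond -big_filter.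
  apply: (@sum_connected _ sadj sadj_sym sadj_refl nbf 81 _ _ _ f).
  - exact: sadj_nbf.
  - exact: size_nbf.
  - by rewrite !filter_uniq.
  - exact: x0.
  - have := eta384; rewrite /eta; set y := _ * x; have : 0 <= y by rewrite mulr_ge0.
    lra.
  - move=> V; rewrite !mem_filter => /andP[/andP[/andP[/eqP <- Vl] _] _].
    by have [] := anE _ Vl.
rewrite -mulr_suml; apply: (@le_trans _ _ (6%:R * (64%:R * #|` K|%:R) * eta)).
  rewrite ler_wpM2r ?mulr_ge0 //; apply: sum_Dw => c.
  rewrite -size_filter.
  have -> : 6%N = size [seq (mkpt c.1 c.2 z, d) | z <- [:: 0; -1 : int], d <- [:: i0; i1; i2]] by [].
  apply: uniq_leq_size; first by rewrite filter_uniq // undup_uniq.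
  move=> f; rewrite mem_filter => /andP[/eqP cf /anl hf_]; apply/allpairsP; exists (ht f, f.2); split.
  - by case/orP: hf_ => /eqP->; rewrite !inE eqxx ?orbT.
  - by elim/ord3_ind: (f.2).
  - by case: f cf {hf_} => p d <-; rewrite /ht /= mkptK.
have -> : 6%:R * (64%:R * #|` K|%:R) * eta = #|` K|%:R * (eta * 384%:R) by rewrite (_ : 384%:R = 6%:R * 64%:R :> R) -?natrM //; ring.
by rewrite -[leRHS]mulr1 ler_wpM2l.
Qed.
End WallSum.

(** * Induction on the walls *)

Definition nested (n : nat) (V K : {fset face}) : Prop :=
  (forall c, rhoW V c -> rho_hull K c) /\ (ext n V < ext n K)%N.

Lemma in_unbounded_reach (S : cell2 -> Prop) u v : reach_compl S u v -> in_unbounded S u -> in_unbounded S v.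
Proof.
elim=> [{}u {}v [nu [nv uv]] [_ far]|//|{}u {}v w _ h1 _ h2 /h1/h2 //].
split=> // N; have [w [hw uw]] := far N; exists w; split=> //.
apply: (rt_trans _ _ _ u) uw; apply: rt_step; split=> //; split=> //.
by case: uv => ne h; split; [move=> e; apply: ne|case: h; [right|left]].
Qed.

Lemma rho_hull_mono V K : (forall c, rhoW V c -> rho_hull K c) -> forall c, rho_hull V c -> rho_hull K c.
Proof.
move=> VK c hV uc; apply: hV; split; first by move=> /VK.
move=> N; have [v [hv cv]] := uc.2 N; exists v; split=> //.
elim: cv uc {hv} => {c v} [c v cv uc|c _|c v w cv h1 vw h2 uc].
- have uv : in_unbounded (rhoW K) v by apply: in_unbounded_reach uc; apply: rt_step.
  by apply: rt_step; split; [move=> /VK|split; [move=> /VK|case: cv => _ []]].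
- exact: rt_refl.
- by apply: (rt_trans _ _ _ v); [apply: h1|apply: h2; apply: in_unbounded_reach cv uc].
Qed.

Lemma nested_trans n U V K : nested n U V -> nested n V K -> nested n U K.
Proof.
move=> [h1 h2] [h3 h4]; split; last exact: ltn_trans h4.
by move=> c /h1; apply: rho_hull_mono.
Qed.

Section Induction.
Variables (R : realType) (beta : R) (n m L N : nat).
Variables (lam s rho ep : R).
Hypothesis lamE : lam = expR (- beta).
Hypothesis sE : s = expR (- (beta - 8) / 2).
Hypothesis rhoE : rho = expR (- (beta - 8)).
Hypothesis epE : ep = eps lam.
Hypothesis s1 : 2 * ((81 ^ 2)%:R * (128%:R * (expR 1 * s))) * 384%:R <= 1.
Hypothesis beta0 : 8 <= beta.
Hypothesis ep_tiny : 2592%:R * ep * 65%:R + 81%:R * ep <= 1.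
Hypothesis LN : (L <= N)%N.
Hypothesis Lm : (N + L + 2 * L.+1 + 2 <= m)%N.

Let lam0 : 0 <= lam. Proof. by rewrite lamE expR_ge0. Qed.
Let lam1 : lam <= 1. Proof. by rewrite lamE -expR0 ler_expR oppr_le0; apply: le_trans beta0. Qed.
Let ep0 : 0 <= ep. Proof. by rewrite epE eps_ge0. Qed.
Let e1_ge0 : 0 <= 2592%:R * ep. Proof. exact: mulr_ge0 (ler0n _ _) ep0. Qed.
Lemma lam_small : small_lam lam.
Proof.
have h : ep <= 1.
  apply: le_trans ep_tiny; rewrite -mulrA mulrCA -[leLHS]mulr1 -[leLHS]addr0; apply: lerD; last exact: mulr_ge0 (ler0n _ _) ep0.
  by apply: ler_wpM2l => //; rewrite -natrM ler1n.
by move: h; rewrite epE /eps /small_lam; set x := (81 ^ 2)%:R * _ => h; lra.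
Qed.
Let m0 : (0 < m)%N. Proof. by clear -Lm; lia. Qed.
Let Lm3 : (3 * L.+1 <= m)%N. Proof. by clear -Lm LN; lia. Qed.

Lemma field_ex I : exists T, isif n m I ->
  [/\ dob n m T, conn_field n T, sepf T = Ih n I & Sx n m T = I].
Proof.
(* [flat] is a default value for sets that are not interfaces. *)
have [iI|ni] := pselect (isif n m I); last by exists flat.
by have [T hT] := field_of_isif m0 iI; exists T.
Qed.
Definition fT I : field := projT1 (cid (field_ex I)).
Lemma fTP I : isif n m I ->
  [/\ dob n m (fT I), conn_field n (fT I), sepf (fT I) = Ih n I & Sx n m (fT I) = I].
Proof. exact: projT2 (cid (field_ex I)). Qed.

Definition Slist : seq {fset face} :=
  [seq I <- fpowerset (Win n m) | `[< isif n m I >] && (#|` I| <= L)%N].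

Lemma uniq_Slist : uniq Slist. Proof. by rewrite filter_uniq // fset_uniq. Qed.

Lemma SlistP I : reflect (isif n m I /\ (#|` I| <= L)%N) (I \in Slist).
Proof.
rewrite mem_filter; apply: (iffP andP) => [[/andP[/asboolP]]|[iI cI]] //.
split; first by apply/andP; split=> //; apply/asboolP.
by rewrite fpowersetE; case: iI.
Qed.

Lemma Slist_ifld I : I \in Slist -> ifld n m L (fT I).
Proof.
move=> /SlistP[iI cI]; have [dT cT _ eS] := fTP iI; split; rewrite ?eS //.
apply: (dob_height m0 dT) => f sf; apply: leq_trans (height_bound m0 dT cT sf) _; by rewrite eS.
Qed.

Lemma fT_eq I T : I \in Slist -> dob n m T -> Sx n m T = I -> fT I = T.
Proof.
move=> /SlistP[iI _] dT eS; have [dI _ _ eI] := fTP iI.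
apply/funext => c; apply/funext => z; apply: (sepf_inj dI dT) => f.
by rewrite -(Ih_Sx m0 dI) -(Ih_Sx m0 dT) eS eI.
Qed.

Definition wt (I : {fset face}) : R := lam ^+ #|` I| * Xi ev lam (allowed n m (Ih n I)).
Lemma wt_ge0 I : 0 <= wt I. Proof. by apply: mulr_ge0; [apply: exprn_ge0|apply/ltW/Xi_gt0]. Qed.

(** The two kinds of conditions in the events: standard walls that must be present, and walls that
    must be absent. [B] will depend on projections only; as a deletion creates no new projection, it
    preserves the second kind. *)
Definition good (P : seq {fset face}) (B : {fset face} -> Prop) (I : {fset face}) : Prop :=
  (forall p, p \in P -> stdw (fT I) p) /\ (forall W, iswall (fT I) W -> ~ B W).
Definition Nn P B : R := \sum_(I <- Slist | `[< good P B I >]) wt I.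

Definition mK (K : {fset face}) : nat := (#|` K| - #|` excols K|)%N.

Definition isdel (K I J D : {fset face}) : Prop := exists W f0, [/\ wallf (fT I) f0,
  forall g, (g \in W) = inW (fT I) f0 g, stdof (fT I) W K, fT J = delT n L.+1 (fT I) W f0 &
  D = signs (fT I) (flr n L.+1 (fT I) W f0) K].

Lemma isdel_ex K I : I \in Slist -> stdw (fT I) K ->
  exists J D, [/\ J \in Slist, (D `<=` K)%fset & isdel K I J D].
Proof.
move=> IS [W [[f0 [w0 hW]] sK]]; have iT := Slist_ifld IS.
have iT' := del_ifld Lm3 iT w0 hW sK; have [d' c' k'] := iT'.
set T' := delT _ _ _ _ _ in iT' d' c' k'.
have dm' : dob n m T' := ifld_m Lm3 iT'.
have JS : Sx n m T' \in Slist by apply/SlistP; split=> //; apply: isif_Sx.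
exists (Sx n m T'), (signs (fT I) (flr n L.+1 (fT I) W f0) K); split=> //.
  by apply/fsubsetP => f; rewrite inE /= => /andP[].
by exists W, f0; split=> //; apply: fT_eq.
Qed.

Lemma isdel_inj K I1 I2 J D : I1 \in Slist -> I2 \in Slist -> isdel K I1 J D -> isdel K I2 J D -> I1 = I2.
Proof.
move=> S1 S2 [W1 [f1 [w1 h1 k1 e1 ->]]] [W2 [f2 [w2 h2 k2 e2 eD]]].
have [d1 c1 _] := Slist_ifld S1; have [d2 c2 _] := Slist_ifld S2.
have e : fT I1 =2 fT I2.
  by apply: (delT_inj (ltn0Sn L) d1 c1 d2 c2 w1 h1 w2 h2 k1 k2) => // c z; rewrite -e1 e2.
have /SlistP[/fTP[_ _ _ <-] _] := S1; have /SlistP[/fTP[_ _ _ <-] _] := S2.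
by congr Sx; apply/funext => c; apply/funext => z; apply: e.
Qed.

(* a finite list containing every standard wall: floors have heights in [-m, m] *)
Definition lcand : seq {fset face} :=
  [seq shS (i%:Z - m%:Z) V | i <- iota 0 (2 * m).+1, V <- fpowerset (Win n m)].
(** The candidates for the walls nested in [K], by decreasing extent, which is the order that
    [expand] needs. *)
Definition lK (K : {fset face}) : seq {fset face} :=
  sort (fun U V => ext n V <= ext n U)%N
    [seq V <- undup lcand | `[< nested n V K /\ exists2 I, I \in Slist & stdw (fT I) V >]].

Lemma uniq_lK K : uniq (lK K). Proof. by rewrite sort_uniq filter_uniq // undup_uniq. Qed.

Lemma lKP K V : V \in lK K -> nested n V K /\ exists2 I, I \in Slist & stdw (fT I) V.
Proof. by rewrite mem_sort mem_filter => /andP[/asboolP]. Qed.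

Lemma iswall_sub T W : dob n m T -> iswall T W -> (W `<=` Win n m)%fset.
Proof.
move=> dT [f0 [w0 hW]]; apply/fsubsetP => f; rewrite in_Win => fW.
exact: (W_inwin m0 dT hW fW).
Qed.

Lemma lK_mem K V I : I \in Slist -> stdw (fT I) V -> nested n V K -> V \in lK K.
Proof.
move=> IS sV iV; rewrite mem_sort mem_filter mem_undup; apply/andP; split.
  by apply/asboolP; split=> //; exists I.
have iT := Slist_ifld IS; have [dT _ _] := iT; have dm := ifld_m Lm3 iT.
case: sV => W [wW [g [_ cg _ _ ->]]].
have hb := ceil_bound (ltn0Sn L) dT cg.
apply/allpairsP; exists (absz (m%:Z - ht g)%R, W); split.
- by rewrite mem_iota /=; clear -hb Lm3; lia.
- by rewrite fpowersetE (iswall_sub dm wW).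
- by congr shS => /=; clear -hb Lm3; lia.
Qed.

Lemma lK_shape K V : V \in lK K -> stdshape V.
Proof.
move=> /lKP[_ [I IS [W [[f0 [w0 hW]] [g [hg cg [f fW fg] _ ->]]]]]].
have cW : connected sadj W.
  move=> a b aW bW.
  have h x : x \in W -> fconn sadj W f0 x.
    rewrite hW => /inWP[_ fx].
    have : inW (fT I) f0 x /\ fconn sadj W f0 x; last by case.
    apply: (@conP_stay (wallf (fT I)) (fun x => inW (fT I) f0 x /\ fconn sadj W f0 x) f0) fx.
      move=> u v wu wv [uW cu] uv; have vW := inW_step uW wv uv; split=> //.
      by apply: (rt_trans _ _ _ u _ cu); apply: rt_step; rewrite /crel !hW.
    by split; [apply: inW_refl|apply: rt_refl].
  by apply: (rt_trans _ _ _ f0); [apply: (fconn_sym sadj_sym); apply: h|apply: h].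
split.
  move=> a b; rewrite !in_shS opprK => aW bW; rewrite -(shiftK (ht g) a) -(shiftK (ht g) b).
  elim: (cW _ _ aW bW) => {a b aW bW} [a b [aW [bW ab]]|a|a b c _ h1 _ h2].
  - by apply: rt_step; rewrite /crel !in_shS opprK !shiftNK; split=> //; split=> //; apply: sadj_shift.
  - exact: rt_refl.
  - exact: (rt_trans _ _ _ (shift_face (- ht g) b)).
exists (shift_face (- ht g) f); first by rewrite in_shS opprK shiftNK.
have [b [z [_ fz _ gz]]] := sadjP _ _ fg.
move: gz; rewrite (horizontalP hg) zvE cohtE => /eqP ez; move: fz; rewrite ez /zv ht_shift {ez}; move: (ht f) (ht g) => y y1.
by case: ifP => _; clear; lia.
Qed.

Lemma std_half I V : I \in Slist -> stdw (fT I) V -> (2 * #|` excols V| <= #|` V|)%N /\ (0 < #|` V|)%N.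
Proof.
move=> IS [W [[f0 [w0 hW]] sV]]; have iT := Slist_ifld IS.
split; first exact: (excols_K_half iT w0 hW sV).
rewrite (card_K iT w0 hW sV) cardfs_gt0; apply/fset0Pn; exists f0; by rewrite hW inW_refl.
Qed.

Definition phi (K V : {fset face}) : R := 2592%:R * ep * \sum_(q <- V) Dw R K (col q).
Lemma phi_ge0 K V : 0 <= phi K V.
Proof. by apply: mulr_ge0 => //; apply: sumr_ge0 => q _; apply: Dw_ge0. Qed.

Lemma isdel_card K I J W f0 : I \in Slist -> J \in Slist -> wallf (fT I) f0 ->
  (forall g, (g \in W) = inW (fT I) f0 g) -> stdof (fT I) W K -> fT J = delT n L.+1 (fT I) W f0 ->
  (#|` I| = #|` J| + mK K)%N.
Proof.
move=> IS JS w0 hW sK eJ; have iT := Slist_ifld IS.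
have := del_card Lm3 iT w0 hW sK; have := excols_K_half iT w0 hW sK.
have [/SlistP[/fTP[_ _ _ eI] _] /SlistP[/fTP[_ _ _ eJS] _]] := (IS, JS).
rewrite -eJ eJS eI /mK.
by move: #|` I| #|` J| #|` K| #|` excols K| => a b c d; clear; lia.
Qed.

Lemma ceil_col_uniq T f g : sepf T f -> sepf T g -> ~~ wallf T f -> ~~ wallf T g -> col f = col g -> f = g.
Proof.
rewrite /wallf => sf sg; rewrite sf sg /= !negbK => /andP[hf_ /isceilP[h ch]] /andP[hg _] e.
rewrite (horizontalP hf_) (horizontalP hg) -e; congr hf.
move: sf sg; rewrite (horizontalP hf_) (horizontalP hg) !sepfE -e !ch !cohtE; clear; lia.
Qed.

(** A shifted face is either a ceiling face, at most one per column, or a face of another wall of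
    [I]. On that wall [Gj] is a nonzero constant, so the wall is nested in [K], and its
    standardization is also a wall of [J]. *)
Lemma sum_zone K I J W f0 : I \in Slist -> J \in Slist -> wallf (fT I) f0 ->
  (forall g, (g \in W) = inW (fT I) f0 g) -> stdof (fT I) W K -> fT J = delT n L.+1 (fT I) W f0 ->
  \sum_(q <- Zall n m L (fT I) W) Dw R K (col q) <=
   64%:R * #|` K|%:R + \sum_(V <- lK K | `[< stdw (fT J) V >]) \sum_(q <- V) Dw R K (col q).
Proof.
move=> IS JS w0 hW sK eJ; have iT := Slist_ifld IS; have [dT cT kT] := iT; have dm := ifld_m Lm3 iT.
set T := fT I in w0 hW sK eJ iT dT cT kT dm *.
have mZ q : q \in Zall n m L T W -> [/\ sepf T q, q \notin W & Gj n L.+1 T W (col q) <> 0].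
  by rewrite in_fsetF mem_Sx // => /andP[/andP[sq _] /andP[nW /eqP]].
have eK := K_shift iT w0 hW sK.
rewrite (bigID (fun q => ~~ wallf T q)) /=; apply: lerD.
  rewrite -big_filter; apply: le_trans (@sum_Dw _ _ 1 K _) _; last by rewrite mul1r.
  move=> c; rewrite -size_filter.
  case E: [seq _ <- _ | _] => [//|a l]; apply: (@uniq_leq_size _ (a :: l) [:: a]).
    by rewrite -E !filter_uniq // fset_uniq.
  have h x : x \in a :: l -> [/\ col x = c, ~~ wallf T x & sepf T x].
    by rewrite -E !mem_filter => /andP[/eqP <- /andP[wx /mZ[]]].
  move=> x /h[cx wx sx]; have [|ca wa sa] := h a; first by rewrite mem_head.
  by rewrite inE; apply/eqP; apply: ceil_col_uniq sx sa wx wa _; rewrite cx.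
pose P (V : {fset face}) (q : face) := `[< exists W1, [/\ q \in W1, iswall T W1 & stdof T W1 V] >].
rewrite -big_filter -[leRHS]big_filter; set sw := [seq q <- _ | _]; set J1 := [seq V <- _ | _].
apply: le_trans (@sum_cover _ _ _ sw J1 P _ _ _) _.
- by move=> q _; apply: Dw_ge0.
- move=> q; rewrite mem_filter negbK => /andP[wq /mZ[sq nW Gq]].
  have inS g : inW T q g -> g \in Sx n m T.
    move=> /inW_wallf wg; rewrite mem_Sx //; have sg := wallf_sepf wg; rewrite sg /=.
    apply/negP => /and3P[hor _ nb]; move: wg; rewrite /wallf hor => /andP[_ /negP]; apply.
    by apply/isceilP; exists 0; exact: (ceil_out dT nb).
  pose W1 : {fset face} := [fset g in Sx n m T | inW T q g]%fset.
  have hW1 g : (g \in W1) = inW T q g.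
    by rewrite in_fsetF; apply/andP/idP => [[]//|h]; split=> //; apply: inS.
  have w1 : iswall T W1 by exists q.
  have q1 : q \in W1 by rewrite hW1 inW_refl.
  have ne : W1 <> W by move=> e; move: nW; rewrite -e q1.
  have [k [hk _]] := iswall_del (ltn0Sn L) dT cT w0 hW w1 ne.
  have sV := stdof_ex (ltn0Sn L) dT cT wq hW1.
  set V := shS _ W1 in sV.
  have Gne f : f \in W1 -> Gj n L.+1 T W (col f) <> 0.
    by move=> fW; have [-> _] := hk _ fW; have [<- _] := hk _ q1.
  have swV : stdw (fT J) V.
    rewrite eJ; apply/(del_stdw iT w0 hW sK); split; first by exists W1.
    by move=> e; apply: ne; apply: (stdof_eq iT w1 (wW w0 hW) sV); rewrite e.
  exists V; last by apply/asboolP; exists W1.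
  rewrite mem_filter; apply/andP; split; first exact/asboolP.
  apply: (lK_mem JS swV); split.
    move=> c; rewrite /V rhoW_shS => -[f [fW fc]]; rewrite /rho_hull eK rhoW_shS.
    exact: (zone_hull (ltn0Sn L) dT cT w0 hW (Gne _ fW) fc).
  rewrite /V eK !ext_shS; apply: (zone_ext (ltn0Sn L) dT cT w0 hW).
    by move=> f fW; split; [apply: Gne|case: (hk _ fW)].
  by apply/fset0Pn; exists q.
apply: ler_sum => V _.
have [[q0 /asboolP[W1 [_ w1 sV]]]|no] := pselect (exists q, P V q); last first.
  rewrite [leLHS]big_pred0; first by apply: sumr_ge0 => q _; apply: Dw_ge0.
  by move=> q; apply/negP => h; apply: no; exists q.
have [g [_ _ _ _ eV]] := sV.
rewrite -[leLHS]big_filter; apply: (@ler_sum_inj _ _ _ _ _ (shift_face (- ht g))).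
- by rewrite !filter_uniq // fset_uniq.
- by move=> a b _ _ e; rewrite -(shiftK (- ht g) a) e shiftK.
- move=> q; rewrite mem_filter => /andP[/asboolP[W2 [q2 w2 s2]] _].
  by rewrite eV in_shS opprK shiftNK -(stdof_eq iT w2 w1 s2 sV).
- by move=> q _; rewrite col_shift.
- by move=> q _; apply: Dw_ge0.
Qed.

Lemma wt_del K I J W f0 : I \in Slist -> J \in Slist -> wallf (fT I) f0 ->
  (forall g, (g \in W) = inW (fT I) f0 g) -> stdof (fT I) W K -> fT J = delT n L.+1 (fT I) W f0 ->
  wt I <= lam ^+ mK K * expR #|` K|%:R * expR (\sum_(V <- lK K | `[< stdw (fT J) V >]) phi K V) * wt J.
Proof.
move=> IS JS w0 hW sK eJ; have iT := Slist_ifld IS; have [dT cT kT] := iT.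
have eK := K_shift iT w0 hW sK; have cK := card_K iT w0 hW sK.
have [/SlistP[/fTP[_ _ sI _] cI] /SlistP[/fTP[_ _ sJ _] _]] := (IS, JS).
have vK : vW K = vW W by rewrite eK vW_shS.
rewrite /wt (isdel_card IS JS w0 hW sK eJ) exprD -sI -sJ.
set X := Xi _ _ _; set X' := Xi _ _ (allowed n m (sepf (fT J))).
set S := \sum_(V <- lK K | _) _; set Ej := lam ^+ #|` J|; set Ek := lam ^+ mK K.
suff hX : X <= expR #|` K|%:R * expR S * X'.
  apply: (@le_trans _ _ (Ej * Ek * (expR #|` K|%:R * expR S * X'))); last by rewrite le_eqVlt; apply/orP; left; apply/eqP; ring.
  by apply: ler_wpM2l => //; apply: mulr_ge0; apply: exprn_ge0.
apply: le_trans (del_Xi lam0 lam1 lam_small Lm dT cT kT w0 hW vK) _.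
rewrite -epE -eJ -expRD; apply: ler_wpM2r; first exact/ltW/Xi_gt0.
rewrite ler_expR big_split /= mulrDr -cK.
set Z := Zall _ _ _ _ _.
(* The term due to polymers that reach high up: at most [L <= N < 2 ^ N] faces, each contributing
   [2 ^ -N]. *)
have hz : \sum_(i <- Z) 2^-1 ^+ N <= (#|` K|%:R : R).
  have K1 : (1 <= #|` K|)%N by have [] := std_half IS (ex_intro _ W (conj (wW w0 hW) sK)).
  rewrite big_const_seq count_predT iter_addr addr0 -[leLHS]mulr_natr.
  apply: (@le_trans _ _ 1); last by rewrite ler1n.
  rewrite exprVn mulrC ler_pdivrMr ?exprn_gt0 // mul1r -natrX ler_nat.
  apply: leq_trans (ltnW (ltn_expl N (ltnSn 1))); apply: leq_trans LN; apply: leq_trans kT.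
  by apply: fsubset_leq_card; apply/fsubsetP => q; rewrite in_fsetF => /andP[].
have hs := sum_zone IS JS w0 hW sK eJ.
have eS : S = 2592%:R * ep * \sum_(V <- lK K | `[< stdw (fT J) V >]) \sum_(q <- V) Dw R K (col q) by rewrite mulr_sumr.
rewrite eS; move: hs; set A := \sum_(q <- _) _; set Bs := \sum_(V <- lK K | _) _ => hs.
apply: (@le_trans _ _ (2592%:R * ep * (64%:R * #|` K|%:R + Bs) + 2592%:R * ep * #|` K|%:R + 81%:R * ep * #|` K|%:R)).
  by apply: lerD => //; apply: lerD; apply: ler_wpM2l.
have hk := ler_wpM2r (ler0n R #|` K|) ep_tiny; rewrite mul1r in hk.
rewrite [leLHS](_ : _ = (2592%:R * ep * 65%:R + 81%:R * ep) * #|` K|%:R + 2592%:R * ep * Bs).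
  by rewrite lerD2r.
(* 64 comes from the ceiling faces of the zones, 1 from the polymers that reach high up. *)
have -> : 65%:R = 64%:R + 1 :> R by rewrite -(natrD _ 64 1).
by move: (2592%:R * ep) (81%:R * ep) (64%:R : R) => x y z; ring.
Qed.

Lemma good_del K P B I J W f0 : K \notin P -> (forall W W', rhoW W = rhoW W' -> B W -> B W') ->
  I \in Slist -> good (K :: P) B I -> wallf (fT I) f0 ->
  (forall g, (g \in W) = inW (fT I) f0 g) -> stdof (fT I) W K -> fT J = delT n L.+1 (fT I) W f0 ->
  good P B J.
Proof.
move=> KP Binv IS [gP gB] w0 hW sK eJ; have iT := Slist_ifld IS; rewrite /good eJ; split.
  move=> p pP; apply/(del_stdw iT w0 hW sK); split; first by apply: gP; rewrite inE pP orbT.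
  by move=> e; move: KP; rewrite -e pP.
move=> W2 /(del_walls iT w0 hW)[W1 w1 e] bW; apply: (gB _ w1); exact: Binv bW.
Qed.

Lemma good_cons V P B J : good (V :: P) B J <-> good P B J /\ stdw (fT J) V.
Proof.
split=> [[h1 h2]|[[h1 h2] h3]]; last by split=> // p; rewrite inE => /predU1P[->|/h1].
by split; [split=> // p pP; apply: h1; rewrite inE pP orbT|apply: h1; rewrite mem_head].
Qed.

(** Deleting [V] requires that [V] is not in [P], and the bounds for the walls nested in [V], which
    enter the expansion, require the same of them. *)
Definition isfree (P : seq {fset face}) (V : {fset face}) : Prop :=
  V \notin P /\ forall p, p \in P -> ~ nested n p V.

(* Expanding the product one wall at a time, from the largest extent down, keeps every remaining wall free. *)
Lemma expand B (F : {fset face} -> R) (r : {fset face} -> R) l P : uniq l ->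
  sorted (fun U V => ext n V <= ext n U)%N l ->
  (forall V, 0 <= F V) -> (forall V, 0 <= r V) ->
  (forall V, V \in l -> isfree P V) ->
  (forall V, V \in l -> forall Q, isfree Q V -> Nn (V :: Q) B <= r V * Nn Q B) ->
  \sum_(J <- Slist | `[< good P B J >]) wt J * \prod_(V <- l) (if `[< stdw (fT J) V >] then 1 + F V else 1) <=
  Nn P B * \prod_(V <- l) (1 + F V * r V).
Proof.
move=> ul sl F0 r0; elim: l P ul sl => [|V l IH] P /=.
  by move=> _ _ _ _; rewrite big_nil mulr1; under eq_bigr do rewrite big_nil mulr1.
move=> /andP[Vl ul] sl fP hr.
have sl' := path_sorted sl.
have hl U : U \in l -> (ext n U <= ext n V)%N.
  apply: (allP (_ : all (fun U => ext n U <= ext n V)%N l)); move: sl; apply: order_path_min.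
  by move=> a b c h1 h2; apply: leq_trans h2 h1.
have hr' U : U \in l -> forall Q, isfree Q U -> Nn (U :: Q) B <= r U * Nn Q B.
  by move=> Ul; apply: hr; rewrite inE Ul orbT.
rewrite big_cons; set S := \prod_(U <- l) (1 + F U * r U).
have S0 : 0 <= S by apply: prodr_ge0 => U _; rewrite addr_ge0 // mulr_ge0.
set g := fun J => \prod_(U <- l) (if `[< stdw (fT J) U >] then 1 + F U else 1).
have h1 := IH P ul sl' (fun U Ul => fP U (mem_behead (s := V :: l) Ul)) hr'.
have h2 : \sum_(J <- Slist | `[< good (V :: P) B J >]) wt J * g J <= Nn (V :: P) B * S.
  apply: IH => // U Ul; have [UP iU] := fP U (mem_behead (s := V :: l) Ul); split.
    by rewrite inE negb_or UP andbT; apply: contraNneq Vl => <-.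
  move=> p; rewrite inE => /predU1P[->|]; last exact: iU.
  by case=> _; rewrite ltnNge hl.
have h3 := hr V (mem_head _ _) P (fP V (mem_head _ _)).
apply: (@le_trans _ _ (\sum_(J <- Slist | `[< good P B J >]) wt J * g J +
    F V * \sum_(J <- Slist | `[< good (V :: P) B J >]) wt J * g J)).
  rewrite mulr_sumr big_mkcond [X in _ <= X + _]big_mkcond [X in _ <= _ + X]big_mkcond -big_split /=.
  apply: ler_sum => J _; rewrite big_cons -/(g J).
  case: asboolP => [gP|ng]; last by case: asboolP => [/good_cons[]//|_]; rewrite addr0.
  case: asboolP => [sV|nV]; case: asboolP => [/good_cons[]//|ngV]; rewrite ?addr0 ?mul1r //.
    move=> _ _; lra.
  by case: ngV; apply/good_cons.
apply: (@le_trans _ _ (Nn P B * S + F V * (Nn (V :: P) B * S))).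
  by apply: lerD => //; apply: ler_wpM2l.
apply: (@le_trans _ _ (Nn P B * S + F V * (r V * Nn P B * S))); last by lra.
by apply: lerD => //; apply: ler_wpM2l => //; apply: ler_wpM2r.
Qed.

Lemma rho_lam k : rho ^+ k = lam ^+ k * expR (k * 8)%:R.
Proof.
have -> : (k * 8)%:R = (8 : R) *+ k by rewrite natrM mulr_natl.
by rewrite rhoE lamE -!expRM_natl -expRD; congr expR; rewrite -mulr_natl; ring.
Qed.

Lemma mK_half K I : I \in Slist -> stdw (fT I) K -> (#|` K| <= 2 * mK K)%N.
Proof. by move=> IS /(std_half IS)[h _]; move: h; rewrite /mK; clear; lia. Qed.

Lemma two_le_e : 2 <= expR (1 : R).
Proof. exact: (expR_ge1Dx (1 : R)). Qed.

Lemma rho_ge0 : 0 <= rho. Proof. by rewrite rhoE expR_ge0. Qed.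
Lemma s_ge0 : 0 <= s. Proof. by rewrite sE expR_ge0. Qed.
Lemma s_le1 : s <= 1.
Proof. by rewrite sE -[leRHS]expR0 ler_expR mulNr oppr_le0 divr_ge0 // subr_ge0. Qed.

Lemma rho_s K I : I \in Slist -> stdw (fT I) K -> rho ^+ mK K <= s ^+ #|` K|.
Proof.
move=> IS sK; have -> : rho = s ^+ 2.
  by rewrite rhoE sE -expRM_natl; congr expR; field.
by rewrite -exprM; apply: ler_wiXn2l; [exact: s_ge0|exact: s_le1|exact: mK_half IS sK].
Qed.

Lemma card_fpowerset_size (K : {fset face}) : size (enum_fset (fpowerset K)) = (2 ^ #|` K|)%N.
Proof. exact: card_fpowerset. Qed.

(** Strong induction on the extent. Each [I] is sent injectively to the pair of its deletion [J] and
    the recorded signs; the factor exp(phi) is then expanded over the walls nested in [K], to which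
    the induction hypothesis applies. *)
Lemma del_bound B K P : (forall W W', rhoW W = rhoW W' -> B W -> B W') -> isfree P K ->
  Nn (K :: P) B <= rho ^+ mK K * Nn P B.
Proof.
move=> Binv; have [k] := ubnP (ext n K); elim: k K P => // k IH K P hk [KP fP].
have N0 Q : 0 <= Nn Q B by apply: sumr_ge0 => I _; apply: wt_ge0.
(* If no interface qualifies, the left side is 0. Otherwise [I0] witnesses that [K] is a wall, which
   is what bounds its cardinal by [2 * mK K]. *)
have [[I0 IS0 /good_cons[_ sK0]]|no] := pselect (exists2 I, I \in Slist & good (K :: P) B I); last first.
  apply: (@le_trans _ _ 0); last by apply: mulr_ge0 => //; apply: exprn_ge0; exact: rho_ge0.
  rewrite /Nn big_seq_cond big_pred0 // => I; apply/negP => /andP[IS /asboolP g]; by apply: no; exists I.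
pose F V := expR (phi K V) - 1.
have F0 V : 0 <= F V by rewrite subr_ge0 -expR0 ler_expR phi_ge0.
pose r V := rho ^+ mK V.
have r0 V : 0 <= r V by apply: exprn_ge0; exact: rho_ge0.
pose g J := \prod_(V <- lK K) (if `[< stdw (fT J) V >] then 1 + F V else 1).
have g0 J : 0 <= g J by apply: prodr_ge0 => V _; case: ifP => // _; rewrite addr_ge0.
have gE J : expR (\sum_(V <- lK K | `[< stdw (fT J) V >]) phi K V) = g J.
  rewrite big_mkcond expR_sum; apply: eq_bigr => V _; case: ifP => _; last by rewrite expR0.
  by rewrite /F addrC subrK.
pose c := lam ^+ mK K * expR #|` K|%:R.
have c0 : 0 <= c by rewrite mulr_ge0 ?expR_ge0 // exprn_ge0.
pose s' := [seq J <- Slist | `[< good P B J >]].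
have hex I : exists JD : {fset face} * {fset face}, I \in Slist -> good (K :: P) B I ->
    [/\ JD.1 \in s', (JD.2 `<=` K)%fset, isdel K I JD.1 JD.2 & wt I <= c * (wt JD.1 * g JD.1)].
  have [[IS gI]|nI] := pselect (I \in Slist /\ good (K :: P) B I); last first.
    by exists (fset0, fset0) => IS gI; case: nI.
  have /good_cons[_ sK] := gI; have [J [D [JS DK dJ]]] := isdel_ex IS sK.
  exists (J, D) => _ _ /=; have [W [f0 [w0 hW sW eJ _]]] := dJ; split=> //.
    by rewrite mem_filter JS andbT; apply/asboolP; apply: good_del KP Binv IS gI w0 hW sW eJ.
  by apply: le_trans (wt_del IS JS w0 hW sW eJ) _; rewrite gE -/c -mulrA [g J * _]mulrC.
pose f I := projT1 (cid (hex I)); have fP' I := projT2 (cid (hex I)).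
have memg I : I \in [seq I <- Slist | `[< good (K :: P) B I >]] -> good (K :: P) B I /\ I \in Slist.
  by rewrite mem_filter => /andP[/asboolP].
apply: (@le_trans _ _ (\sum_(JD <- [seq (J, D) | J <- s', D <- fpowerset K]) c * (wt JD.1 * g JD.1))).
  rewrite /Nn -big_filter; apply: (@ler_sum_inj _ _ _ _ _ f).
  - by rewrite filter_uniq // uniq_Slist.
  - move=> I1 I2 /memg[g1 S1] /memg[g2 S2] e.
    have [_ _ d1' _] := fP' I1 S1 g1; have [_ _ d2' _] := fP' I2 S2 g2.
    by apply: isdel_inj S1 S2 d1' _; rewrite -/(f I1) e.
  - move=> I /memg[gI IS]; have [h1 h2 _ _] := fP' I IS gI.
    by apply/allpairsP; exists (f I); rewrite -surjective_pairing fpowersetE.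
  - by move=> I /memg[gI IS]; have [_ _ _] := fP' I IS gI.
  - by move=> JD _; apply: mulr_ge0 => //; apply: mulr_ge0 => //; apply: wt_ge0.
rewrite big_allpairs /=.
under eq_bigr do rewrite big_const_seq count_predT iter_addr addr0 card_fpowerset_size -mulr_natl mulrA.
(* The signs are a subset of [K], so a given [J] is reached at most [2 ^ |K|] times. *)
rewrite -mulr_sumr big_filter.
have hl := @expand B F r (lK K) P (uniq_lK K) _ F0 r0 _ _.
apply: (@le_trans _ _ ((2 ^ #|` K|)%:R * c * (Nn P B * \prod_(V <- lK K) (1 + F V * r V)))).
  apply: ler_wpM2l; first exact: mulr_ge0.
  apply: hl.
  - by apply: sort_sorted => U V; apply: leq_total.
  - move=> V /lKP[iV _]; split; first by apply/negP => VP; apply: (fP V).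
    by move=> p pP ip; apply: (fP p pP); apply: nested_trans ip iV.
  - move=> V /lKP[[_ eV] _] Q fQ; apply: IH => //; exact: leq_trans eV _.
have hprod : \prod_(V <- lK K) (1 + F V * r V) <= expR #|` K|%:R.
  apply: le_trans (prodr_le_expR _) _; first by move=> V _; apply: mulr_ge0.
  rewrite ler_expR; apply: (@le_trans _ _ (\sum_(V <- lK K) F V * s ^+ #|` V|)).
    rewrite big_seq [leRHS]big_seq; apply: ler_sum => V Vl; apply: ler_wpM2l => //.
    by have [_ [I IS sV]] := lKP Vl; apply: rho_s IS sV.
  apply: (@sum_walls _ _ s_ge0 s1 (2592%:R * ep) K (lK K) (uniq_lK K) e1_ge0).
    apply: le_trans ep_tiny; rewrite mulrC -[leLHS]addr0; apply: lerD; last exact: mulr_ge0 (ler0n _ _) ep0.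
    by apply: ler_wpM2l => //; rewrite ler_nat.
  exact: lK_shape.
apply: (@le_trans _ _ ((2 ^ #|` K|)%:R * c * (Nn P B * expR #|` K|%:R))).
  by apply: ler_wpM2l; [exact: mulr_ge0|exact: ler_wpM2l].
have h2 : (2 ^ #|` K|)%:R <= expR #|` K|%:R :> R.
  have -> : expR #|` K|%:R = expR 1 ^+ #|` K| :> R by rewrite -expRM_natl mulr1.
  by rewrite natrX; apply: lerXn2r; rewrite ?nnegrE ?expR_ge0 //; exact: two_le_e.
(* The three factors are the comparison of the contour sums, the expansion and the count of signs;
   together [3 * |K| <= 6 * mK K], below the 8 built into [rho]. *)
have h3 : expR #|` K|%:R * (expR #|` K|%:R * expR #|` K|%:R) <= expR (mK K * 8)%:R :> R.
  rewrite -!expRD ler_expR -!natrD ler_nat.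
  by have := mK_half IS0 sK0; move: #|` K| (mK K) => a b; clear; lia.
rewrite rho_lam /c; move: (N0 P) h2 h3 (exprn_ge0 (mK K) lam0) (expR_ge0 (#|` K|%:R : R)).
move: (expR #|` K|%:R) (2 ^ _)%:R (lam ^+ mK K) (expR (mK K * 8)%:R) (Nn P B).
clear => a t l e N1 N1_ge0 ta ae l0 a0.
apply: (@le_trans _ _ (a * (a * a) * (l * N1))).
  rewrite (_ : a * (a * a) * (l * N1) = a * (l * a) * (N1 * a)); last by ring.
  by apply: ler_wpM2r; [exact: mulr_ge0|apply: ler_wpM2r => //; exact: mulr_ge0].
rewrite (_ : l * e * N1 = e * (l * N1)); last by ring.
by apply: ler_wpM2r => //; exact: mulr_ge0.
Qed.

(** * From configurations to events on interfaces *)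

Definition allI : seq {fset face} := [seq I <- fpowerset (Win n m) | `[< isif n m I >]].

Lemma allIP I : reflect (isif n m I) (I \in allI).
Proof.
rewrite mem_filter; apply: (iffP andP) => [[/asboolP]//|iI]; split; first exact/asboolP.
by rewrite fpowersetE; case: iI.
Qed.

Lemma uniq_allI : uniq allI. Proof. by rewrite filter_uniq // fset_uniq. Qed.

Lemma sum_cfg_event (Q : {fset face} -> Prop) :
  \sum_(c : config n m | `[< Q (Iin n m (scfg c)) >]) lam ^+ energy c = \sum_(I <- allI | `[< Q I >]) wt I.
Proof.
have h (c : config n m) : \sum_(I <- allI | `[< Q I >] && (Iin n m (scfg c) == I)) lam ^+ energy c =
    if `[< Q (Iin n m (scfg c)) >] then lam ^+ energy c else 0.
  have Ii : Iin n m (scfg c) \in allI by apply/allIP; apply: (isif_Iin m0); apply: dob_scfg.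
  rewrite (eq_bigl (fun I => `[< Q (Iin n m (scfg c)) >] && (I == Iin n m (scfg c)))); last first.
    by move=> I; rewrite eq_sym; case: eqVneq => [->|]; rewrite ?andbF.
  case: asboolP => _ /=; last by rewrite big_pred0.
  by rewrite -big_filter filter_pred1_uniq ?uniq_allI // big_seq1.
rewrite [LHS]big_mkcond /=; under eq_bigr do rewrite -h.
rewrite (exchange_big_dep (fun I => `[< Q I >])) /=; last by move=> c I _ /andP[].
rewrite big_seq_cond [RHS]big_seq_cond; apply: eq_bigr => I /andP[/allIP iI qI].
rewrite /wt -(sum_cfg m0 lam0 iI); apply: eq_bigl => c; by rewrite qI.
Qed.

Section Events.
Variables (r : nat) (Ws : 'I_r -> {fset face}) (A : {fset face}) (WA : face -> {fset face}).
Hypothesis aW : admissible_walls Ws.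
Hypothesis aA : admissible_family A WA.
Hypothesis dis : forall c, rho_family A WA c -> forall i, ~ rho_hull (Ws i) c.

Definition EW (I : {fset face}) : Prop := forall i, exists W,
  is_wall_of (fun f => Ih n I f) W /\ std_of (fun f => Ih n I f) W (Ws i).
Definition EA (I : {fset face}) : Prop := forall z, z \in A ->
  if WA z == fset0 then ~ (exists W, is_wall_of (fun f => Ih n I f) W /\ assigned_to z W)
  else exists W, is_wall_of (fun f => Ih n I f) W /\ assigned_to z W /\ std_of (fun f => Ih n I f) W (WA z).

Definition PA : seq {fset face} := [seq WA z | z <- A & WA z != fset0].
Definition BA (W : {fset face}) : Prop := exists z, [/\ z \in A, WA z = fset0 & assigned_to z W].

Lemma assigned_rho z W W' : rhoW W = rhoW W' -> assigned_to z W -> assigned_to z W'.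
Proof. by rewrite /assigned_to /rho_hull => ->. Qed.

Lemma stdof_rho T W K : stdof T W K -> rhoW K = rhoW W.
Proof. by case=> g [_ _ _ _ ->]; rewrite rhoW_shS. Qed.

Lemma EWE I : I \in Slist -> EW I <-> forall i, stdw (fT I) (Ws i).
Proof.
move=> /SlistP[/fTP[dT _ eT _] _]; rewrite /EW -eT.
split=> h i; have [W [h1 h2]] := h i; exists W; split.
- exact/(is_wall_ofE m0 dT).
- exact/(std_ofE m0 dT).
- exact/(is_wall_ofE m0 dT).
- exact/(std_ofE m0 dT).
Qed.

(** Whether a wall is assigned to [z] depends only on its projection, which standardization keeps.
    This part of the conditioning is therefore independent of the interface, and if it fails the
    event is empty. *)
Definition assigned_ok : Prop := forall z, z \in A -> WA z <> fset0 -> assigned_to z (WA z).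

Lemma EAE I : I \in Slist -> EA I <-> assigned_ok /\ good PA BA I.
Proof.
move=> /SlistP[/fTP[dT _ eT _] _]; rewrite /EA -eT.
split=> [h|[ok [gP gB]] z zA].
  split; first by move=> z zA /eqP/negbTE nz; have := h z zA; rewrite nz => -[W [_ [az /(std_ofE m0 dT) /stdof_rho sz]]]; apply: assigned_rho az.
  split=> [p /mapP[z]|W wW [z [zA ez az]]].
    rewrite mem_filter => /andP[/negbTE nz zA] ->; have := h z zA; rewrite nz => -[W [w [_ sz]]].
    by exists W; split; [exact/(is_wall_ofE m0 dT)|exact/(std_ofE m0 dT)].
  have := h z zA; rewrite ez eqxx; apply; exists W; split=> //; exact/(is_wall_ofE m0 dT).
case: ifP => [/eqP ez|nz].
  by move=> [W [/(is_wall_ofE m0 dT) w az]]; apply: (gB W w); exists z.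
have [|W [w sW]] := gP (WA z); first by apply/mapP; exists z; rewrite // mem_filter nz.
exists W; split; first exact/(is_wall_ofE m0 dT).
split; last exact/(std_ofE m0 dT).
by apply: assigned_rho (stdof_rho sW) _; apply: ok => // e; rewrite e eqxx in nz.
Qed.

Lemma std_wall_ex W : is_std_wall W -> exists f, f \in W.
Proof.
move=> [n1 [m1 [c [W0 [[f [wf hf]] [g [_ [_ [_ ->]]]]]]]]].
by exists (shift_face (- g.1 i2) f); apply/imfsetP; exists f => //=; apply/hf; split=> //; apply: rt_refl.
Qed.

Lemma std_wall_vertex W : is_std_wall W -> exists b : int * int, rhoW W (2 * b.1, 2 * b.2).
Proof.
by move=> /std_wall_ex[f fW]; have [b [z [fb _]]] := pv_ex f; exists b, f; split=> //; apply: proj_vertex.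
Qed.

Lemma rhoW_hull W c : rhoW W c -> rho_hull W c. Proof. by move=> h []. Qed.

(** Here the disjointness of the conditioned walls from the hulls enters: such a wall has a vertex
    outside the hull of [Ws i], so it is not nested in [Ws i], and it cannot be [Ws i] itself. *)
Lemma free_PA i : isfree PA (Ws i).
Proof.
have sW := aW.1 i.
have hz p : p \in PA -> exists2 z, z \in A & p = WA z /\ is_std_wall p.
  move=> /mapP[z]; rewrite mem_filter => /andP[nz zA] ->; exists z => //; split=> //.
  by have [e|//] := aA.1 z zA; rewrite e eqxx in nz.
split.
  apply/negP => /hz[z zA [e _]]; have [b hb] := std_wall_vertex sW.
  by apply: (dis _ (rhoW_hull hb)); exists z; rewrite -e.
move=> p /hz[z zA [e sp]] [pW _]; have [b hb] := std_wall_vertex sp.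
by apply: (dis _ (pW _ hb)); exists z; rewrite -e.
Qed.

Lemma Ws_inj : injective Ws.
Proof.
move=> i j e; apply: contrapT => /eqP ne; have [b hb] := std_wall_vertex (aW.1 i).
by apply: (aW.2 i j ne (2 * b.1, 2 * b.2)); rewrite ?dvdz_mulr //= -e.
Qed.

(** With increasing extents, the walls still imposed are at least as extended as [K], so none of
    them is nested in it. *)
Lemma Nn_peel (ws : seq {fset face}) : uniq ws -> sorted (fun U V => ext n U <= ext n V)%N ws ->
  (forall V, V \in ws -> isfree PA V) ->
  Nn (ws ++ PA) BA <= (\prod_(V <- ws) rho ^+ mK V) * Nn PA BA.
Proof.
elim: ws => [|K ws IH] /=; first by rewrite big_nil mul1r.
move=> /andP[Kw uw] sw fw; rewrite big_cons -mulrA.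
apply: (@le_trans _ _ (rho ^+ mK K * Nn (ws ++ PA) BA)).
  apply: del_bound.
    by move=> W W' e [z [zA ez az]]; exists z; split=> //; apply: assigned_rho az.
  have [KP KI] := fw K (mem_head _ _); split; first by rewrite mem_cat negb_or Kw.
  move=> p; rewrite mem_cat => /orP[pw|]; last exact: KI.
  have := order_path_min (fun a b c h1 h2 => leq_trans (h1 : (ext n b <= ext n a)%N) h2 : (ext n b <= ext n c)%N) sw.
  by move=> /allP/(_ _ pw) => h [_]; rewrite ltnNge h.
apply: ler_wpM2l; first by apply: exprn_ge0; exact: rho_ge0.
apply: IH => //; first exact: path_sorted sw.
by move=> V Vw; apply: fw; rewrite inE Vw orbT.
Qed.

Lemma event_bound : \sum_(I <- Slist | `[< EW I /\ EA I >]) wt I <=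
  (\prod_(i < r) rho ^+ mK (Ws i)) * \sum_(I <- Slist | `[< EA I >]) wt I.
Proof.
have [ok|nok] := pselect assigned_ok; last first.
  have nE I : I \in Slist -> ~ EA I by move=> /EAE h /h[].
  rewrite big_seq_cond big_pred0; last by move=> I; apply/negP => /andP[IS /asboolP[_]]; apply: nE.
  apply: mulr_ge0; last by apply: sumr_ge0 => I _; apply: wt_ge0.
  by apply: prodr_ge0 => i _; apply: exprn_ge0; exact: rho_ge0.
pose w0 := [seq Ws i | i <- enum 'I_r].
pose ws := sort (fun U V => ext n U <= ext n V)%N w0.
have w0P V : V \in ws -> exists i, V = Ws i by rewrite mem_sort => /mapP[i _ ->]; exists i.
have -> : \sum_(I <- Slist | `[< EW I /\ EA I >]) wt I = Nn (ws ++ PA) BA.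
  rewrite /Nn big_seq_cond [RHS]big_seq_cond; apply: eq_bigl => I.
  have [IS|//] := boolP (I \in Slist); apply: asbool_equiv_eq; split.
    move=> [/(EWE IS) hW /(EAE IS)[_ [hP hB]]]; split=> // p; rewrite mem_cat => /orP[/w0P[i ->]|]; [exact: hW|exact: hP].
  move=> [hP hB]; split; first by apply/(EWE IS) => i; apply: hP; rewrite mem_cat mem_sort map_f ?mem_enum.
  by apply/(EAE IS); split=> //; split=> // p pP; apply: hP; rewrite mem_cat pP orbT.
have -> : \sum_(I <- Slist | `[< EA I >]) wt I = Nn PA BA.
  rewrite /Nn big_seq_cond [RHS]big_seq_cond; apply: eq_bigl => I.
  have [IS|//] := boolP (I \in Slist); apply: asbool_equiv_eq.
  by split=> [/(EAE IS)[]//|g]; apply/(EAE IS).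
have -> : \prod_(i < r) rho ^+ mK (Ws i) = \prod_(V <- ws) rho ^+ mK V.
  by rewrite (perm_big w0) ?perm_sort //= big_map big_enum.
apply: Nn_peel.
- by rewrite sort_uniq map_inj_uniq ?enum_uniq //; exact: Ws_inj.
- by apply: sort_sorted => U V; apply: leq_total.
- by move=> V /w0P[i ->]; exact: free_PA.
Qed.

(** The interfaces with more than [L] faces are not controlled wall by wall; all of their weight
    goes into the error term. *)
Lemma finite_bound :
  \sum_(c : config n m | `[< walls_event n Ws (spin_ext c) /\ IW_event n A WA (spin_ext c) >]) lam ^+ energy c <=
  (\prod_(i < r) rho ^+ mK (Ws i)) *
    (\sum_(c : config n m | `[< IW_event n A WA (spin_ext c) >]) lam ^+ energy c) +
  \sum_(I <- allI | (L < #|` I|)%N) wt I.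
Proof.
rewrite (eq_bigl (fun c => `[< EW (Iin n m (scfg c)) /\ EA (Iin n m (scfg c)) >])); last first.
  by move=> c; rewrite /walls_event /IW_event (interfaceE m0).
rewrite (sum_cfg_event (fun I => EW I /\ EA I)).
rewrite [X in _ <= _ * X + _](eq_bigl (fun c => `[< EA (Iin n m (scfg c)) >])); last first.
  by move=> c; rewrite /IW_event (interfaceE m0).
rewrite (sum_cfg_event EA) (bigID (fun I : {fset face} => #|` I| <= L)%N) /=.
have hS (Q : pred {fset face}) : \sum_(I <- allI | Q I && (#|` I| <= L)%N) wt I = \sum_(I <- Slist | Q I) wt I.
  rewrite /Slist /allI !big_filter_cond; apply: eq_bigl => I; by rewrite -andbA [Q I && _]andbC.
apply: lerD.
  rewrite hS; apply: le_trans event_bound _; apply: ler_wpM2l.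
    by apply: prodr_ge0 => i _; apply: exprn_ge0; exact: rho_ge0.
  by rewrite -hS [leRHS](bigID (fun I : {fset face} => #|` I| <= L)%N) /= lerDl; apply: sumr_ge0 => I _; apply: wt_ge0.
rewrite big_mkcond [leRHS]big_mkcond; apply: ler_sum => I _; rewrite -ltnNge.
by case: asboolP => _ //=; case: ifP => // _; apply: wt_ge0.
Qed.
End Events.
End Induction.

(** * Large interfaces *)

(** A flat square slightly larger than the box. It contains the outer faces that touch the window,
    so that its union with any interface is connected. *)
Definition Sq (n : nat) : {fset face} := [fset f in
  [seq hf c 0 | c <- [seq (i%:Z - n.+2%:Z, j%:Z - n.+2%:Z) | i <- iota 0 (2 * n + 5), j <- iota 0 (2 * n + 5)]]]%fset.

Lemma in_Sq n f : (f \in Sq n) =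
  [&& horizontal f, ht f == 0, (absz (col f).1 <= n.+2)%N & (absz (col f).2 <= n.+2)%N].
Proof.
rewrite !inE; apply/mapP/and4P => [[c /allpairsP[[i j] /= [hi hj ->]] ->]|[hor /eqP h0 h1 h2]].
  have h (k : nat) : k \in iota 0 (2 * n + 5) -> (absz (k%:Z - n.+2%:Z)%R <= n.+2)%N.
    by rewrite mem_iota; clear; lia.
  by rewrite horizontal_hf cohtE; split=> //; rewrite mkptE; apply: h.
exists (col f); last by rewrite {1}(horizontalP hor) h0.
apply/allpairsP; exists (absz ((col f).1 + n.+2%:Z)%R, absz ((col f).2 + n.+2%:Z)%R) => /=.
move: h1 h2; rewrite /= /col; move: (f.1 i0) (f.1 i1) => x y h1 h2; split.
- by rewrite mem_iota; clear -h1; lia.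
- by rewrite mem_iota; clear -h2; lia.
- by congr pair; [clear -h1|clear -h2]; lia.
Qed.

Lemma Sq_near n m f g : inwin n m f -> horizontal g -> ht g = 0 -> sadj f g -> g \in Sq n.
Proof.
move=> fw hor h0 /sadj_near; rewrite in_Sq hor h0 eqxx.
have : (absz (col f).1 <= n.+1)%N && (absz (col f).2 <= n.+1)%N.
  move: fw; elim/face_ind: f => [[x y] z|d [x y] z]; rewrite inwinE cohtE /inc /inbox /prv.
    by move=> /= h; clear -h; lia.
  by case: d => /= h; clear -h; lia.
by case: (col f) (col g) => x y [x' y']; rewrite /near1 /=; clear; lia.
Qed.

Lemma hf_walk (X : {fset face}) n (c : int * int) : (Sq n `<=` X)%fset -> hf c 0 \in Sq n ->
  fconn sadj X (hf c 0) (hf (0, 0) 0).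
Proof.
move=> /fsubsetP SX; have [k] := ubnP (absz c.1 + absz c.2)%N; elim: k c => // k IH [x y] /= hk cS.
have [/eqP|ne] := boolP ((x, y) == ((0, 0) : int * int)); first by move=> [-> ->]; apply: rt_refl.
have step (c : int * int) : (absz c.1 <= absz x)%N -> (absz c.2 <= absz y)%N ->
    (absz c.1 + absz c.2 < absz x + absz y)%N -> sadj (hf (x, y) 0) (hf c 0) ->
    fconn sadj X (hf (x, y) 0) (hf (0, 0) 0).
  move=> h1 h2 h3 a; have cS' : hf c 0 \in Sq n.
    move: cS; rewrite !in_Sq !horizontal_hf !cohtE /= => /andP[ex ey].
    by apply/andP; split; [exact: leq_trans h1 ex|exact: leq_trans h2 ey].
  apply: (rt_trans _ _ _ (hf c 0)); last by apply: IH => //; exact: leq_trans h3 _.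
  by apply: rt_step; split; [exact: SX|split=> //; exact: SX].
have adj b c : arnd b (x, y) -> arnd b c -> sadj (hf (x, y) 0) (hf c 0).
  by move=> h1 h2; apply/sadjP; exists b, 0; split; rewrite ?pvE ?zvE.
have [x0|x0|x0] := ltrgtP x 0.
- apply: (step (x + 1, y)); try by rewrite /=; clear -x0; lia.
  by apply: (adj (x + 1, y)); rewrite /arnd /= ?addrK !eqxx ?orbT.
- apply: (step (x - 1, y)); try by rewrite /=; clear -x0; lia.
  by apply: (adj (x, y)); rewrite /arnd /= !eqxx ?orbT.
have [y0|y0|y0] := ltrgtP y 0.
- apply: (step (x, y + 1)); try by rewrite /=; clear -y0; lia.
  by apply: (adj (x, y + 1)); rewrite /arnd /= ?addrK !eqxx ?orbT.
- apply: (step (x, y - 1)); try by rewrite /=; clear -y0; lia.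
  by apply: (adj (x, y)); rewrite /arnd /= !eqxx ?orbT.
by move: ne; rewrite x0 y0 eqxx.
Qed.

Lemma connected_Sq n m I : isif n m I -> connected sadj (I `|` Sq n)%fset.
Proof.
move=> [/fsubsetP IW _ cI]; set X := (I `|` Sq n)%fset; pose o := hf (0, 0) 0.
have SX : (Sq n `<=` X)%fset by apply: fsubsetUr.
have hS g : g \in Sq n -> fconn sadj X g o.
  move=> gS; move: (gS); rewrite in_Sq => /and4P[hor /eqP h0 _ _]; rewrite (horizontalP hor) h0 in gS *.
  exact: hf_walk SX gS.
have hX x : x \in X -> fconn sadj X x o.
  rewrite in_fsetU => /orP[xI|]; last exact: hS.
  have [g [gL gx]] := cI _ xI.
  apply: (@conP_stay (Ih n I) (fun y => y \in I -> fconn sadj X y o) g x) => //; last first.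
    by move=> gI; move: (IW _ gI); rewrite in_Win (outL_inwin m gL).
  move=> y z Iy Iz hy yz zI; have zX : z \in X by rewrite in_fsetU zI.
  have yX : y \in X /\ fconn sadj X y o.
    case/orP: Iy => [yI|/and3P[hor /eqP h0 _]]; first by split; [rewrite in_fsetU yI|apply: hy].
    have yS : y \in Sq n by apply: (@Sq_near n m z) => //; [rewrite -in_Win IW|rewrite sadj_sym].
    by split; [rewrite in_fsetU yS orbT|apply: hS].
  by apply: (rt_trans _ _ _ y); [apply: rt_step; split=> //; split; [case: yX|rewrite sadj_sym]|case: yX].
move=> a b /hX ha /hX hb; apply: (rt_trans _ _ _ o) ha _; exact: (fconn_sym sadj_sym).
Qed.

Section Tail.
Variables (R : realType) (lam : R) (n m : nat).
Hypothesis lam_gt0 : 0 < lam.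
Hypothesis lam1 : lam <= 1.
Hypothesis lam_small : small_lam lam.
Hypothesis m0 : (0 < m)%N.
Let lam0 : 0 <= lam. Proof. exact: ltW. Qed.
Let a := #|` Sq n|.

Lemma flat_sub : (Iin n m flat `<=` Sq n)%fset.
Proof.
have dF : dob n m flat by [].
apply/fsubsetP => f /[dup] /in_Iin[fw _] fI.
have : sepf flat f by apply: (Ih_sepf m0 dF); rewrite /Ih fI.
rewrite sepf_flat => /andP[hor /eqP h0]; exact: Sq_near fw hor h0 (sadj_refl f).
Qed.

(** Only polymers next to [Sq n] have to be removed, so the cost does not depend on [m]. *)
Lemma Xi_Win : Xi ev lam (Win n m) <=
  expR (a%:R * (81%:R * eps lam)) * Xi ev lam (allowed n m (Ih n (Iin n m flat))).
Proof.
set I0 := Iin n m flat; pose k f := `[< exists q, Ih n I0 q /\ sadj f q >].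
have -> : allowed n m (Ih n I0) = [fset f in Win n m | ~~ k f]%fset.
  apply/fsetP => f; apply/in_allowed/idP => [[fw h]|].
    by rewrite in_fsetF in_Win fw; apply/asboolPn => -[q [qI /negP]]; apply; apply/negP/negPn/negPn; apply: h.
  rewrite in_fsetF in_Win => /andP[fw /asboolPn nk]; split=> // q qI; apply/negP => fq; by apply: nk; exists q.
apply: le_trans (Xi_peierls lam0 lam1 _ k) _; apply: ler_wpM2r; first exact/ltW/Xi_gt0.
apply: le_trans (polys_le_expR _ _ _ lam0) _; rewrite ler_expR.
set s := badlist _ _ _ _; pose J := [seq f | q <- Sq n, f <- nbf q].
apply: le_trans (@sum_cover _ _ _ s J (fun f X => f \in X) _ _ _) _.
- by move=> X _; rewrite exprn_ge0 // mulr_ge0.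
- move=> X; rewrite mem_filter => /andP[/asboolP[cX [f fX /asboolP[q [qI fq]]] _]].
  rewrite fpowersetE => /fsubsetP XW; have fw : inwin n m f.
    by move: (XW _ fX); rewrite in_fsetU in_fset0 in_Win.
  exists f => //; apply/allpairsPdep; exists q, f; rewrite sadj_nbf 1?sadj_sym //; split=> //.
  have : sepf flat q by apply: (Ih_sepf m0 _ qI).
  by rewrite sepf_flat => /andP[hor /eqP h0]; exact: Sq_near fw hor h0 fq.
rewrite /J big_allpairs_dep /=.
apply: (@le_trans _ _ (\sum_(q <- Sq n) 81%:R * eps lam)); last first.
  by rewrite big_const_seq count_predT iter_addr addr0 -[leLHS]mulr_natl.
apply: ler_sum => q _; apply: (@le_trans _ _ (\sum_(f <- nbf q) eps lam)).
  apply: ler_sum => f _; rewrite -[eps lam]mulr1 -(expr0 (2^-1 : R)).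
  apply: (@sum_polys _ _ lam0 lam_small f 0 s (fun X => f \in X)); first by rewrite filter_uniq // fset_uniq.
  by move=> X; rewrite mem_filter => /andP[/asboolP[cX _ _] _] fX; split.
rewrite big_const_seq count_predT iter_addr addr0 -[leLHS]mulr_natl ler_wpM2r ?eps_ge0 // ler_nat size_nbf.
Qed.

(* [I] is recovered from the connected set [I `|` Sq n] and the trace [I `&` Sq n], so that
   lattice animals bound the number of large interfaces *)
Lemma sum_large (L : nat) : \sum_(I <- allI n m | (L < #|` I|)%N) lam ^+ #|` I| <=
  (2 ^ a)%:R * (lam ^+ a)^-1 * 2^-1 ^+ L.
Proof.
pose l0 : seq {fset face} := [seq I : {fset face} <- allI n m | (L < #|` I|)%N].
have l0P (I : {fset face}) : I \in l0 -> isif n m I /\ (L < #|` I|)%N.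
  by rewrite mem_filter => /andP[h /allIP].
pose Xs : seq {fset face} := undup [seq (J `|` Sq n)%fset | J <- l0].
pose c := (lam ^+ a)^-1 * 2^-1 ^+ L.
have c0 : 0 <= c by apply: mulr_ge0; [rewrite invr_ge0|]; apply: exprn_ge0.
have lam2 : 0 <= 2 * lam by rewrite mulr_ge0.
rewrite -big_filter -/l0.
apply: (@le_trans _ _ (\sum_(XD <- [seq (X, D) | X <- Xs, D <- fpowerset (Sq n)]) c * (2 * lam) ^+ #|` XD.1|)).
  apply: (@ler_sum_inj _ _ _ _ _ (fun I : {fset face} => ((I `|` Sq n)%fset, (I `&` Sq n)%fset))).
  - by rewrite !filter_uniq // fset_uniq.
  - move=> I J _ _ [/fsetP e1 /fsetP e2]; apply/fsetP => f.
    by have := e1 f; have := e2 f; rewrite !in_fsetU !in_fsetI; case: (f \in I); case: (f \in J); case: (f \in Sq n).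
  - move=> I Il; apply/allpairsP; exists ((I `|` Sq n)%fset, (I `&` Sq n)%fset); split=> //=.
      by rewrite mem_undup; apply/mapP; exists I.
    by rewrite fpowersetE fsubsetIr.
  (* [x <= |I| + a] pays for replacing [lam ^ |I|] by [lam ^ x], and [L <= x] gives [2 ^ -L] in
     exchange for the factor [2 ^ x]. *)
  - move=> I /l0P[_ LI] /=; set x := #|` (I `|` Sq n)%fset|.
    have x1 : (x <= #|` I| + a)%N by rewrite /x cardfsU leq_subr.
    have x2 : (L <= x)%N by apply: leq_trans (ltnW LI) _; apply: fsubset_leq_card; apply: fsubsetUl.
    rewrite /c exprMn [2 ^+ x * _]mulrC mulrACA -[leLHS]mulr1; apply: ler_pM => //; first exact: exprn_ge0.
      rewrite mulrC ler_pdivlMr ?exprn_gt0 // -exprD; exact: ler_wiXn2l.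
    rewrite exprVn mulrC ler_pdivlMr ?exprn_gt0 // mul1r; apply: ler_weXn2l => //; by rewrite ler1n.
  - by move=> XD _; apply: mulr_ge0 => //; apply: exprn_ge0.
rewrite big_allpairs /=.
rewrite (eq_bigr (fun X : {fset face} => (2 ^ a)%:R * c * (2 * lam) ^+ #|` X|)); last first.
  by move=> X _; rewrite big_const_seq count_predT iter_addr addr0 card_fpowerset_size -[LHS]mulr_natl mulrA.
rewrite -mulr_sumr -[leRHS]mulrA -/c -[leRHS]mulr1; apply: ler_wpM2l; first exact: mulr_ge0.
have ls : (81 ^ 2)%:R * (2 * lam) <= 2^-1.
  move: lam_small; rewrite /small_lam; apply: le_trans; apply: ler_wpM2l => //.
  by rewrite mulrA; apply: ler_wpM2r => //; rewrite -natrM ler_nat.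
apply: (@le_trans _ _ (2 * ((81 ^ 2)%:R * (2 * lam)))); last by move: ls; move: (_ * _) => y; lra.
apply: (@sum_connected _ sadj sadj_sym sadj_refl nbf 81 _ _ _ (hf (0, 0) 0)) => //.
- exact: sadj_nbf.
- by rewrite undup_uniq.
- move=> X; rewrite mem_undup => /mapP[I /l0P[iI _] ->]; split; last exact: connected_Sq iI.
  by rewrite in_fsetU in_Sq horizontal_hf !cohtE /= orbT.
Qed.

(** The second factor [(lam ^+ a)^-1] comes from bounding the total weight below by that of the flat
    interface. The prefactor of [2^-1 ^+ L] does not depend on [m]. *)
Lemma tail_bound (L : nat) : \sum_(I <- allI n m | (L < #|` I|)%N) wt n m lam I <=
  expR (a%:R * (81%:R * eps lam)) * (2 ^ a)%:R * (lam ^+ a)^-1 * (lam ^+ a)^-1 * 2^-1 ^+ L *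
  \sum_(I <- allI n m) wt n m lam I.
Proof.
set I0 := Iin n m flat; set X0 := Xi ev lam (allowed n m (Ih n I0)).
have hZ : lam ^+ a * X0 <= \sum_(I <- allI n m) wt n m lam I.
  apply: (@le_trans _ _ (wt n m lam I0)).
    apply: ler_wpM2r; first exact/ltW/Xi_gt0.
    by apply: ler_wiXn2l => //; apply: fsubset_leq_card; apply: flat_sub.
  have iA : I0 \in allI n m by apply/allIP; apply: isif_Iin.
  rewrite -[leLHS](big_seq1 +%R); apply: ler_sum_uniq_sub => // [I|I _]; first by rewrite inE => /eqP->.
  by apply: mulr_ge0; [exact: exprn_ge0|exact/ltW/Xi_gt0].
set Z := \sum_(I <- allI n m) _ in hZ *.
apply: (@le_trans _ _ (Xi ev lam (Win n m) * ((2 ^ a)%:R * (lam ^+ a)^-1 * 2^-1 ^+ L))).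
  apply: (@le_trans _ _ (Xi ev lam (Win n m) * \sum_(I <- allI n m | (L < #|` I|)%N) lam ^+ #|` I|)).
    rewrite mulr_sumr; apply: ler_sum => I _; rewrite mulrC; apply: ler_wpM2l; first exact: exprn_ge0.
    by apply: Xi_sub => //; apply/fsubsetP => f /in_allowed[]; rewrite in_Win.
  by apply: ler_wpM2l; [exact/ltW/Xi_gt0|exact: sum_large].
have p0 : 0 <= (2 ^ a)%:R * (lam ^+ a)^-1 * 2^-1 ^+ L.
  by apply: mulr_ge0; [apply: mulr_ge0 => //; rewrite invr_ge0|]; apply: exprn_ge0.
apply: le_trans (ler_wpM2r p0 Xi_Win) _.
have hX : X0 <= (lam ^+ a)^-1 * Z by rewrite mulrC ler_pdivlMr ?exprn_gt0 // mulrC.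
have := ler_wpM2l (mulr_ge0 (expR_ge0 (a%:R * (81%:R * eps lam))) p0) hX.
rewrite -/X0 mulrAC => h; apply: le_trans h _.
by rewrite le_eqVlt; apply/orP; left; apply/eqP; move: (expR _) (lam ^+ a)^-1 (2^-1 ^+ L) (2 ^ a)%:R => x y z t; ring.
Qed.
End Tail.

(** * The limit *)

Section Limit.
Variable R : realType.

(* [limn] of a divergent sequence is [0], and so is a quotient by [0]: only convergent numerators and denominators matter *)
Lemma lim_quotient_le (u v d : nat -> R) (c : R) : 0 <= c -> (forall k, 0 <= v k) ->
  (d @ \oo --> (0 : R))%classic -> (forall k, (4 <= k)%N -> u k <= c * v k + d k) ->
  limn u / limn v <= c.
Proof.
move=> c0 v0 d0 uv.
have [cu|nu] := pselect (cvgn u); last by rewrite dvgP // mul0r.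
have [cv|nv] := pselect (cvgn v); last by rewrite (dvgP nv) invr0 mulr0.
have h : limn u <= c * limn v.
  have hw : ((fun k => c * v k + d k) @ \oo --> c * limn v + 0)%classic.
    by apply: cvgD => //; apply: cvgM => //; apply: cvg_cst.
  by rewrite -[leRHS]addr0; apply: (ler_cvg_to cu hw); exists 4%N => // k; apply: uv.
have [->|vn] := eqVneq (limn v) 0; first by rewrite invr0 mulr0.
rewrite ler_pdivrMr // lt_def vn /=; apply: limr_ge => //; by exists 0%N => // k _; apply: v0.
Qed.

Lemma mul_expRN_le1 (c x : R) : c <= x -> c * expR (- x) <= 1.
Proof.
move=> cx; rewrite expRN ler_pdivrMr ?expR_gt0 // mul1r; apply: le_trans (expR_ge1Dx x).
by apply: le_trans cx _; rewrite lerDr.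
Qed.

Lemma excols_le (W : {fset face}) : (#|` excols W| <= #|` W|)%N.
Proof.
rewrite -[leqRHS](size_map face_cell W); apply: uniq_leq_size; first exact: fset_uniq.
by move=> y /in_excols[f [fW _ ->]]; apply: map_f.
Qed.

Lemma excessE (W : {fset face}) : excess R W = (mK W)%:R.
Proof. by rewrite /excess /mK natrB // excols_le. Qed.

(** The exponential rate is relaxed to a sequence whose limit is already known; any error tending to
    0 will do. *)
Lemma half_pow_harmonic (k : nat) : (4 <= k)%N -> 2^-1 ^+ (k %/ 4 - 1) <= 8 * harmonic k :> R.
Proof.
move=> k4; rewrite /harmonic exprVn ler_pdivlMr ?ltr0n // mulrC ler_pdivrMr ?exprn_gt0 //.
rewrite -natrX -natrM ler_nat; set j := (k %/ 4 - 1)%N.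
apply: (@leq_trans (8 * j.+1)%N); first by rewrite /j; clear -k4; lia.
by rewrite leq_mul2l ltn_expl.
Qed.

Variable beta : R.
Let lam := expR (- beta).

Lemma weightE n m (c : config n m) : weight beta c = lam ^+ energy c.
Proof. by rewrite /weight mulrC expRM_natl. Qed.

Let s := expR (- (beta - 8) / 2).
Let rho := expR (- (beta - 8)).
Hypothesis s1 : 2 * ((81 ^ 2)%:R * (128%:R * (expR 1 * s))) * 384%:R <= 1.
Hypothesis beta8 : 8 <= beta.
Hypothesis ep_tiny : 2592%:R * eps lam * 65%:R + 81%:R * eps lam <= 1.

Lemma cond_bound (n r : nat) (Ws : 'I_r -> {fset face}) (A : {fset face}) (WA : face -> {fset face}) :
  admissible_walls Ws -> admissible_family A WA ->
  (forall c, rho_family A WA c -> forall i, ~ rho_hull (Ws i) c) ->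
  cond_prob beta n (walls_event n Ws) (IW_event n A WA) <= \prod_(i < r) rho ^+ mK (Ws i).
Proof.
move=> aW aA dis; have l0 : 0 < lam by apply: expR_gt0.
have l1 : lam <= 1 by rewrite -[leRHS]expR0 ler_expR oppr_le0; apply: le_trans beta8.
have ls : small_lam lam := lam_small erefl erefl ep_tiny.
have r0 : 0 <= rho by apply: expR_ge0.
set C := expR (#|` Sq n|%:R * (81%:R * eps lam)) * (2 ^ #|` Sq n|)%:R * (lam ^+ #|` Sq n|)^-1 * (lam ^+ #|` Sq n|)^-1.
have C0 : 0 <= C.
  by rewrite /C !mulr_ge0 ?expR_ge0 ?invr_ge0 ?exprn_ge0 // ltW.
rewrite /cond_prob /mu; apply: (@lim_quotient_le _ _ (fun k => C * (8 * harmonic k))).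
- by apply: prodr_ge0 => i _; apply: exprn_ge0.
- by move=> m; rewrite /mu_fin; apply: divr_ge0; apply: sumr_ge0 => c _; apply: expR_ge0.
- rewrite -(mulr0 C) -[X in (_ --> C * X)%classic](mulr0 8).
  by apply: cvgM; [apply: cvg_cst|apply: cvgM; [apply: cvg_cst|apply: cvg_harmonic]].
(* With [N = L] the height condition reads [4 * L + 4 <= m], hence this choice. *)
move=> m m4; set L := (m %/ 4 - 1)%N.
have Lm : (L + L + 2 * L.+1 + 2 <= m)%N by rewrite /L; clear -m4; lia.
have m0 : (0 < m)%N by apply: leq_trans m4.
have Z0 : 0 < \sum_(c : config n m) lam ^+ energy c.
  rewrite (bigD1 (cfg_of n m flat)) //=; apply: ltr_wpDr; last exact: exprn_gt0.
  by apply: sumr_ge0 => c _; apply: exprn_ge0; apply: ltW.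
rewrite /mu_fin; under eq_bigr do rewrite weightE; under [X in _ / X]eq_bigr do rewrite weightE.
under [X in _ <= _ * (X / _) + _]eq_bigr do rewrite weightE; under [X in _ <= _ * (_ / X) + _]eq_bigr do rewrite weightE.
rewrite ler_pdivrMr // mulrDl -(mulrA _ (_ / _)) divfK ?gt_eqF //.
apply: le_trans (finite_bound n (erefl lam) (erefl s) (erefl rho) (erefl (eps lam)) s1 beta8 ep_tiny (leqnn L) Lm aW aA dis) _.
apply: lerD => //; apply: le_trans (tail_bound n l0 l1 ls m0 L) _.
rewrite -/C; have -> : \sum_(I <- allI n m) wt n m lam I = \sum_(c : config n m) lam ^+ energy c.
  have := sum_cfg_event n (erefl lam) Lm (fun=> True).
  by rewrite asboolT //= => ->.
by apply: ler_wpM2r; [exact: ltW|apply: ler_wpM2l => //; exact: half_pow_harmonic].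
Qed.
End Limit.

Theorem theorem3p1 (R : realType) :
  exists C : R, 0 < C /\ exists beta0 : R, forall beta : R, beta0 < beta ->
  forall (n r : nat) (Ws : 'I_r -> {fset face})
         (A : {fset face}) (WA : face -> {fset face}),
    admissible_walls Ws ->
    (forall z, z \in A -> inL0n n z) ->
    admissible_family A WA ->
    (forall c, rho_family A WA c -> forall i, ~ rho_hull (Ws i) c) ->
    cond_prob beta n (walls_event n Ws) (IW_event n A WA)
      <= expR (- (beta - C) * \sum_(i < r) excess R (Ws i)).
Proof.
exists 8; split=> //.
have [c1 c1E] : exists c, c = 2 * ((81 ^ 2)%:R * (128%:R * expR 1)) * 384%:R :> R by eexists.
have [c2 c2E] : exists c, c = (2592%:R * 65%:R + 81%:R) * (2 * ((81 ^ 2)%:R * (64 * 4))) :> R by eexists.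
(* A constant [c] satisfies [c * expR (- x) <= 1] as soon as [c <= x]. This is applied with
   [x = (beta - 8) / 2] to the sum over walls, hence the factor 2, and with [x = beta] to the
   polymer sums. *)
exists (8 + 2 * `|c1| + `|c2|) => beta hb n r Ws A WA aW _ aA dis.
have [g1 g2] := (normr_ge0 c1, normr_ge0 c2); have [n1 n2] := (ler_norm c1, ler_norm c2).
have b8 : 8 <= beta by clear -hb g1 g2; lra.
have h1 : c1 * expR (- ((beta - 8) / 2)) <= 1 by apply: mul_expRN_le1; clear -hb g2 n1; lra.
have h2 : c2 * expR (- beta) <= 1 by apply: mul_expRN_le1; clear -hb g1 n2; lra.
apply: le_trans (cond_bound _ b8 _ n aW aA dis) _.
- rewrite mulNr; apply: le_trans h1; rewrite le_eqVlt; apply/orP; left; apply/eqP; rewrite c1E.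
  by move: (expR (- _)) => w; move: (expR _) (2 : R) (81 ^ 2)%:R 128%:R 384%:R => x y z t p; ring.
- apply: le_trans h2; rewrite le_eqVlt; apply/orP; left; apply/eqP; rewrite c2E /eps.
  by move: (expR _) => w; move: 2592%:R 65%:R 81%:R (81 ^ 2)%:R (64 : R) (4 : R) (2 : R) => x y z t p q u; ring.
rewrite mulr_sumr expR_sum; apply: ler_prod => i _.
by rewrite excessE -expRM_natl (mulrC (mK _)%:R) lexx expR_ge0.
Qed.
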